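(* Let $\alpha>0$ and let $r\in C(0,+\infty)$ satisfy $r(x)>0$ for all $x>0$, $\int_0^1\frac{d\tau}{r(\tau)}=+\infty$, $\int_1^\infty\frac{d\tau}{r(\tau)}=+\infty$, and $\sup_{z>0}\frac{r(z)}{z}<+\infty$. Define $n_\alpha(y):=\int_0^yx^\alpha b(x,y)\,dx$. If $\sup_{y>0}\frac{n_\alpha(y)}{y^\alpha}<+\infty$, then $B$ is $T$-bounded in $X_\alpha$ and $$\lim_{\lambda\to+\infty}\|B(\lambda-T)^{-1}\|_{\mathcal{L}(X_\alpha)}\le\limsup_{a(y)\to+\infty}\frac{n_\alpha(y)}{y^\alpha}.$$ In particular, if $\limsup_{a(y)\to+\infty}\frac{n_\alpha(y)}{y^\alpha}<1$, then $A:=T+B:D(T)\subset X_\alpha\to X_\alpha$ generates a positive $C_0$-semigroup $(V(t))_{t\ge0}$ on $X_\alpha$.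
   Context: $X_{\alpha}:=L^1(\mathbb{R}_+;x^\alpha dx)$, $\mathbb{R}_+=(0,+\infty)$. The total fragmentation rate $a\in L^1_{loc}(0,+\infty)$ is nonnegative. The fragmentation kernel $b(\cdot,\cdot)\ge 0$ is measurable, $b(x,y)=0$ if $x\ge y$, and $\int_0^y x\,b(x,y)\,dx=y$ for $y>0$. For $t\ge0$ and $y>0$, $X(y,t)\in(0,y]$ is defined by $\int_{X(y,t)}^y\frac{d\tau}{r(\tau)}=t$. $T$ is the generator of the positive $C_0$-semigroup $(U(t))_{t\ge0}$ on $X_{\alpha}$ given by $$(U(t)f)(y)=e^{-\int_{X(y,t)}^y\frac{a(p)}{r(p)}dp}\,\frac{r(X(y,t))f(X(y,t))}{r(y)}.$$ $B$ is the fragmentation operator with domain $D(T)$, $(B\varphi)(x)=\int_x^{+\infty}a(y)b(x,y)\varphi(y)\,dy$. $\limsup_{a(y)\to+\infty}g(y):=\lim_{c\to+\infty}\sup_{\{y:\,a(y)\ge c\}}g(y)$, where the supremum over the empty set of a nonnegative function is $0$. *)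

(* Defs.v *)
From HB Require Import structures.
From mathcomp Require Import all_boot all_order all_algebra.
From mathcomp Require Import generic_quotient ring_quotient.
From mathcomp Require Import all_classical all_reals all_analysis.
From mathcomp Require Import measurable_realfun.

Set Implicit Arguments.
Unset Strict Implicit.
Unset Printing Implicit Defensive.

Import Order.TTheory GRing.Theory Num.Def Num.Theory.
Import numFieldNormedType.Exports.

Local Open Scope classical_set_scope.
Local Open Scope ring_scope.
Local Open Scope quotient_scope.

(** L^1(mu) as a normed space of classes.  The library's [LspaceType] carries
    neither a vector space structure nor a norm, so we divide the vector space
    [LfunType mu 1] of integrable functions by the a.e. vanishing ones. *)
Section L1_space.
Context d (T : measurableType d) (R : realType).
Variable mu : {measure set T -> \bar R}.

Local Notation Lf := (LfunType mu (@lexx _ _ 1%E)).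

Definition ae_null : {pred Lf} :=
  fun f => `[< {ae mu, forall x, f x = 0} >].

Lemma ae_null_zmod_closed : zmod_closed ae_null.
Proof.
split; first by apply/asboolP; apply: nearW.
move=> f g /asboolP f0 /asboolP g0; apply/asboolP.
apply: filterS2 f0 g0 => x /= fx gx.
by rewrite -[LHS]/(f x - g x) fx gx subr0.
Qed.

HB.instance Definition _ := GRing.isZmodClosed.Build Lf ae_null
  ae_null_zmod_closed.

Definition L1 : Type := Quotient.quot ae_null.

HB.instance Definition _ := Choice.on L1.
HB.instance Definition _ := GRing.Zmodule.on L1.
HB.instance Definition _ := ZmodQuotient.on L1.

Definition L1_fun (f : L1) : T -> R := (repr f : Lf).

(* The class of [g] if [g] is measurable and mu-integrable, and 0 otherwise. *)
Definition toL1 (g : T -> R) : L1 := \pi_L1 (insubd (0 : Lf) g).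

Definition L1_scale (c : R) (f : L1) : L1 := \pi_L1 (c *: (repr f : Lf)).

Definition L1_norm (f : L1) : R := (\int[mu]_x `|L1_fun f x|)%R.

Lemma L1_piP (f g : Lf) :
  {ae mu, forall x, f x = g x} <-> \pi_L1 f = \pi_L1 g.
Proof.
split=> [fg|/eqP].
  apply/eqP; rewrite -Quotient.idealrBE; apply/asboolP.
  by apply: filterS fg => x fgx; rewrite -[LHS]/(f x - g x) fgx subrr.
rewrite -Quotient.idealrBE => /asboolP.
apply: filterS => x; rewrite -[LHS]/(f x - g x) => /eqP.
by rewrite subr_eq0 => /eqP.
Qed.

Lemma L1_repr_pi (f : Lf) :
  {ae mu, forall x, L1_fun (\pi_L1 f) x = f x}.
Proof. by apply/L1_piP; rewrite reprK. Qed.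

Lemma L1_pi_scale c (f : Lf) : \pi_L1 (c *: f) = L1_scale c (\pi_L1 f).
Proof.
apply/L1_piP; apply: filterS (L1_repr_pi f) => x fx.
by rewrite -[LHS]/(c * f x) -fx.
Qed.

Let scaleA a b (v : L1) : L1_scale a (L1_scale b v) = L1_scale (a * b) v.
Proof.
rewrite -[v]reprK; move: (repr v) => {}v.
by rewrite -(L1_pi_scale b v) -(L1_pi_scale a) -(L1_pi_scale _ v) scalerA.
Qed.

Let scale1 : left_id 1 L1_scale.
Proof.
by move=> v; rewrite -[v]reprK -(L1_pi_scale 1 (repr v)) scale1r.
Qed.

Let scaleDr : right_distributive L1_scale +%R.
Proof.
move=> a u v; rewrite -[u]reprK -[v]reprK; move: (repr u) (repr v) => {}u {}v.
by rewrite -raddfD -(L1_pi_scale a (u + v)) -(L1_pi_scale a u)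
           -(L1_pi_scale a v) scalerDr raddfD.
Qed.

Let scaleDl v : {morph L1_scale^~ v : a b / a + b}.
Proof.
move=> a b; rewrite /= -[v]reprK; move: (repr v) => {}v.
by rewrite -(L1_pi_scale (a + b) v) -(L1_pi_scale a v) -(L1_pi_scale b v)
           scalerDl raddfD.
Qed.

HB.instance Definition _ :=
  GRing.Zmodule_isLmodule.Build R L1 scaleA scale1 scaleDr scaleDl.

Let Lf_integrable (f : Lf) : mu.-integrable setT (EFin \o f).
Proof. exact/Lfun1_integrable/LfunP. Qed.

Let Lf_norm_integrable (f : Lf) : mu.-integrable setT (EFin \o (normr \o f)).
Proof. exact/Lfun1_integrable/Lfun_norm/LfunP. Qed.

Lemma L1_norm_pi (f : Lf) : L1_norm (\pi_L1 f) = \int[mu]_x `|f x|.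
Proof.
rewrite /L1_norm /Rintegral; congr fine; apply: ae_eq_integral => //.
- by have /integrableP[] := Lf_norm_integrable (repr (\pi_L1 f)).
- by have /integrableP[] := Lf_norm_integrable f.
- by apply: filterS (L1_repr_pi f) => x fx _; rewrite fx.
Qed.

Let normD (f g : L1) : L1_norm (f + g) <= L1_norm f + L1_norm g.
Proof.
rewrite -[f]reprK -[g]reprK -raddfD !L1_norm_pi.
move: (repr f) (repr g) => {f g} f g.
rewrite -RintegralD //; try exact: Lf_norm_integrable.
apply: le_Rintegral => //; first exact: Lf_norm_integrable.
  have := integrableD measurableT (Lf_norm_integrable f) (Lf_norm_integrable g).
  by apply: eq_integrable.
by move=> x _; exact: ler_normD.
Qed.

Let normZ (c : R) (f : L1) : L1_norm (c *: f) = `|c| * L1_norm f.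
Proof.
rewrite -[f]reprK -[_ *: _]/(L1_scale _ _) -L1_pi_scale !L1_norm_pi.
rewrite -RintegralZl //; last exact: Lf_norm_integrable.
by apply: eq_Rintegral => x _ /=; rewrite -normrM.
Qed.

Let norm_eq0 (f : L1) : L1_norm f = 0 -> f = 0.
Proof.
rewrite -[f]reprK -(raddf0 (\pi_L1)) L1_norm_pi => f0.
apply/L1_piP; have /integrableP[mf foo] := Lf_integrable (repr f).
have : (\int[mu]_x `|((repr f : Lf) x)%:E| = 0)%E.
  apply/eqP; rewrite -fine_eq0; first exact/eqP.
  by rewrite ge0_fin_numE ?integral_ge0.
by move/(ae_eq_integral_abs _ measurableT mf); apply: filterS => x /(_ I) [].
Qed.

HB.instance Definition _ :=
  Lmodule_isNormed.Build R L1 normD normZ norm_eq0.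

Definition L1_nneg (f : L1) : Prop := {ae mu, forall x, 0 <= L1_fun f x}.

Definition positive_op (P : L1 -> L1) : Prop :=
  forall f, L1_nneg f -> L1_nneg (P f).

End L1_space.

(** An unbounded operator is a pair [D, T] of a domain and a total function
    whose values outside [D] are irrelevant. *)
Section operators.
Context (R : realType) (X : normedModType R).
Implicit Types (D : set X) (T B P : X -> X) (U : R -> X -> X).

Definition bounded_op P : Prop :=
  linear P /\ exists M : R, forall f, `|P f| <= M * `|f|.

Definition opnorm P : \bar R :=
  ereal_sup [set (`|P f|)%:E | f in [set f : X | `|f| <= 1]].

Definition is_resolvent D T (l : R) P : Prop :=
  [/\ bounded_op P,
      forall g, D (P g) /\ l *: P g - T (P g) = g &
      forall f, D f -> P (l *: f - T f) = f].

Definition resolvent_set D T : set R :=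
  [set l | exists P, is_resolvent D T l P].

(* (l - T)^{-1} *)
Definition resolvent D T (l : R) : X -> X :=
  xget (fun=> 0) [set P | is_resolvent D T l P].

Definition rel_bounded D T DB B : Prop :=
  D `<=` DB /\
  exists c1 c2 : R, forall f, D f -> `|B f| <= c1 * `|f| + c2 * `|T f|.

Definition C0_semigroup U : Prop :=
  [/\ forall t, 0 <= t -> bounded_op (U t),
      U 0 = id,
      forall s t, 0 <= s -> 0 <= t -> U (s + t) = U s \o U t &
      forall f, U t f @[t --> 0^'+] --> f].

Definition gen_dom U : set X :=
  [set f | cvg (h^-1 *: (U h f - f) @[h --> 0^'+])].

Definition gen U (f : X) : X := lim (h^-1 *: (U h f - f) @[h --> 0^'+]).

Definition generates D T U : Prop :=
  gen_dom U = D /\ forall f, D f -> gen U f = T f.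

End operators.

(** The measure x^alpha dx on (0,+oo). It lives on R and gives mass 0 to (-oo, 0]; classes modulo a.e.
    equality are therefore classes of functions on (0,+oo). *)

Notation halfline := (`]0, +oo[%classic).

Definition weight {R : realType} (alpha : R) : R -> R :=
  (fun x => x `^ alpha) \_ halfline.

Definition weighted {R : realType} (alpha : R)
    (A : set (measurableTypeR R)) : \bar R :=
  (\int[lebesgue_measure]_(x in A) (weight alpha x)%:E)%E.

Section weighted_measure.
Context {R : realType}.
Variable alpha : R.

Lemma weight_ge0 x : 0 <= weight alpha x.
Proof. by rewrite /weight patchE; case: ifP => // _; exact: powR_ge0. Qed.

Lemma measurable_weight : measurable_fun setT (weight alpha).
Proof.
apply/(measurable_restrictT _ _).1 => //.
apply: measurable_funTS; exact: measurable_powR.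
Qed.

Let weighted0 : weighted alpha set0 = 0%E.
Proof. by rewrite /weighted integral_set0. Qed.

Let weighted_ge0 A : (0 <= weighted alpha A)%E.
Proof. by apply: integral_ge0 => x _; rewrite lee_fin weight_ge0. Qed.

Let weighted_sigma_additive : semi_sigma_additive (weighted alpha).
Proof.
move=> /= F mF tF mUF; rewrite /weighted; apply: cvg_toP.
  apply: ereal_nondecreasing_is_cvgn => m n mn.
  apply: lee_sum_nneg_natr => // k _ _; apply: integral_ge0 => /= x Fkx.
  by rewrite lee_fin weight_ge0.
rewrite ge0_integral_bigcup//=.
- apply/measurable_funTS/measurableT_comp => //; exact: measurable_weight.
- by move=> x _; rewrite lee_fin weight_ge0.
Qed.

HB.instance Definition _ := isMeasure.Build _ _ _ (weighted alpha)
  weighted0 weighted_ge0 weighted_sigma_additive.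

End weighted_measure.

(* X_alpha *)
Definition Xspace {R : realType} (alpha : R) : normedModType R :=
  L1 (weighted alpha).

Section growth_fragmentation.
Context {R : realType}.
Variables (alpha : R) (r a : R -> R) (b : R -> R -> R).
Local Notation leb := (@lebesgue_measure R).

(* X(y,t) *)
Definition flow (y t : R) : R :=
  xget 0 [set x | 0 < x <= y /\
    (\int[leb]_(s in `[x, y]) ((r s)^-1)%:E = t%:E)%E].

Definition transport_fun (t : R) (f : R -> R) : R -> R :=
  (fun y => expR (- \int[leb]_(p in `[flow y t, y]) (a p / r p))
            * (r (flow y t) * f (flow y t) / r y)) \_ halfline.

Definition transport (t : R) (f : Xspace alpha) : Xspace alpha :=
  toL1 (weighted alpha) (transport_fun t (L1_fun f)).

Definition transport_dom : set (Xspace alpha) := gen_dom transport.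

(* T *)
Definition transport_gen : Xspace alpha -> Xspace alpha := gen transport.

Definition frag_fun (f : R -> R) : R -> R :=
  (fun x => \int[leb]_(y in `]x, +oo[) (a y * b x y * f y)) \_ halfline.

(* The f for which the integral defining Bf converges absolutely for almost
   every x and Bf belongs to X_alpha; on this set [frag] carries no default
   value. *)
Definition frag_dom : set (Xspace alpha) :=
  [set f | {ae weighted alpha, forall x,
              leb.-integrable `]x, +oo[
                (fun y => (a y * b x y * L1_fun f y)%:E)} /\
           frag_fun (L1_fun f) \in Lfun (weighted alpha) 1%E].

(* B *)
Definition frag (f : Xspace alpha) : Xspace alpha :=
  toL1 (weighted alpha) (frag_fun (L1_fun f)).

(* n_alpha(y) *)
Definition frag_moment (y : R) : \bar R :=
  (\int[leb]_(x in `]0%R, y[) (x `^ alpha * b x y)%:E)%E.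

(* n_alpha(y) / y^alpha *)
Definition moment_ratio (y : R) : \bar R :=
  (frag_moment y * ((y `^ alpha)^-1)%:E)%E.

(* limsup_{a(y) -> +oo} g(y) for a nonnegative g; the extra point 0 only makes
   the supremum over the empty set equal to 0. *)
Definition limsup_rate (g : R -> \bar R) : \bar R :=
  lim (ereal_sup ([set 0%E] `|` [set g y | y in [set y | 0 < y /\ c <= a y]])
       @[c --> +oo%R]).

End growth_fragmentation.

Arguments transport_dom {R} alpha r a _.
Arguments transport_gen {R} alpha r a _.
Arguments frag_dom {R} alpha a b _.
Arguments frag {R} alpha a b _.

(* Main.v *)
Require Import Defs.
From HB Require Import structures.
From mathcomp Require Import all_boot all_order all_algebra.
From mathcomp Require Import all_classical all_reals all_analysis.
From mathcomp Require Import measurable_realfun.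
From mathcomp Require Import ring lra zify.

Set Implicit Arguments.
Unset Strict Implicit.
Unset Printing Implicit Defensive.

Import Order.TTheory GRing.Theory Num.Theory.
Import numFieldNormedType.Exports.

Local Open Scope classical_set_scope.
Local Open Scope ring_scope.
Local Open Scope quotient_scope.

(** Write [r z <= C z] and [omega = alpha C], so that the weight [y ^ alpha]
    grows at most at the rate [omega] along the flow of [r].

    The resolvent.  Variation of constants gives (l - T)^{-1} as an integral
    operator with an explicit positive kernel.  By Tonelli's theorem and the
    inequality int g e^{-G} <= e^{-G(x)}, where G' = g, absorption consumes
    no more than what is put in ([resolvent_energy]):
      int (l - omega + a(y)) y^alpha |(l - T)^{-1} u| dy <= |u|.
    To see that this operator is the resolvent of the generator of U, which is
    defined by a limit of difference quotients, let K_h be the average of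
    e^{-l s} U(s) over [0, h].  Then (l - T)^{-1} commutes with U(h) and
    U(h) (l - T)^{-1} f = e^{l h} ((l - T)^{-1} f - h K_h f)
    ([resolvent_transport], [transport_resolvent_average]), so it suffices that
    K_h f tends to f ([average_cvg]).  This follows almost everywhere from
    Lebesgue's differentiation theorem, and in norm from Scheffe's lemma,
    because K_h is a positive contraction.

    The fragmentation bound.  The norm of B f is at most
    int a(y) n_alpha(y) |f(y)| dy.  Let S bound n_alpha(y) / y^alpha everywhere
    and s bound it where a(y) >= c.  Then a n_alpha / y^alpha <= s a + c S, and
    the inequality above yields |B (l - T)^{-1}| <= s + c S / (l - omega)
    ([frag_resolvent_bnd]).  Letting l and then c tend to infinity bounds the
    limit.  The limit exists because the norm decreases with l, by the
    resolvent identity and positivity ([frag_opnorm_antitone]).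

    Generation.  If the upper limit is less than 1, then for some w and some
    q < 1 the positive operators K_l = B (l - T)^{-1}, l >= w, have norm at
    most q, and T + B generates a positive semigroup by a theorem of Desch
    ([positive_perturbation]).  For A = T + B - w and v in the domain,
    - A v = (1 - K_w) (w - T) v, so the functional phi f = int (1 - K_w)^{-1} f,
    an equivalent norm on the cone of nonnegative functions, satisfies
    phi (A v) = int T v - w int v <= 0 for v >= 0.  Hence the positive operators
    (1 - h A)^{-1} are contractions for phi, and all their powers are bounded
    by one constant.  That is the hypothesis of the Hille-Yosida theorem
    ([euler_lim_semigroup]), for which the semigroup is constructed as the limit
    of backward Euler schemes of step 2^-k: halving the step changes the result
    by O(2^-k). *)

(** * Linear maps and limits in normed spaces *)

Section linear_maps.
Context (R : pzRingType) (V W : lmodType R) (F : V -> W) (F_lin : linear F).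

Lemma linear_add u v : F (u + v) = F u + F v.
Proof. by rewrite -[u]scale1r F_lin !scale1r. Qed.

Lemma linear_zero : F 0 = 0.
Proof. by apply: (addrI (F 0)); rewrite -linear_add !addr0. Qed.

Lemma linear_scale c u : F (c *: u) = c *: F u.
Proof. by rewrite -[c *: u]addr0 F_lin linear_zero addr0. Qed.

Lemma linear_opp u : F (- u) = - F u.
Proof. by rewrite -scaleN1r linear_scale scaleN1r. Qed.

Lemma linear_sub u v : F (u - v) = F u - F v.
Proof. by rewrite linear_add linear_opp. Qed.

End linear_maps.

Lemma iter_linear (R : pzRingType) (V : lmodType R) (F : V -> V) n :
  linear F -> linear (iter n F).
Proof.
by move=> F_lin; elim: n => [//|n IH] a u v; rewrite !iterS IH F_lin.
Qed.

Definition seq_complete (R : realType) (X : normedModType R) : Prop :=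
  forall u : nat -> X,
    (forall e : R, 0 < e -> exists N, forall m n,
       (N <= m)%N -> (N <= n)%N -> `|u m - u n| <= e) ->
    exists l : X, u @ \oo --> l.

Lemma cvg_near_eq (T : Type) (U : topologicalType) {F : set_system T}
    {FF : Filter F} (f g : T -> U) (l : U) :
  (\forall x \near F, f x = g x) -> f x @[x --> F] --> l -> g x @[x --> F] --> l.
Proof.
by move=> fg; exact: (@cvg_trans _ _ _ _ (@near_eq_cvg _ _ _ FF _ _ fg)).
Qed.

Section normed_limits.
Context (R : realType) (X : normedModType R).
Implicit Types (u v : nat -> X) (l : X).

Lemma cvgn_norm_le u l (B : R) :
  u @ \oo --> l -> (\forall n \near \oo, `|u n| <= B) -> `|l| <= B.
Proof.
move=> ul uB; have nul : `|u n| @[n --> \oo] --> `|l| by exact: cvg_norm.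
rewrite -(cvg_lim _ nul)//; apply: limr_le; first by apply/cvg_ex; exists `|l|.
exact: uB.
Qed.

Section filters.
Context (T : Type) {F : set_system T} {FF : Filter F}.

Lemma cvg_dist_squeeze (u : T -> X) l (e : T -> R) :
  e x @[x --> F] --> 0 -> (\forall x \near F, `|l - u x| <= e x) ->
  u x @[x --> F] --> l.
Proof.
move=> e0 le; apply/cvgrPdist_le => d d0.
have /cvgrPdist_le/(_ d d0) := e0; apply: filterS2 le => x le_x.
rewrite sub0r normrN => ed; apply: le_trans le_x _.
by apply: le_trans ed; exact: ler_norm.
Qed.

Lemma cvg_bounded_linear (G : X -> X) (M : R) (u : T -> X) l :
  linear G -> (forall f, `|G f| <= M * `|f|) -> u x @[x --> F] --> l ->
  G (u x) @[x --> F] --> G l.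
Proof.
move=> G_lin G_bnd ul; apply: (@cvg_dist_squeeze _ _ (fun x => M * `|l - u x|)).
  rewrite -(mulr0 M); apply: cvgM; first exact: cvg_cst.
  rewrite -(normr0 X) -(subrr l); apply: cvg_norm.
  by apply: cvgB => //; exact: cvg_cst.
by apply: nearW => x; rewrite -linear_sub.
Qed.

End filters.

Definition dense_in_norm (D : set X) : Prop :=
  forall f (e : R), 0 < e -> exists2 g, D g & `|f - g| <= e.

Lemma bounded_linear_ext (D : set X) (F G : X -> X) (M : R) :
  dense_in_norm D -> linear F -> linear G ->
  (forall f, `|F f| <= M * `|f|) -> (forall f, `|G f| <= M * `|f|) ->
  (forall f, D f -> F f = G f) -> F =1 G.
Proof.
move=> Dd Fl Gl FM GM FG f; apply/eqP; rewrite -subr_eq0 -normr_le0.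
apply/ler_addgt0Pl => e e0; rewrite addr0.
pose M1 := 1 + `|M|; have M1_gt0 : 0 < M1 by rewrite ltr_pwDl.
have M1E : forall g : X, M * `|g| <= M1 * `|g|.
  move=> g; rewrite ler_wpM2r ?normr_ge0 //; apply: le_trans (ler_norm M) _.
  by rewrite lerDr.
have d_gt0 : 0 < e / 2 / M1 by rewrite !divr_gt0.
have [g Dg fg] := Dd f _ d_gt0.
have -> : F f - G f = F (f - g) - G (f - g).
  by rewrite (linear_sub Fl) (linear_sub Gl) (FG _ Dg) opprB addrA subrK.
apply: le_trans (ler_normB _ _) _.
have FGe : M1 * `|f - g| <= e / 2.
  by rewrite mulrC -ler_pdivlMr.
have := le_trans (FM (f - g)) (M1E _); have := le_trans (GM (f - g)) (M1E _).
move: FGe; move: `|F (f - g)| `|G (f - g)| (M1 * `|f - g|) => p q s; lra.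
Qed.

End normed_limits.

Lemma cvg_two_pow (R : realType) (c : R) : (c / 2 ^+ k) @[k --> \oo] --> (0 : R).
Proof.
rewrite -(mulr0 c); apply: cvgM; first exact: cvg_cst.
under eq_fun do rewrite -exprVn.
by apply: cvg_expr; rewrite gtr0_norm ?invr_gt0 // invf_lt1 ?ltr1n.
Qed.

Section geometric_sequences.
Context (R : realType) (X : normedModType R).

Lemma geometric_cauchy (u : nat -> X) (C q : R) :
  0 <= C -> 0 <= q -> q < 1 ->
  (forall n, `|u n.+1 - u n| <= C * q ^+ n) ->
  forall e : R, 0 < e -> exists N, forall m n,
    (N <= m)%N -> (N <= n)%N -> `|u m - u n| <= e.
Proof.
move=> C0 q0 q1 uq e e0.
have p0 : 0 < 1 - q by rewrite subr_gt0.
have tail N j : `|u (N + j)%N - u N| <= C / (1 - q) * (q ^+ N - q ^+ (N + j)).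
  elim: j => [|j IH]; first by rewrite addn0 !subrr normr0 mulr0.
  rewrite addnS -(subrK (u (N + j)%N) (u _.+1)) -addrA.
  apply: le_trans (ler_normD _ _) _; apply: le_trans (lerD (uq _) IH) _.
  rewrite exprS le_eqVlt; apply/orP; left; apply/eqP.
  by field; rewrite gt_eqF.
have /cvgrPdist_le/(_ (e / 2)) : C / (1 - q) * q ^+ n @[n --> \oo] --> C / (1 - q) * 0.
  by apply: cvgM; [exact: cvg_cst|apply: cvg_expr; rewrite ger0_norm].
rewrite divr_gt0 // => /(_ isT) [N _ HN]; exists N => m n Nm Nn.
have half k : (N <= k)%N -> `|u k - u N| <= e / 2.
  move=> Nk; rewrite -(subnKC Nk); apply: le_trans (tail _ _) _.
  have := HN N (leqnn N); rewrite mulr0 sub0r normrN.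
  rewrite ger0_norm ?mulr_ge0 ?exprn_ge0 ?invr_ge0 ?(ltW p0) //.
  apply: le_trans; rewrite ler_wpM2l ?divr_ge0 ?(ltW p0) //.
  by rewrite gerBl exprn_ge0.
rewrite -(subrK (u N) (u m)) -addrA; apply: le_trans (ler_normD _ _) _.
rewrite [X in _ <= X](splitr e); apply: lerD; first exact: half.
by rewrite distrC half.
Qed.

(** The Cauchy estimate for the Euler schemes needs two applications of the
    generator, so it is available on a dense set only. *)
Lemma bounded_linear_cvg (D : set X) (F : nat -> X -> X) (M : R) :
  seq_complete X -> dense_in_norm D ->
  (forall k, linear (F k)) -> (forall k f, `|F k f| <= M * `|f|) ->
  (forall f, D f -> forall e : R, 0 < e -> exists N, forall m n,
    (N <= m)%N -> (N <= n)%N -> `|F m f - F n f| <= e) ->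
  forall f, cvg (F k f @[k --> \oo]).
Proof.
move=> Xc Dd F_lin F_bnd F_cauchy f; apply/cvg_ex; apply: Xc => e e0.
pose M1 := 1 + `|M|; have M1_gt0 : 0 < M1 by rewrite ltr_pwDl.
have F_bnd1 k (g : X) : `|F k g| <= M1 * `|g|.
  apply: le_trans (F_bnd k g) _; rewrite ler_wpM2r ?normr_ge0 //.
  by apply: le_trans (ler_norm M) _; rewrite lerDr.
have d_gt0 : 0 < e / 3 / M1 by rewrite !divr_gt0.
have [g Dg fg] := Dd f _ d_gt0.
have e3 : 0 < e / 3 by rewrite divr_gt0.
have [N HN] := F_cauchy g Dg _ e3; exists N => m n Nm Nn.
have close k : `|F k f - F k g| <= e / 3.
  rewrite -(linear_sub (F_lin k)); apply: le_trans (F_bnd1 _ _) _.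
  by rewrite mulrC -ler_pdivlMr.
have -> : F m f - F n f = (F m f - F m g) + (F m g - F n g) - (F n f - F n g).
  by rewrite addrA subrK opprB addrA subrK.
apply: le_trans (ler_normB _ _) _; apply: le_trans (lerD (ler_normD _ _) (close n)) _.
have := close m; have := HN m n Nm Nn.
move: `|F m g - F n g| `|F m f - F m g| => p s; lra.
Qed.

End geometric_sequences.

(** * Semigroups from backward Euler schemes *)

(** [J h] is the operator (1 - h A)^{-1}. *)
Section hille_yosida.
Context (R : realType) (X : normedModType R).
Variables (D : set X) (A : X -> X) (J : R -> X -> X) (M : R).
Implicit Types (h s t : R) (f g : X).
Hypothesis X_complete : seq_complete X.
Hypothesis M_ge0 : 0 <= M.
Hypothesis D_dense : dense_in_norm D.
Hypothesis J_lin : forall h, 0 < h -> linear (J h).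
Hypothesis J_pow : forall h n f, 0 < h -> `|iter n (J h) f| <= M * `|f|.
Hypothesis J_right : forall h f, 0 < h -> D (J h f) /\ J h f - h *: A (J h f) = f.
Hypothesis J_left : forall h f, 0 < h -> D f -> J h (f - h *: A f) = f.

Lemma J_bnd h f : 0 < h -> `|J h f| <= M * `|f|.
Proof. exact: (J_pow 1). Qed.

Lemma J_dom h f : 0 < h -> D (J h f).
Proof. by move=> h0; case: (J_right f h0). Qed.

Lemma J_step h f : 0 < h -> D f -> J h f = f + h *: J h (A f).
Proof.
move=> h0 Df; have := J_left h0 Df.
rewrite (linear_sub (J_lin h0)) (linear_scale (J_lin h0)) => {2}<-.
by rewrite subrK.
Qed.

Lemma J_gen_comm h f : 0 < h -> D f -> A (J h f) = J h (A f).
Proof.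
move=> h0 Df; apply: (scalerI (lt0r_neq0 h0)).
have [_ E] := J_right f h0.
have -> : h *: A (J h f) = J h f - f by rewrite -[in X in _ - X]E opprB addrC subrK.
by rewrite [in LHS](J_step h0 Df) addrAC subrr add0r.
Qed.

Lemma J_comm h k f : 0 < h -> 0 < k -> J k (J h f) = J h (J k f).
Proof.
move=> h0 k0; have [Dk E] := J_right f k0.
rewrite -{1}E (linear_sub (J_lin h0)) (linear_scale (J_lin h0)).
by rewrite -(J_gen_comm h0 Dk) (J_left k0) //; exact: J_dom.
Qed.

Lemma J_iter_comm h k n f : 0 < h -> 0 < k ->
  J k (iter n (J h) f) = iter n (J h) (J k f).
Proof.
by move=> h0 k0; elim: n f => [//|n IH] f; rewrite !iterS J_comm // IH.
Qed.

Lemma J_near h f : 0 < h -> D f -> `|J h f - f| <= h * (M * `|A f|).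
Proof.
move=> h0 Df; rewrite (J_step h0 Df) addrAC subrr add0r normrZ gtr0_norm //.
by rewrite ler_wpM2l ?(ltW h0) // J_bnd.
Qed.

Lemma J_iter_near h n f : 0 < h -> D f ->
  `|iter n (J h) f - f| <= n%:R * h * (M * `|A f|).
Proof.
move=> h0 Df; elim: n => [|n IH]; first by rewrite /= subrr normr0 !mul0r.
rewrite iterSr (J_step h0 Df) (linear_add (iter_linear n (J_lin h0))).
rewrite (linear_scale (iter_linear n (J_lin h0))) -iterSr.
rewrite addrAC; apply: le_trans (ler_normD _ _) _.
rewrite -natr1 mulrDl mulrDl mul1r; apply: lerD => //.
by rewrite normrZ gtr0_norm // ler_wpM2l ?(ltW h0) // J_pow.
Qed.

(** Both schemes agree with [f + (k + k) *: A f] up to terms of order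
    [k * k], which involve [A (A f)] alone. *)
Lemma J_halving_error k f : 0 < k -> D f -> D (A f) ->
  `|J (k + k) f - J k (J k f)| <= 7 * (k * k) * (M * `|A (A f)|).
Proof.
move=> k0 Df DAf; have kk0 : 0 < k + k by rewrite addr_gt0.
set w := A (A f); pose p := f + (k + k) *: A f.
have E1 : J (k + k) f - p = ((k + k) * (k + k)) *: J (k + k) w.
  rewrite /p (J_step kk0 Df) (J_step kk0 DAf) scalerDr scalerA.
  by apply/eqP; rewrite subr_eq; apply/eqP; rewrite addrA addrC.
have E2 : J k (J k f) - p = (k * k) *: (J k w + J k w + J k (J k w)).
  rewrite (J_step k0 Df) (J_step k0 DAf) (linear_add (J_lin k0)).
  rewrite (linear_scale (J_lin k0)) (linear_add (J_lin k0)).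
  rewrite (linear_scale (J_lin k0)) (J_step k0 Df) (J_step k0 DAf).
  rewrite /p !scalerDr !scalerA scalerDl.
  set a := k *: A f; set v := (k * k) *: J k w; set z := _ *: J k (J k w).
  apply/eqP; rewrite subr_eq; apply/eqP.
  by rewrite [f + _]addrA -[a + v + z]addrA addrACA addrC !addrA.
have -> : J (k + k) f - J k (J k f) = (J (k + k) f - p) - (J k (J k f) - p).
  by rewrite opprB addrA subrK.
have kk : 0 <= k * k by rewrite mulr_ge0 ?ltW.
apply: le_trans (ler_normB _ _) _; rewrite E1 E2 !normrZ.
have kk2 : 0 <= (k + k) * (k + k) by rewrite mulr_ge0 // ltW.
rewrite (gtr0_norm kk0) (gtr0_norm k0).
have b1 := J_bnd w kk0; have b2 := J_bnd w k0; have b3 := J_pow 2 w k0.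
have b4 : `|J k w + J k w + J k (J k w)| <= 3 * (M * `|w|).
  apply: le_trans (ler_normD _ _) _.
  apply: le_trans (lerD (ler_normD _ _) (lexx _)) _.
  apply: le_trans (lerD (lerD b2 b2) b3) _.
  by rewrite le_eqVlt; apply/orP; left; apply/eqP; ring.
apply: le_trans (lerD (ler_wpM2l kk2 b1) (ler_wpM2l kk b4)) _.
by rewrite le_eqVlt; apply/orP; left; apply/eqP; ring.
Qed.

(** Replacing the steps of length [h] one at a time by two steps of length
    [k] passes each error on through powers of [J h] and [J k], which are
    bounded. The powers [iter m (J k)] make room for the steps that are
    already replaced. *)
Lemma J_telescope h k n m f : 0 < h -> 0 < k ->
  `|iter m (J k) (iter n (J h) f - iter n.*2 (J k) f)| <=
    n%:R * (M * (M * `|J h f - J k (J k f)|)).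
Proof.
move=> h0 k0; elim: n m => [|n IH] m.
  by rewrite /= subrr (linear_zero (iter_linear m (J_lin k0))) normr0 mul0r.
have -> : iter n.+1 (J h) f - iter n.+1.*2 (J k) f =
    iter n (J h) (J h f - J k (J k f)) +
    J k (J k (iter n (J h) f - iter n.*2 (J k) f)).
  rewrite doubleS !(linear_sub (J_lin k0)) (linear_sub (iter_linear n (J_lin h0))).
  by rewrite iterSr !iterS !J_iter_comm // addrA subrK.
rewrite (linear_add (iter_linear m (J_lin k0))) -natr1 mulrDl mul1r addrC.
apply: le_trans (ler_normD _ _) _; apply: lerD.
  by have := IH m.+2; rewrite !iterSr.
apply: le_trans (J_pow m _ k0) _; rewrite ler_wpM2l //; exact: J_pow.
Qed.

Definition mesh (k : nat) : R := (2 ^+ k)^-1.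

Lemma mesh_gt0 k : 0 < mesh k.
Proof. by rewrite invr_gt0 exprn_gt0. Qed.

Lemma meshS k : mesh k = mesh k.+1 + mesh k.+1.
Proof. by rewrite /mesh exprS; field; rewrite expf_neq0. Qed.

Definition steps (k : nat) (t : R) : nat := Num.truncn (t * 2 ^+ k).

Definition euler (k : nat) (t : R) : X -> X := iter (steps k t) (J (mesh k)).

Lemma steps_itv k t : 0 <= t ->
  (steps k t)%:R * mesh k <= t < (steps k t)%:R * mesh k + mesh k.
Proof.
move=> t0; have p0 : 0 < 2 ^+ k :> R by rewrite exprn_gt0.
have := truncn_itv (mulr_ge0 t0 (ltW p0)).
rewrite -/(steps k t) -{3}[mesh k]mul1r -mulrDl natr1.
by rewrite ler_pdivrMr // ltr_pdivlMr.
Qed.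

Lemma steps0 k : steps k 0 = 0%N.
Proof. by rewrite /steps mul0r truncn0. Qed.

Lemma stepsS k t : 0 <= t ->
  steps k.+1 t = (steps k t).*2 \/ steps k.+1 t = (steps k t).*2.+1.
Proof.
move=> t0; have /andP[a1 a2] := steps_itv k t0.
have /andP[b1 b2] := steps_itv k.+1 t0.
have d0 := mesh_gt0 k.+1.
have c1 : (steps k t).*2%:R < (steps k.+1 t).+1%:R :> R.
  rewrite -(ltr_pM2r d0) -muln2 natrM -natr1; rewrite meshS in a1; nra.
have c2 : (steps k.+1 t)%:R < (steps k t).*2.+2%:R :> R.
  rewrite -(ltr_pM2r d0) -muln2 -addn2 natrD natrM; rewrite meshS in a2; nra.
move: c1 c2; rewrite !ltr_nat => c1 c2; lia.
Qed.

Lemma stepsD k s t : 0 <= s -> 0 <= t ->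
  steps k (s + t) = (steps k s + steps k t)%N \/
  steps k (s + t) = (steps k s + steps k t).+1.
Proof.
move=> s0 t0; have /andP[a1 a2] := steps_itv k t0.
have /andP[b1 b2] := steps_itv k s0.
have /andP[c1 c2] := steps_itv k (addr_ge0 s0 t0).
have d0 := mesh_gt0 k.
have e1 : (steps k s + steps k t)%:R < (steps k (s + t)).+1%:R :> R.
  by rewrite -(ltr_pM2r d0) natrD -natr1; lra.
have e2 : (steps k (s + t))%:R < (steps k s + steps k t).+2%:R :> R.
  by rewrite -(ltr_pM2r d0) -addn2 !natrD; lra.
move: e1 e2; rewrite !ltr_nat; lia.
Qed.

Lemma mesh_cvg c : c * mesh k @[k --> \oo] --> 0.
Proof. exact: cvg_two_pow. Qed.

Lemma steps_mesh_cvg t : 0 <= t -> (steps k t)%:R * mesh k @[k --> \oo] --> t.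
Proof.
move=> t0; apply: (@squeeze_cvgr _ _ _ _ (fun k => t - mesh k) (fun=> t)).
- near=> k; have /andP[a1 a2] := steps_itv k t0.
  by rewrite a1 andbT lerBlDr ltW.
- rewrite -[X in _ --> X]subr0; apply: cvgB; first exact: cvg_cst.
  have <- : (fun k => 1 * mesh k) = mesh by apply/funext => k; rewrite mul1r.
  exact: mesh_cvg.
- exact: cvg_cst.
Unshelve. all: by end_near. Qed.

Lemma euler_lin k t : linear (euler k t).
Proof. exact/iter_linear/J_lin/mesh_gt0. Qed.

Lemma euler_bnd k t f : `|euler k t f| <= M * `|f|.
Proof. exact/J_pow/mesh_gt0. Qed.

(** Refining the mesh makes [steps k t] errors of order [mesh k * mesh k],
    and [steps k.+1 t] may exceed twice [steps k t] by one; both effects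
    are of order [mesh k], hence summable in [k]. *)
Lemma euler_refine t f : 0 <= t -> D f -> D (A f) ->
  exists2 C, 0 <= C & forall k, `|euler k.+1 t f - euler k t f| <= C * (2^-1) ^+ k.
Proof.
move=> t0 Df DAf; set w := A (A f).
exists (t * (M * (M * (7 * (M * `|w|)))) + M * (M * `|A f|)).
  by rewrite addr_ge0 ?mulr_ge0.
move=> k; rewrite exprVn -/(mesh k) /euler.
have d0 := mesh_gt0 k.+1; have D0 := mesh_gt0 k.
set n := steps k t; set m := steps k.+1 t.
set Jk := J (mesh k); set Jl := J (mesh k.+1).
have E1 : `|iter n Jk f - iter n.*2 Jl f| <=
    t * (M * (M * (7 * (M * `|w|)))) * mesh k.
  apply: le_trans (J_telescope n 0 f D0 d0) _.
  have b := J_halving_error d0 Df DAf.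
  rewrite -meshS -/Jk -/Jl -/w in b.
  have b' : `|Jk f - Jl (Jl f)| <= mesh k * mesh k * (7 * (M * `|w|)).
    apply: le_trans b _; rewrite [X in _ <= X]mulrA ler_wpM2r ?mulr_ge0 //.
    by rewrite (meshS k); move: (mesh k.+1) d0 => x x0; have := mulr_gt0 x0 x0; lra.
  apply: (@le_trans _ _ (n%:R * (M * (M * (mesh k * mesh k * (7 * (M * `|w|))))))).
    by do !rewrite ler_wpM2l //.
  have -> : n%:R * (M * (M * (mesh k * mesh k * (7 * (M * `|w|))))) =
     (n%:R * mesh k) * ((M * (M * (7 * (M * `|w|)))) * mesh k) by ring.
  rewrite -[X in _ <= X]mulrA ler_wpM2r ?mulr_ge0 ?(ltW D0) //.
  by have /andP[] := steps_itv k t0.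
have E2 : `|iter m Jl f - iter n.*2 Jl f| <= M * (M * `|A f|) * mesh k.
  rewrite /m; case: (stepsS k t0) => ->; rewrite -/n.
    by rewrite subrr normr0 ?mulr_ge0 // ltW.
  rewrite iterSr -(linear_sub (iter_linear _ (J_lin d0))).
  apply: le_trans (J_pow _ _ d0) _; rewrite -mulrA ler_wpM2l //.
  apply: le_trans (J_near d0 Df) _.
  rewrite mulrC ler_wpM2l ?mulr_ge0 // (meshS k) lerDr; exact: ltW.
have -> : iter m Jl f - iter n Jk f =
  (iter m Jl f - iter n.*2 Jl f) - (iter n Jk f - iter n.*2 Jl f).
  by rewrite opprB addrA subrK.
apply: le_trans (ler_normB _ _) _; rewrite mulrDl addrC; exact: lerD.
Qed.

(** Applying [J h] with a small [h] gains one power of the generator. *)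
Lemma dom_sq_dense : dense_in_norm [set f | D f /\ D (A f)].
Proof.
move=> f e e0; have e2 : 0 < e / 2 by rewrite divr_gt0.
have [g Dg fg] := D_dense f e2.
pose B := 1 + M * `|A g|.
have B0 : 0 < B by rewrite ltr_pwDl ?mulr_ge0.
have h0 : 0 < e / 2 / B by rewrite divr_gt0.
exists (J (e / 2 / B) g).
  by split; [exact: J_dom|rewrite J_gen_comm //; exact: J_dom].
rewrite -(subrK g f) -addrA; apply: le_trans (ler_normD _ _) _.
rewrite [X in _ <= X](splitr e); apply: lerD => //.
rewrite distrC; apply: le_trans (J_near h0 Dg) _.
by rewrite mulrAC ler_pdivrMr // ler_wpM2l ?(ltW e2) // lerDr.
Qed.

Lemma euler_cvg t f : 0 <= t -> cvg (euler k t f @[k --> \oo]).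
Proof.
move=> t0; apply: (@bounded_linear_cvg _ _ _ (fun k => euler k t) M X_complete dom_sq_dense).
- by move=> k; exact: euler_lin.
- by move=> k g; exact: euler_bnd.
move=> g [Dg DAg]; have [C C0 HC] := euler_refine t0 Dg DAg.
apply: (geometric_cauchy C0 _ _ HC); first by rewrite invr_ge0.
by rewrite invf_lt1 // ltr1n.
Qed.

Definition euler_lim (t : R) (f : X) : X := lim (euler k t f @[k --> \oo]).

Lemma euler_limP t f : 0 <= t -> euler k t f @[k --> \oo] --> euler_lim t f.
Proof.
move=> t0; have /cvg_ex[l fl] := @euler_cvg t f t0.
by rewrite /euler_lim (cvg_lim _ fl) //; exact: norm_hausdorff.
Qed.

Lemma euler_lim_eq t f l : euler k t f @[k --> \oo] --> l -> euler_lim t f = l.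
Proof. by move=> ul; apply: cvg_lim => //; exact: norm_hausdorff. Qed.

Lemma euler_lim_lin t : 0 <= t -> linear (euler_lim t).
Proof.
move=> t0 a u v; apply: euler_lim_eq.
under eq_fun do rewrite (euler_lin _ _ a u v).
apply: cvgD; last exact: euler_limP.
by apply: cvgZr; exact: euler_limP.
Qed.

Lemma euler_lim_bnd t f : 0 <= t -> `|euler_lim t f| <= M * `|f|.
Proof.
move=> t0; apply: (cvgn_norm_le (@euler_limP t f t0)).
by apply: nearW => k; exact: euler_bnd.
Qed.

Lemma euler_lim0 : euler_lim 0 = id.
Proof.
apply/funext => f; apply: euler_lim_eq.
by rewrite /euler; under eq_fun do rewrite steps0 /=; exact: cvg_cst.
Qed.

Lemma euler_lim_comm h t f : 0 < h -> 0 <= t ->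
  J h (euler_lim t f) = euler_lim t (J h f).
Proof.
move=> h0 t0; apply/esym/euler_lim_eq.
rewrite /euler; under eq_fun do rewrite -(J_iter_comm _ _ (mesh_gt0 _) h0).
by apply: (cvg_bounded_linear (J_lin h0) (fun g => J_bnd g h0)); exact: euler_limP.
Qed.

Lemma euler_lim_comp s t f : 0 <= s -> 0 <= t ->
  euler k s (euler k t f) @[k --> \oo] --> euler_lim s (euler_lim t f).
Proof.
move=> s0 t0; set g := euler_lim t f.
have -> : (fun k => euler k s (euler k t f)) =
    (fun k => euler k s g - euler k s (g - euler k t f)).
  by apply/funext => k; rewrite (linear_sub (euler_lin k s)) opprB addrC subrK.
rewrite -[X in _ --> X]subr0; apply: cvgB; first exact: euler_limP.
apply: (@cvg_dist_squeeze _ _ _ _ _ _ _ (fun k => M * `|g - euler k t f|)).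
  rewrite -(mulr0 M); apply: cvgM; first exact: cvg_cst.
  rewrite -(normr0 X) -(subrr g); apply: cvg_norm.
  by apply: cvgB; [exact: cvg_cst|exact: euler_limP].
by apply: nearW => k; rewrite sub0r normrN; exact: euler_bnd.
Qed.

(** On [D] the composition of the two schemes differs from the scheme for
    [s + t] by at most one step, which costs a multiple of [mesh k]. *)
Lemma euler_limD s t f : 0 <= s -> 0 <= t ->
  euler_lim (s + t) f = euler_lim s (euler_lim t f).
Proof.
move=> s0 t0; have st0 := addr_ge0 s0 t0.
have MM0 : 0 <= M * M by rewrite mulr_ge0.
apply: (@bounded_linear_ext _ _ D _ (euler_lim s \o euler_lim t) (M + M * M) D_dense).
- exact: euler_lim_lin.
- by move=> a u v; rewrite /= euler_lim_lin // euler_lim_lin.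
- move=> g; apply: le_trans (euler_lim_bnd g st0) _.
  by rewrite mulrDl lerDl mulr_ge0.
- move=> g /=; apply: le_trans (euler_lim_bnd _ s0) _.
  rewrite mulrDl -[X in X <= _]add0r lerD ?mulr_ge0 //.
  by rewrite -mulrA ler_wpM2l // euler_lim_bnd.
move=> {}f Df; apply: euler_lim_eq => /=.
have -> : (fun k => euler k (s + t) f) =
    (fun k => euler k s (euler k t f) - (euler k s (euler k t f) - euler k (s + t) f)).
  by apply/funext => k; rewrite opprB addrCA subrr addr0.
rewrite -[X in _ --> X]subr0; apply: cvgB; first exact: euler_lim_comp.
apply: (@cvg_dist_squeeze _ _ _ _ _ _ _ (fun k => M * (M * `|A f|) * mesh k)).
  exact: mesh_cvg.
apply: nearW => k; rewrite sub0r normrN; have d0 := mesh_gt0 k.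
rewrite /euler -iterD; case: (stepsD k s0 t0) => ->.
  by rewrite subrr normr0 !mulr_ge0 // ltW.
rewrite iterSr -(linear_sub (iter_linear _ (J_lin d0))).
apply: le_trans (J_pow _ _ d0) _; rewrite -mulrA ler_wpM2l // distrC mulrC.
exact: J_near.
Qed.

Lemma euler_lim_near t f : 0 <= t -> D f -> `|euler_lim t f - f| <= t * (M * `|A f|).
Proof.
move=> t0 Df.
apply: (@cvgn_norm_le _ _ (fun k => euler k t f - f)).
  by apply: cvgB; [exact: euler_limP|exact: cvg_cst].
apply: nearW => k; apply: le_trans (J_iter_near _ (mesh_gt0 k) Df) _.
by rewrite ler_wpM2r ?mulr_ge0 //; have /andP[] := steps_itv k t0.
Qed.

Lemma euler_lim_continuous f : euler_lim t f @[t --> 0^'+] --> f.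
Proof.
apply/cvgrPdist_le => e e0.
pose K := 2 + M; have K0 : 0 < K by rewrite ltr_pwDl.
have d0 : 0 < e / 2 / K by rewrite !divr_gt0.
have [g Dg fg] := D_dense f d0.
have e2 : 0 < e / 2 / (1 + M * `|A g|) by rewrite !divr_gt0 // ltr_pwDl ?mulr_ge0.
near=> t; have t0 : 0 < t by near: t; exact: nbhs_right_gt.
have te : t <= e / 2 / (1 + M * `|A g|) by near: t; exact: nbhs_right_le.
have -> : f - euler_lim t f = (f - g) - (euler_lim t g - g) - euler_lim t (f - g).
  rewrite (linear_sub (euler_lim_lin (ltW t0))) !opprB.
  by rewrite !addrA !subrK.
have b1 := euler_lim_bnd (f - g) (ltW t0).
have b2 := euler_lim_near (ltW t0) Dg.
apply: le_trans (ler_normB _ _) _.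
apply: le_trans (lerD (ler_normB _ _) (lexx _)) _.
have b3 : t * (M * `|A g|) <= e / 2.
  apply: le_trans (_ : t * (1 + M * `|A g|) <= _).
    by rewrite ler_wpM2l ?(ltW t0) // lerDr.
  by rewrite -ler_pdivlMr // ltr_pwDl ?mulr_ge0.
have b4 : (1 + M) * `|f - g| <= e / 2.
  apply: le_trans (_ : K * `|f - g| <= _).
    by rewrite ler_wpM2r // /K lerD2r lerDl.
  by rewrite mulrC -ler_pdivlMr.
move: b1 b2 b3 b4; rewrite mulrDl mul1r.
move: `|f - g| `|euler_lim t g - g| `|euler_lim t (f - g)| => p q s.
lra.
Unshelve. all: by end_near. Qed.

(** [A f] need not lie in the domain, so [g] approximates it there. *)
Lemma J_iter_taylor h n f g : 0 < h -> D f -> D g ->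
  `|iter n (J h) f - f - (n%:R * h) *: A f| <=
   n%:R * h * ((M + 1) * `|A f - g| + n%:R * h * (M * `|A g|)).
Proof.
move=> h0 Df Dg.
suff H m : (m <= n)%N -> `|iter m (J h) f - f - (m%:R * h) *: A f| <=
   m%:R * h * ((M + 1) * `|A f - g| + n%:R * h * (M * `|A g|)) by exact: H.
elim: m => [|m IH] mn.
  by rewrite /= subrr !mul0r scale0r subr0 normr0.
have -> : iter m.+1 (J h) f - f - (m.+1%:R * h) *: A f =
    (iter m (J h) f - f - (m%:R * h) *: A f) + h *: (iter m.+1 (J h) (A f) - A f).
  rewrite iterSr {1}(J_step h0 Df) (linear_add (iter_linear m (J_lin h0))).
  rewrite (linear_scale (iter_linear m (J_lin h0))) -iterSr -natr1 mulrDl mul1r.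
  by rewrite scalerDl scalerBr opprD [_ + _ - f]addrAC addrACA.
apply: le_trans (ler_normD _ _) _.
rewrite -natr1 mulrDl mulrDl mul1r; apply: lerD; first exact/IH/ltnW.
rewrite normrZ gtr0_norm // ler_wpM2l ?(ltW h0) //.
set K := iter m.+1 (J h).
have K_lin : linear K by exact/iter_linear/J_lin.
have -> : K (A f) - A f = K (A f - g) + (K g - g) - (A f - g).
  by rewrite (linear_sub K_lin) opprB !addrA !subrK.
have b1 : `|K (A f - g)| <= M * `|A f - g| by exact: J_pow.
have b2 : `|K g - g| <= n%:R * h * (M * `|A g|).
  apply: le_trans (J_iter_near _ h0 Dg) _.
  by rewrite ler_wpM2r ?mulr_ge0 // ler_wpM2r ?(ltW h0) // ler_nat.
apply: le_trans (ler_normB _ _) _.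
apply: le_trans (lerD (ler_normD _ _) (lexx _)) _.
apply: le_trans (lerD (lerD b1 b2) (lexx _)) _.
by rewrite mulrDl mul1r addrAC.
Qed.

Lemma euler_lim_taylor t f g : 0 <= t -> D f -> D g ->
  `|euler_lim t f - f - t *: A f| <=
   t * ((M + 1) * `|A f - g| + t * (M * `|A g|)).
Proof.
move=> t0 Df Dg.
apply: (@cvgn_norm_le _ _
  (fun k => euler k t f - f - ((steps k t)%:R * mesh k) *: A f)).
  apply: cvgB; first by apply: cvgB; [exact: euler_limP|exact: cvg_cst].
  by apply: cvgZl; exact: steps_mesh_cvg.
apply: nearW => k; have d0 := mesh_gt0 k.
apply: le_trans (J_iter_taylor _ d0 Df Dg) _.
have /andP[le_t _] := steps_itv k t0.
have p0 : 0 <= (steps k t)%:R * mesh k by rewrite mulr_ge0 // ltW.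
have M1 : 0 <= M + 1 by rewrite addr_ge0.
apply: ler_pM => //.
  by apply: addr_ge0; [exact: mulr_ge0|apply: mulr_ge0 => //; exact: mulr_ge0].
by rewrite lerD2l ler_wpM2r ?mulr_ge0.
Qed.

Lemma euler_lim_deriv f : D f ->
  h^-1 *: (euler_lim h f - f) @[h --> 0^'+] --> A f.
Proof.
move=> Df; apply/cvgrPdist_le => e e0.
pose K := M + 1; have K0 : 0 < K by rewrite ltr_wpDl.
have d0 : 0 < e / 2 / K by rewrite !divr_gt0.
have [g Dg fg] := D_dense (A f) d0.
have e2 : 0 < e / 2 / (1 + M * `|A g|) by rewrite !divr_gt0 // ltr_pwDl ?mulr_ge0.
near=> t; have t0 : 0 < t by near: t; exact: nbhs_right_gt.
have te : t <= e / 2 / (1 + M * `|A g|) by near: t; exact: nbhs_right_le.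
have tn0 : t != 0 by rewrite gt_eqF.
rewrite distrC.
have -> : t^-1 *: (euler_lim t f - f) - A f = t^-1 *: (euler_lim t f - f - t *: A f).
  by rewrite [in RHS]scalerBr scalerA mulVf // scale1r.
rewrite normrZ gtr0_norm ?invr_gt0 // ler_pdivrMl //.
apply: le_trans (euler_lim_taylor (ltW t0) Df Dg) _.
rewrite ler_wpM2l ?(ltW t0) // [X in _ <= X](splitr e); apply: lerD.
  by rewrite mulrC -ler_pdivlMr.
apply: le_trans (_ : t * (1 + M * `|A g|) <= _).
  by rewrite ler_wpM2l ?(ltW t0) // lerDr.
by rewrite -ler_pdivlMr // ltr_pwDl ?mulr_ge0.
Unshelve. all: by end_near. Qed.

(** If the difference quotients of [f] tend to [l], those of [J 1 f] tend
    to [J 1 l], so [A (J 1 f) = J 1 l] and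
    [f = J 1 f - A (J 1 f) = J 1 (f - l)] lies in [D]. *)
Lemma euler_lim_gen_dom : gen_dom euler_lim = D.
Proof.
apply/seteqP; split=> [f|f Df]; last by apply/cvg_ex; exists (A f); exact: euler_lim_deriv.
move=> /cvg_ex[l fl].
have J1l : J 1 (h^-1 *: (euler_lim h f - f)) @[h --> 0^'+] --> J 1 l.
  exact: (cvg_bounded_linear (J_lin ltr01) (fun g => J_bnd g ltr01) fl).
have DJ : D (J 1 f) by exact: J_dom.
have E : J 1 l = A (J 1 f).
  rewrite -(cvg_lim (@norm_hausdorff _ _) (euler_lim_deriv DJ)).
  apply/esym; apply: cvg_lim => //.
  apply: (cvg_near_eq _ J1l); near=> h.
  have h0 : 0 < h by near: h; exact: nbhs_right_gt.
  rewrite (linear_scale (J_lin ltr01)) (linear_sub (J_lin ltr01)).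
  by rewrite euler_lim_comm // ltW.
have [_] := J_right f ltr01; rewrite scale1r -E -(linear_sub (J_lin ltr01)) => <-.
exact: J_dom.
Unshelve. all: by end_near. Qed.

(** The theorem of Hille and Yosida. Dyadic backward Euler schemes take the
    place of the exponentials of the Yosida approximations, so that the
    proof handles powers of resolvents only and no vector-valued integrals. *)
Theorem euler_lim_semigroup :
  C0_semigroup euler_lim /\ generates D A euler_lim.
Proof.
split.
  split.
  - move=> t t0; split; first exact: euler_lim_lin.
    by exists M => f; exact: euler_lim_bnd.
  - exact: euler_lim0.
  - by move=> s t s0 t0; apply/funext => f; exact: euler_limD.
  - exact: euler_lim_continuous.
split; first exact: euler_lim_gen_dom.
move=> f Df; apply: cvg_lim => //.
exact: euler_lim_deriv.
Qed.

End hille_yosida.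

(** * Exponential shifts and Neumann series *)

Section exponential_shift.
Context (R : realType) (X : normedModType R).

Lemma expR_quotient_cvg (w : R) : h^-1 * (expR (w * h) - 1) @[h --> 0^'+] --> w.
Proof.
have h0 : h @[h --> 0^'+] --> (0 : R) by exact: cvg_at_right_filter cvg_id.
apply: (@squeeze_cvgr _ _ _ _ (fun=> w) (fun h => w + 2 * w ^+ 2 * h)).
- near=> h; have h_gt0 : 0 < h by near: h; exact: nbhs_right_gt.
  have wh : w * h <= 2^-1.
    have W : 0 < 1 + `|w| by rewrite ltr_pwDl.
    have : h <= 2^-1 / (1 + `|w|) by near: h; apply: nbhs_right_le; rewrite divr_gt0.
    rewrite ler_pdivlMr // mulrC => ?; apply: le_trans (_ : (1 + `|w|) * h <= _) => //.
    by rewrite ler_pM2r //; apply: le_trans (ler_norm w) _; rewrite lerDr.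
  set x := w * h in wh *; have p : 0 < 1 - x by lra.
  have e1 := expR_ge1Dx x; have e2 := expR_ge1Dx (- x).
  have e3 : expR x <= (1 - x)^-1.
    by rewrite -lef_pV2 ?posrE ?expR_gt0 ?invr_gt0 // invrK -expRN.
  rewrite ler_pdivlMl // [h * w]mulrC -/x lerBrDl e1 /=.
  rewrite ler_pdivrMl // lerBlDr; apply: le_trans e3 _.
  rewrite -[X in X <= _]mul1r ler_pdivrMr //.
  have -> : h * (w + 2 * w ^+ 2 * h) = x + 2 * x ^+ 2 by rewrite /x; ring.
  have : 0 <= x ^+ 2 by exact: sqr_ge0.
  have -> : (x + 2 * x ^+ 2 + 1) * (1 - x) = 1 + x ^+ 2 * (1 - 2 * x) by ring.
  by move=> x2; rewrite lerDl mulr_ge0 //; lra.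
- exact: cvg_cst.
- rewrite -[X in _ --> X]addr0 -[X in _ + X](mulr0 (2 * w ^+ 2)).
  by apply: cvgD; [exact: cvg_cst|apply: cvgM => //; exact: cvg_cst].
Unshelve. all: by end_near. Qed.

Lemma expR_right_cvg (w : R) : expR (w * h) @[h --> 0^'+] --> (1 : R).
Proof.
have h0 : h @[h --> 0^'+] --> (0 : R) by exact: cvg_at_right_filter cvg_id.
have -> : (fun h => expR (w * h)) = (fun h => expR (w * h) - 1 + 1).
  by apply/funext => h; rewrite subrK.
rewrite -[X in _ --> X]add0r; apply: cvgD; last exact: cvg_cst.
rewrite -[X in _ --> X](mul0r w); apply: (@cvg_near_eq _ _ _ _ (fun h => h * (h^-1 * (expR (w * h) - 1)))).
  near=> h; have h_gt0 : 0 < h by near: h; exact: nbhs_right_gt.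
  by rewrite mulrA mulfV ?mul1r // gt_eqF.
by apply: cvgM => //; exact: expR_quotient_cvg.
Unshelve. all: by end_near. Qed.

Variables (W : R -> X -> X) (w : R).

Definition exp_shift (t : R) (f : X) : X := expR (w * t) *: W t f.

Lemma exp_shift_C0 : C0_semigroup W -> C0_semigroup exp_shift.
Proof.
move=> [W_bnd W0 WD W_cont]; split.
- move=> t t0; have [W_lin [M HM]] := W_bnd t t0; split.
    by move=> a u v; rewrite /exp_shift W_lin scalerDr !scalerA mulrC.
  exists (expR (w * t) * M) => f.
  by rewrite /exp_shift normrZ gtr0_norm ?expR_gt0 // -mulrA ler_pM2l ?expR_gt0.
- by apply/funext => f; rewrite /exp_shift W0 mulr0 expR0 scale1r.
- move=> s t s0 t0; apply/funext => f; rewrite /exp_shift /= WD //=.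
  have [W_lin _] := W_bnd s s0.
  by rewrite (linear_scale W_lin) scalerA mulrDr expRD.
- move=> f; rewrite -[X in _ --> X]scale1r; apply: cvgZ; last exact: W_cont.
  exact: expR_right_cvg.
Qed.

Lemma exp_shift_deriv f l : h^-1 *: (W h f - f) @[h --> 0^'+] --> l ->
  h^-1 *: (exp_shift h f - f) @[h --> 0^'+] --> l + w *: f.
Proof.
move=> Wf.
have -> : (fun h => h^-1 *: (exp_shift h f - f)) = (fun h =>
   expR (w * h) *: (h^-1 *: (W h f - f)) + (h^-1 * (expR (w * h) - 1)) *: f).
  apply/funext => h; rewrite scalerA mulrC -!scalerA -scalerDr; congr (_ *: _).
  by rewrite scalerBr scalerBl scale1r addrA subrK.
apply: cvgD; last by apply: cvgZl; exact: expR_quotient_cvg.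
rewrite -[X in _ --> X]scale1r; apply: cvgZ => //; exact: expR_right_cvg.
Qed.

End exponential_shift.

(** The inclusion of the domain of the shifted generator in [D] is the
    other one, applied to the shift back by [- w]. *)
Lemma exp_shift_generates (R : realType) (X : normedModType R) (W : R -> X -> X)
    (w : R) (D : set X) (A : X -> X) :
  generates D A W -> generates D (fun f => A f + w *: f) (exp_shift W w).
Proof.
move=> [WD WA]; have dW f : D f -> h^-1 *: (W h f - f) @[h --> 0^'+] --> A f.
  move=> Df; rewrite -(WA f Df) /gen.
  move: Df; rewrite -WD => /cvg_ex[l Wl].
  by rewrite (cvg_lim _ Wl).
split; last first.
  move=> f Df; apply: cvg_lim => //; apply: exp_shift_deriv; exact: dW.
apply/seteqP; split=> f; last first.
  by move=> Df; apply/cvg_ex; eexists; apply: exp_shift_deriv; exact: dW.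
move=> /cvg_ex[l Vl]; rewrite -WD; apply/cvg_ex.
have W_back : W = exp_shift (exp_shift W w) (- w).
  apply/funext => t; apply/funext => g.
  by rewrite /exp_shift scalerA -expRD mulNr addNr expR0 scale1r.
by exists (l + (- w) *: f); rewrite W_back; exact: exp_shift_deriv.
Qed.

Section neumann.
Context (R : realType) (X : normedModType R).
Variables (K : X -> X) (c : R).
Hypothesis X_complete : seq_complete X.
Hypothesis K_lin : linear K.
Hypotheses (c_ge0 : 0 <= c) (c_lt1 : c < 1).
Hypothesis K_bnd : forall f, `|K f| <= c * `|f|.
Implicit Types f : X.

(** The Horner form of the partial sums of the series of [K^n f]. *)
Fixpoint neumann_sum n f : X :=
  if n is m.+1 then f + K (neumann_sum m f) else 0.

Lemma neumann_sum_lin n : linear (neumann_sum n).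
Proof.
elim: n => [|n IH] a u v /=; first by rewrite scaler0 addr0.
by rewrite IH K_lin scalerDr addrACA.
Qed.

Lemma iter_contraction n f : `|iter n K f| <= `|f| * c ^+ n.
Proof.
elim: n => [|n IH]; first by rewrite mulr1.
rewrite iterS exprS mulrCA; apply: le_trans (K_bnd _) _.
by rewrite ler_wpM2l.
Qed.

Lemma neumann_sum_step n f : neumann_sum n.+1 f - neumann_sum n f = iter n K f.
Proof.
elim: n => [|n IH]; first by rewrite /= (linear_zero K_lin) addr0 subr0.
by rewrite iterS -IH (linear_sub K_lin) /= opprD addrACA subrr add0r.
Qed.

Lemma neumann_sum_bnd n f : `|neumann_sum n f| <= (1 - c)^-1 * `|f|.
Proof.
have p : 0 < 1 - c by rewrite subr_gt0.
elim: n => [|n IH] /=; first by rewrite normr0 mulr_ge0 // invr_ge0 ltW.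
apply: le_trans (ler_normD _ _) _.
apply: le_trans (lerD (lexx _) (le_trans (K_bnd _) (ler_wpM2l c_ge0 IH))) _.
rewrite le_eqVlt; apply/orP; left; apply/eqP; move: `|f| => x.
by field; rewrite gt_eqF.
Qed.

Definition neumann f : X := lim (neumann_sum n f @[n --> \oo]).

Lemma neumannP f : neumann_sum n f @[n --> \oo] --> neumann f.
Proof.
suff /cvg_ex[l fl] : cvg (neumann_sum n f @[n --> \oo]).
  by rewrite /neumann (cvg_lim _ fl).
apply/cvg_ex; apply: X_complete.
apply: (@geometric_cauchy _ _ _ `|f| c) => // n.
by rewrite neumann_sum_step iter_contraction.
Qed.

Lemma neumann_eq f l : neumann_sum n f @[n --> \oo] --> l -> neumann f = l.
Proof. by move=> fl; exact: cvg_lim. Qed.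

Lemma neumann_lin : linear neumann.
Proof.
move=> a u v; apply: neumann_eq.
under eq_fun do rewrite neumann_sum_lin.
by apply: cvgD; [apply: cvgZr|]; exact: neumannP.
Qed.

Lemma neumann_bnd f : `|neumann f| <= (1 - c)^-1 * `|f|.
Proof.
by apply: (cvgn_norm_le (@neumannP f)); apply: nearW => n; exact: neumann_sum_bnd.
Qed.

Lemma K_neumann_cvg f : K (neumann_sum n f) @[n --> \oo] --> K (neumann f).
Proof. exact: (cvg_bounded_linear K_lin K_bnd (@neumannP f)). Qed.

Lemma neumannE f : neumann f = f + K (neumann f).
Proof.
apply/eqP; rewrite -subr_eq0 -normr_le0.
apply: (@cvgn_norm_le _ _ (fun n => neumann_sum n.+1 f - (f + K (neumann_sum n f)))).
  apply: cvgB; first by have := @neumannP f; rewrite -(cvg_shiftS _ _).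
  by apply: cvgD; [exact: cvg_cst|exact: K_neumann_cvg].
by apply: nearW => n; rewrite subrr normr0.
Qed.

Lemma neumann_sub f : neumann (f - K f) = f.
Proof.
apply/eqP; rewrite -subr_eq0; set u := _ - f.
have uK : u = K u.
  rewrite /u {1}neumannE (linear_sub K_lin).
  by rewrite addrAC [f - _ - f]addrAC subrr add0r addrC.
have : `|u| <= c * `|u| by rewrite {1}uK.
rewrite -subr_ge0 -{2}[`|u|]mul1r -mulrBl nmulr_rge0 ?subr_lt0 //.
by rewrite normr_le0.
Qed.

End neumann.

(** * Positive perturbations in cones *)

(** The cone [C] and the functional [I] model the nonnegative elements of an L^1
    space and the integral. *)
Section positive_perturbation.
Context (R : realType) (X : normedModType R).
Variables (C : set X) (I : X -> R).
Variables (D : set X) (T B : X -> X) (Rs : R -> X -> X) (w c : R).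
Implicit Types (f g v : X) (h l : R).
Hypothesis X_complete : seq_complete X.
Hypothesis C_closed : forall (u : nat -> X) f,
  u @ \oo --> f -> (forall n, C (u n)) -> C f.
Hypothesis C0 : C 0.
Hypothesis C_add : forall f g, C f -> C g -> C (f + g).
Hypothesis C_scale : forall k f, 0 <= k -> C f -> C (k *: f).
Hypothesis I_lin : forall k f g, I (k *: f + g) = k * I f + I g.
Hypothesis I_bnd : forall f, `|I f| <= `|f|.
Hypothesis I_norm : forall f, C f -> I f = `|f|.
Hypothesis C_split : forall f, exists p q,
  [/\ C p, C q, f = p - q & `|f| = `|p| + `|q|].
Hypothesis D_dense : dense_in_norm D.
Hypothesis Rs_res : forall l, w <= l -> is_resolvent D T l (Rs l).
Hypothesis Rs_pos : forall l f, w <= l -> C f -> C (Rs l f).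
Hypothesis K_lin : forall l, w <= l -> linear (B \o Rs l).
Hypothesis K_bnd : forall l f, w <= l -> `|B (Rs l f)| <= c * `|f|.
Hypothesis K_pos : forall l f, w <= l -> C f -> C (B (Rs l f)).
Hypotheses (c_ge0 : 0 <= c) (c_lt1 : c < 1).
Hypothesis T_growth : forall v, D v -> C v -> I (T v) <= w * I v.

Let K l : X -> X := B \o Rs l.
Let N l : X -> X := neumann (K l).
Let A f : X := (T f + B f) - w *: f.
(** From 1 - h A = h (l - T - B) with [l = w + h^-1], the inverse is
    (l - T)^{-1} (1 - K l)^{-1} h^{-1}. *)
Let J h f : X := Rs (w + h^-1) (N (w + h^-1) (h^-1 *: f)).

Let K_bnd' l : w <= l -> forall f, `|K l f| <= c * `|f|.
Proof. by move=> wl f; exact: K_bnd. Qed.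

Let N_cvg l f : w <= l -> neumann_sum (K l) n f @[n --> \oo] --> N l f.
Proof.
by move=> wl; exact: (neumannP X_complete (K_lin wl) c_ge0 c_lt1 (K_bnd' wl)).
Qed.

Let NE l f : w <= l -> N l f = f + K l (N l f).
Proof.
move=> wl; exact: (neumannE X_complete (K_lin wl) c_ge0 c_lt1 (K_bnd' wl)).
Qed.

Let N_sub l f : w <= l -> N l (f - K l f) = f.
Proof.
move=> wl; exact: (neumann_sub X_complete (K_lin wl) c_ge0 c_lt1 (K_bnd' wl)).
Qed.

Let N_lin l : w <= l -> linear (N l).
Proof.
move=> wl; exact: (neumann_lin X_complete (K_lin wl) c_ge0 c_lt1 (K_bnd' wl)).
Qed.

Let N_bnd l f : w <= l -> `|N l f| <= (1 - c)^-1 * `|f|.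
Proof.
move=> wl; exact: (neumann_bnd X_complete (K_lin wl) c_ge0 c_lt1 (K_bnd' wl)).
Qed.

Let N_pos l f : w <= l -> C f -> C (N l f).
Proof.
move=> wl Cf; apply: (C_closed (@N_cvg l f wl)).
by elim=> [//|n IH] /=; apply: C_add => //; exact: K_pos.
Qed.

Let I_add f g : I (f + g) = I f + I g.
Proof. by rewrite -[f]scale1r I_lin mul1r scale1r. Qed.

Let I_scale k f : I (k *: f) = k * I f.
Proof. by rewrite -[k *: f]addr0 I_lin (I_norm C0) normr0 addr0. Qed.

Let I_sub f g : I (f - g) = I f - I g.
Proof. by rewrite I_add -scaleN1r I_scale mulN1r. Qed.

(** An equivalent norm on the cone, for which the [J h] are contractions. *)
Let phi f : R := I (N w f).

Let phi_ge f : C f -> `|f| <= phi f.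
Proof.
move=> Cf; rewrite /phi (NE _ (lexx w)) I_add I_norm // lerDl I_norm //.
by apply: K_pos => //; exact: N_pos.
Qed.

Let phi_le f : phi f <= (1 - c)^-1 * `|f|.
Proof.
by apply: le_trans (ler_norm _) _; apply: le_trans (I_bnd _) _; exact: N_bnd.
Qed.

Let wh h : 0 < h -> w <= w + h^-1.
Proof. by move=> h0; rewrite lerDl invr_ge0 ltW. Qed.

Let J_pos h f : 0 < h -> C f -> C (J h f).
Proof.
move=> h0 Cf; apply: Rs_pos; first exact: wh.
by apply: N_pos; [exact: wh|apply: C_scale; rewrite // invr_ge0 ltW].
Qed.

Let A_scaled h v : 0 < h ->
  h^-1 *: (v - h *: A v) = ((w + h^-1) *: v - T v) - B v.
Proof.
move=> h0; have h1 : h != 0 by rewrite gt_eqF.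
rewrite scalerBr scalerA mulVf // scale1r /A scalerDl !opprD opprK !addrA.
by rewrite addrC !addrA.
Qed.

Let J_right h f : 0 < h -> D (J h f) /\ J h f - h *: A (J h f) = f.
Proof.
move=> h0; have wl := wh h0; rewrite /J; set z := N _ _.
have [_ /(_ z)[Dz Tz] _] := Rs_res wl; split=> //.
have h1 : h != 0 by rewrite gt_eqF.
apply: (scalerI (invr_neq0 h1)); rewrite A_scaled // Tz.
by rewrite {1}/z (NE _ wl) addrK.
Qed.

Let J_left h f : 0 < h -> D f -> J h (f - h *: A f) = f.
Proof.
move=> h0 Df; have wl := wh h0; have [_ _ /(_ f Df) E] := Rs_res wl.
have BK : B f = K (w + h^-1) ((w + h^-1) *: f - T f) by rewrite /K /= E.
by rewrite /J A_scaled // BK N_sub.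
Qed.

Let J_lin h : 0 < h -> linear (J h).
Proof.
move=> h0 a u v; have wl := wh h0; have [[Rs_lin _] _ _] := Rs_res wl.
by rewrite /J scalerDr scalerA mulrC -scalerA N_lin // Rs_lin.
Qed.

(** For [v = J h g], - A v = (1 - K w) (w - T) v and [N w] inverts 1 - K w,
    so [phi g - phi v = h * (w * I v - I (T v))]. *)
Let J_phi h g : 0 < h -> C g -> phi (J h g) <= phi g.
Proof.
move=> h0 Cg; have [Dv gE] := J_right g h0; have Cv := J_pos h0 Cg.
set v := J h g in Dv gE Cv *; rewrite -[g in _ <= phi g]gE.
have [_ _ /(_ v Dv) Rv] := Rs_res (lexx w).
have AE : A v = - ((w *: v - T v) - K w (w *: v - T v)).
  by rewrite /K /= Rv /A !opprB addrA [B v + _]addrC.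
rewrite AE scalerN opprK /phi (linear_add (N_lin (lexx w))).
rewrite (linear_scale (N_lin (lexx w))) (N_sub _ (lexx w)) I_add I_scale I_sub I_scale.
rewrite lerDl mulr_ge0 ?(ltW h0) // subr_ge0; exact: T_growth.
Qed.

Let J_pow h n f : 0 < h -> `|iter n (J h) f| <= (1 - c)^-1 * `|f|.
Proof.
move=> h0; have Cpow g : C g -> `|iter n (J h) g| <= (1 - c)^-1 * `|g|.
  move=> Cg; apply: le_trans (phi_le g).
  suff [Cn le_n] : C (iter n (J h) g) /\ phi (iter n (J h) g) <= phi g.
    exact: le_trans (phi_ge Cn) le_n.
  elim: n => [//|n [Cn IH]]; rewrite iterS; split; first exact: J_pos.
  by apply: le_trans IH; exact: J_phi.
have [p [q [Cp Cq -> ->]]] := C_split f.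
rewrite (linear_sub (iter_linear n (J_lin h0))) mulrDr.
by apply: le_trans (ler_normB _ _) _; apply: lerD; exact: Cpow.
Qed.

(** The theorem of Desch. The semigroup is positive because it is a limit
    of powers of the positive operators [J h]. *)
Theorem positive_perturbation : exists V : R -> X -> X,
  [/\ C0_semigroup V, forall t, 0 <= t -> forall f, C f -> C (V t f) &
      generates D (fun f => T f + B f) V].
Proof.
have M_ge0 : 0 <= (1 - c)^-1 by rewrite invr_ge0 subr_ge0 ltW.
have [W_C0 W_gen] :=
  euler_lim_semigroup X_complete M_ge0 D_dense J_lin J_pow J_right J_left.
exists (exp_shift (euler_lim J) w); split.
- exact: exp_shift_C0.
- move=> t t0 f Cf; apply: C_scale; first exact: expR_ge0.
  apply: (C_closed (@euler_limP _ _ _ _ _ _ X_complete M_ge0 D_dense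
    J_lin J_pow J_right J_left t f t0)) => k.
  rewrite /euler; elim: (steps k t) => [//|n IH].
  by rewrite iterS; apply: J_pos => //; exact: mesh_gt0.
have [VD VT] := exp_shift_generates w W_gen; split=> // f Df.
by rewrite VT // /A subrK.
Qed.

End positive_perturbation.

Import HBNNSimple.

(** * Spaces of integrable functions *)

Section density.
Context d (T : measurableType d) (R : realType).
Variables (m nu : {measure set T -> \bar R}) (w : T -> R).
Hypothesis w_meas : measurable_fun setT w.
Hypothesis w_ge0 : forall x, 0 <= w x.
Hypothesis nuE : forall A, measurable A -> nu A = (\int[m]_(x in A) (w x)%:E)%E.
Local Open Scope ereal_scope.

(** By monotone convergence, from simple functions. *)
Lemma ge0_integral_density (f : T -> \bar R) :
  measurable_fun setT f -> (forall x, 0 <= f x) ->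
  \int[nu]_x f x = \int[m]_x (f x * (w x)%:E).
Proof.
move=> mf f0; pose h := nnsfun_approx measurableT mf.
have mw : measurable_fun setT (EFin \o w) by exact/measurable_EFinP.
have mh n : measurable_fun setT (EFin \o h n) by exact/measurable_EFinP.
have -> : \int[nu]_x f x = lim (\int[nu]_x (EFin \o h n) x @[n --> \oo]).
  have fE x : f x = lim ((EFin \o h n) x @[n --> \oo]).
    by apply/esym/cvg_lim => //; exact: cvg_nnsfun_approx.
  under eq_integral do rewrite fE; apply: monotone_convergence => //.
  - by move=> n x _; rewrite lee_fin.
  - by move=> x _ a b ab; rewrite lee_fin; exact/lefP/nd_nnsfun_approx.
have -> : \int[m]_x (f x * (w x)%:E) =
    lim (\int[m]_x ((EFin \o h n) x * (w x)%:E) @[n --> \oo]).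
  have fE x : f x * (w x)%:E = lim ((EFin \o h n) x * (w x)%:E @[n --> \oo]).
    by apply/esym/cvg_lim => //; apply: cvgeZr => //; exact: cvg_nnsfun_approx.
  under eq_integral do rewrite fE; apply: monotone_convergence => //.
  - by move=> n; exact: emeasurable_funM.
  - by move=> n x _; rewrite mule_ge0 ?lee_fin.
  - move=> x _ a b ab; rewrite lee_wpmul2r ?lee_fin ?w_ge0 //.
    exact/lefP/nd_nnsfun_approx.
congr (limn _); apply/funext => n.
transitivity (\int[nu]_x (\sum_(y \in range (h n)) (y * \1_(h n @^-1` [set y]) x)%:E)).
  by apply: eq_integral => t tE; rewrite /= fimfunE -fsumEFin.
rewrite ge0_integral_fsum//; last 2 first.
- by move=> r; apply/measurable_EFinP; exact: measurable_funM.
- by move=> r y Ey; exact: nnfun_muleindic_ge0.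
transitivity (\int[m]_x (\sum_(y \in range (h n))
    (y * \1_(h n @^-1` [set y]) x)%:E * (w x)%:E)); last first.
  apply: eq_integral => x _.
  rewrite -ge0_mule_fsuml => [|y]; last exact: nnfun_muleindic_ge0.
  by rewrite fsumEFin // -(fimfunE _ x).
rewrite ge0_integral_fsum//; last 2 first.
- move=> y; apply: emeasurable_funM => //.
  by apply/measurable_EFinP; exact: measurable_funM.
- by move=> r y Ey; apply: mule_ge0; [exact: nnfun_muleindic_ge0|rewrite lee_fin].
apply: eq_fsbigr => r rhn.
under eq_integral do rewrite EFinM.
rewrite integralZl_indic_nnsfun => //.
have r0 : (0 <= r)%R by move: rhn; rewrite inE => -[t _ <-].
under [RHS]eq_integral do rewrite EFinM -muleA.
rewrite ge0_integralZl_EFin//.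
- congr (_ * _); rewrite integral_indic // setIT nuE //.
  rewrite integral_mkcond; apply: eq_integral => x _.
  by rewrite epatch_indic muleC.
- by move=> x _; rewrite mule_ge0 ?lee_fin.
- by apply: emeasurable_funM => //; exact/measurable_EFinP.
Qed.

Lemma density_ae (P : T -> Prop) :
  {ae m, forall x, w x != 0%R -> P x} -> {ae nu, forall x, P x}.
Proof.
move=> [N [mN N0 PN]].
have mZ : measurable (w @^-1` [set 0%R]).
  by rewrite -[X in measurable X]setTI; exact: w_meas.
have nN : nu.-negligible N.
  exists N; split => //; rewrite nuE //; apply: null_set_integral => //.
  apply/measurable_funTS/measurable_EFinP; exact: w_meas.
have nZ : nu.-negligible (w @^-1` [set 0%R]).
  exists (w @^-1` [set 0%R]); split => //; rewrite nuE //.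
  by apply: integral0_eq => x /= ->.
apply: negligibleS (negligibleU nN nZ) => x /= nPx.
have [wx|wx] := eqVneq (w x) 0%R; [by right|left].
by apply: PN => /= /(_ wx).
Qed.

Lemma ae_density (P : T -> Prop) :
  {ae nu, forall x, P x} -> {ae m, forall x, w x != 0%R -> P x}.
Proof.
move=> [N [mN N0 PN]].
have mw : measurable_fun N (EFin \o w) by apply/measurable_funTS/measurable_EFinP.
have : \int[m]_(x in N) `|(w x)%:E| = 0.
  rewrite -[RHS]N0 nuE //; apply: eq_integral => x _.
  by rewrite gee0_abs // lee_fin.
move/(ae_eq_integral_abs _ mN mw); apply: filterS => x Nx wx.
apply: contrapT => nPx; move/eqP: wx; apply.
by have [] := Nx (PN x nPx).
Qed.

End density.

Section L1_facts.
Context d (T : measurableType d) (R : realType).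
Variable mu : {measure set T -> \bar R}.
Implicit Types (f g : L1 mu).

Lemma L1_fun_integrable f : mu.-integrable setT (EFin \o L1_fun f).
Proof. exact/Lfun1_integrable/LfunP. Qed.

Lemma L1_fun_measurable f : measurable_fun setT (L1_fun f).
Proof. by have /integrableP[/measurable_EFinP] := L1_fun_integrable f. Qed.

Lemma toL1_ae (g : T -> R) : mu.-integrable setT (EFin \o g) ->
  {ae mu, forall x, L1_fun (toL1 mu g) x = g x}.
Proof.
move=> /Lfun1_integrable ig; rewrite /toL1.
have := L1_repr_pi (insubd (0 : LfunType mu (@lexx _ _ 1%E)) g).
by apply: filterS => x; rewrite insubdK.
Qed.

Lemma L1_ext f g : {ae mu, forall x, L1_fun f x = L1_fun g x} -> f = g.
Proof. by move=> fg; rewrite -[f]reprK -[g]reprK; exact/L1_piP. Qed.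

Lemma toL1_eq (g : T -> R) f : mu.-integrable setT (EFin \o g) ->
  {ae mu, forall x, g x = L1_fun f x} -> toL1 mu g = f.
Proof.
move=> ig gf; apply: L1_ext; apply: filterS2 (toL1_ae ig) gf => x.
by move=> -> ->.
Qed.

Lemma L1_fun_lin (k : R) f g :
  {ae mu, forall x, L1_fun (k *: f + g) x = k * L1_fun f x + L1_fun g x}.
Proof.
have -> : k *: f + g = \pi_(L1 mu) (k *: (repr f : LfunType mu (@lexx _ _ 1%E)) + repr g).
  rewrite raddfD /= reprK; congr (_ + _).
exact: L1_repr_pi.
Qed.

Lemma L1_fun0 : {ae mu, forall x, L1_fun (0 : L1 mu) x = 0}.
Proof.
rewrite -[0 : L1 mu](raddf0 (\pi_(L1 mu))).
exact: (L1_repr_pi (0 : LfunType mu (@lexx _ _ 1%E))).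
Qed.

Lemma L1_funZ (k : R) f : {ae mu, forall x, L1_fun (k *: f) x = k * L1_fun f x}.
Proof.
rewrite -[k *: f]addr0; apply: filterS2 (L1_fun_lin k f 0) L1_fun0 => x -> ->.
by rewrite addr0.
Qed.

Lemma L1_funB f g : {ae mu, forall x, L1_fun (f - g) x = L1_fun f x - L1_fun g x}.
Proof.
rewrite addrC -scaleN1r; apply: filterS (L1_fun_lin (-1) g f) => x ->.
by rewrite mulN1r addrC.
Qed.

Lemma L1_normE f : (`|f|%:E = \int[mu]_x `|(L1_fun f x)%:E|)%E.
Proof.
have -> : `|f| = L1_norm f by [].
rewrite /L1_norm /Rintegral fineK //.
have /integrableP[_ foo] := L1_fun_integrable f.
by rewrite ge0_fin_numE // integral_ge0.
Qed.

Lemma toL1_normE (g : T -> R) : mu.-integrable setT (EFin \o g) ->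
  (`|toL1 mu g|%:E = \int[mu]_x `|(g x)%:E|)%E.
Proof.
move=> ig; rewrite L1_normE; have /integrableP[mg _] := ig.
apply: ae_eq_integral => //.
- by apply: measurableT_comp => //; exact/measurable_EFinP/L1_fun_measurable.
- exact: measurableT_comp.
- by apply: filterS (toL1_ae ig) => x gx _; rewrite gx.
Qed.

Lemma toL1_lin (k : R) (g h : T -> R) :
  mu.-integrable setT (EFin \o g) -> mu.-integrable setT (EFin \o h) ->
  toL1 mu (fun x => k * g x + h x) = k *: toL1 mu g + toL1 mu h.
Proof.
move=> ig ih; apply: toL1_eq.
  apply: (@eq_integrable _ _ _ mu _ measurableT (fun x => k%:E * (g x)%:E + (h x)%:E)%E) => //.
  by apply: integrableD => //; exact: integrableZl.
apply: filterS3 (toL1_ae ig) (toL1_ae ih) (L1_fun_lin k (toL1 mu g) (toL1 mu h)).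
by move=> x <- <- ->.
Qed.

Definition L1_integral f : R := \int[mu]_x L1_fun f x.

Lemma L1_integralE f : (L1_integral f)%:E = (\int[mu]_x (L1_fun f x)%:E)%E.
Proof.
rewrite /L1_integral /Rintegral fineK //; apply: integrable_fin_num => //.
exact: L1_fun_integrable.
Qed.

Lemma L1_integral_lin k f g :
  L1_integral (k *: f + g) = k * L1_integral f + L1_integral g.
Proof.
apply: EFin_inj; rewrite EFinD EFinM !L1_integralE.
have iF := L1_fun_integrable f; have iG := L1_fun_integrable g.
rewrite -integralZl // -integralD //; last exact: integrableZl.
apply: ae_eq_integral => //.
- exact/measurable_EFinP/L1_fun_measurable.
- apply: emeasurable_funD; last exact/measurable_EFinP/L1_fun_measurable.
  apply: emeasurable_funM => //.
  exact/measurable_EFinP/L1_fun_measurable.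
- by apply: filterS (L1_fun_lin k f g) => x fx _; rewrite fx EFinD EFinM.
Qed.

Lemma L1_integral_le f : `|L1_integral f| <= `|f|.
Proof.
rewrite -lee_fin L1_normE.
have -> : (`|L1_integral f|%:E = `|(L1_integral f)%:E|)%E by [].
rewrite L1_integralE.
by apply: le_abse_integral => //; exact/measurable_EFinP/L1_fun_measurable.
Qed.

Lemma L1_integral_nneg f : L1_nneg f -> L1_integral f = `|f|.
Proof.
move=> f0; apply: EFin_inj; rewrite L1_normE L1_integralE.
have mf : measurable_fun setT (EFin \o L1_fun f) by exact/measurable_EFinP/L1_fun_measurable.
apply: ae_eq_integral => //; first exact: measurableT_comp.
by apply: filterS f0 => x fx _; rewrite gee0_abs ?lee_fin.
Qed.

Lemma L1_nneg_lin k f g : 0 <= k -> L1_nneg f -> L1_nneg g -> L1_nneg (k *: f + g).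
Proof.
move=> k0 f0 g0; apply: filterS3 f0 g0 (L1_fun_lin k f g) => x f0 g0 ->.
by rewrite addr_ge0 ?mulr_ge0.
Qed.

Lemma toL1_nneg (g : T -> R) : mu.-integrable setT (EFin \o g) ->
  {ae mu, forall x, 0 <= g x} -> L1_nneg (toL1 mu g).
Proof. by move=> ig; apply: filterS2 (toL1_ae ig) => x ->. Qed.

(** The norm of L^1 is additive on positive and negative parts; this is how
    estimates on the cone extend to all functions. *)
Lemma L1_split f : exists p q : L1 mu,
  [/\ L1_nneg p, L1_nneg q, f = p - q & `|f| = `|p| + `|q|].
Proof.
have iF := L1_fun_integrable f.
have ip : mu.-integrable setT (EFin \o (L1_fun f)^\+) by exact: integrable_funrpos.
have iq : mu.-integrable setT (EFin \o (L1_fun f)^\-) by exact: integrable_funrneg.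
have mp : measurable_fun setT (EFin \o (L1_fun f)^\+) by have /integrableP[] := ip.
have mq : measurable_fun setT (EFin \o (L1_fun f)^\-) by have /integrableP[] := iq.
exists (toL1 mu (L1_fun f)^\+), (toL1 mu (L1_fun f)^\-); split.
- by apply: toL1_nneg => //; apply: nearW => x; exact: funrpos_ge0.
- by apply: toL1_nneg => //; apply: nearW => x; exact: funrneg_ge0.
- apply: L1_ext; apply: filterS3 (toL1_ae ip) (toL1_ae iq)
    (L1_funB (toL1 mu (L1_fun f)^\+) (toL1 mu (L1_fun f)^\-)) => x.
  by move=> fp fq ->; rewrite fp fq -[in LHS](funrposBneg (L1_fun f)).
- apply: EFin_inj; rewrite EFinD !toL1_normE // L1_normE.
  rewrite -ge0_integralD //; [|exact: measurableT_comp..].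
  apply: eq_integral => x _; rewrite /= -EFinD; congr EFin.
  rewrite (ger0_norm (funrpos_ge0 _ _)) (ger0_norm (funrneg_ge0 _ _)).
  by have := congr1 (@^~ x) (funrposDneg (L1_fun f)).
Qed.

Lemma L1_normE_le f g (F : T -> R) :
  {ae mu, forall x, F x = L1_fun f x - L1_fun g x} -> measurable_fun setT F ->
  (\int[mu]_x `|(F x)%:E| = `|f - g|%:E)%E.
Proof.
move=> FE mF; rewrite L1_normE; apply: ae_eq_integral => //.
- by apply: measurableT_comp => //; exact/measurable_EFinP.
- by apply: measurableT_comp => //; exact/measurable_EFinP/L1_fun_measurable.
- by apply: filterS2 FE (L1_funB f g) => x Fx fgx _; rewrite Fx fgx.
Qed.

(** The negative part of the limit is dominated by the distance of the
    limit to any term of the sequence. *)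
Lemma L1_nneg_closed (u : nat -> L1 mu) f :
  u @ \oo --> f -> (forall n, L1_nneg (u n)) -> L1_nneg f.
Proof.
move=> uf u0; have mf := L1_fun_measurable f.
have mn : measurable_fun setT (EFin \o (L1_fun f)^\-).
  by apply/measurable_EFinP; exact: measurable_funrneg.
have le n : (\int[mu]_x ((L1_fun f)^\- x)%:E <= `|f - u n|%:E)%E.
  rewrite L1_normE; apply: ae_ge0_le_integral => //.
  - by move=> x _; rewrite lee_fin funrneg_ge0.
  - by apply: measurableT_comp => //; exact/measurable_EFinP/L1_fun_measurable.
  - apply: filterS2 (u0 n) (L1_funB f (u n)) => x ux -> _.
    rewrite lee_fin /funrneg; case: (leP 0 (L1_fun f x)) => fx.
      by rewrite (max_idPr _) ?oppr_le0 // normr_ge0.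
    rewrite (max_idPl _) ?oppr_ge0 ?(ltW fx) // distrC.
    by apply: le_trans (ler_norm _); rewrite lerDr.
have z : (\int[mu]_x ((L1_fun f)^\- x)%:E = 0)%E.
  apply/eqP; rewrite eq_le integral_ge0 ?andbT; last first.
    by move=> x _; rewrite lee_fin funrneg_ge0.
  apply/lee_addgt0Pr => e e0; rewrite add0e.
  have /cvgrPdist_le/(_ e e0)[N _ /(_ N (leqnn N)) fN] := uf.
  by apply: le_trans (le N) _; rewrite lee_fin.
have : (\int[mu]_x `|((L1_fun f)^\- x)%:E| = 0)%E.
  by rewrite -[RHS]z; apply: eq_integral => x _; rewrite gee0_abs // lee_fin funrneg_ge0.
move=> /(ae_eq_integral_abs _ measurableT mn); apply: filterS => x /(_ I) [nx].
have := congr1 (@^~ x) (funrposBneg (L1_fun f)) => /= <-.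
by rewrite -[X in 0 <= X]/(_ - (L1_fun f)^\- x) nx subr0 funrpos_ge0.
Qed.

(** A subsequence with summable increments converges almost everywhere;
    Fatou's lemma bounds the distance of the whole sequence to that limit. *)
Lemma L1_complete : seq_complete (L1 mu).
Proof.
move=> u u_cauchy.
have half k : 0 < (2^-1 : R) ^+ k by rewrite exprn_gt0 // invr_gt0.
have [s sP] := choice (fun k => u_cauchy _ (half k)).
pose n_ k := (\sum_(i < k.+1) s i + k)%N.
have n_s k : (s k <= n_ k)%N by rewrite /n_ big_ord_recr -addnA addnCA leq_addr.
have n_mono k : (n_ k <= n_ k.+1)%N.
  by rewrite /n_ [X in (_ <= X + _)%N]big_ord_recr /= leq_add // leq_addr.
have n_ge k j : (k <= j)%N -> (s k <= n_ j)%N.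
  move=> kj; apply: leq_trans (n_s k) _; rewrite -(subnKC kj).
  by elim: (j - k)%N => [|i IH]; rewrite ?addn0 // addnS; exact: leq_trans IH _.
pose v k := u (n_ k).
have v_step k : `|v k.+1 - v k| <= 2^-1 ^+ k.
  by apply: sP; [apply: n_ge|apply: n_ge].
pose dd k x := L1_fun (v k.+1) x - L1_fun (v k) x.
have mdd k : measurable_fun setT (dd k).
  by apply: measurable_funB; exact: L1_fun_measurable.
have mda k : measurable_fun setT (fun x => `|(dd k x)%:E|)%E.
  by apply: measurableT_comp => //; exact/measurable_EFinP.
pose G x := (\sum_(0 <= k <oo) `|(dd k x)%:E|)%E.
have G_lt : (\int[mu]_x G x < +oo)%E.
  rewrite /G integral_nneseries //.
  apply: (@le_lt_trans _ _ 2%:E); last exact: ltry.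
  apply: lime_le; first by apply: is_cvg_nneseries => *; exact: integral_ge0.
  apply: nearW => n; apply: (@le_trans _ _ (\sum_(0 <= k < n) ((2^-1 : R) ^+ k)%:E)%E).
    apply: lee_sum => k _; rewrite (@L1_normE_le (v k.+1) (v k)) //.
      by rewrite lee_fin.
    exact: nearW.
  rewrite sumEFin lee_fin; apply: le_trans (_ : 2 - 2 * 2^-1 ^+ n <= _); last first.
    by rewrite gerBl mulr_ge0 // ltW.
  elim: n => [|n IH]; first by rewrite big_geq // mulr1 subrr.
  rewrite big_nat_recr //= exprS; move: IH (half n).
  move: (\sum_(0 <= i < n) _) (2^-1 ^+ n) => p q; lra.
have mG : measurable_fun setT G by exact: ge0_emeasurable_sum.
have G_fin : {ae mu, forall x, G x \is a fin_num}.
  have iG : mu.-integrable setT G.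
    apply/integrableP; split => //.
    under eq_integral do rewrite gee0_abs ?nneseries_ge0 //.
    exact: G_lt.
  by apply: filterS (integrable_ae measurableT iG) => x; apply.
have v_cvg : {ae mu, forall x, cvgn (fun k => L1_fun (v k) x)}.
  apply: filterS G_fin => x Gx.
  have snE n : [normed (series (dd ^~ x))] n = \sum_(0 <= k < n) `|dd k x| by [].
  have sn : cvgn [normed (series (dd ^~ x))].
    apply: nondecreasing_is_cvgn.
      by apply/nondecreasing_seqP => n; rewrite !snE big_nat_recr //= lerDl.
    exists (fine (G x)) => _ [n _ <-]; rewrite snE -lee_fin fineK //.
    by rewrite -sumEFin; apply: nneseries_lim_ge => k _; rewrite lee_fin.
  have sc := normed_cvg sn.
  have -> : (fun k => L1_fun (v k) x) = (fun k => L1_fun (v 0%N) x + series (dd ^~ x) k).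
    apply/funext => k; rewrite [LHS](eq_sum_telescope (fun k => L1_fun (v k) x)).
    by [].
  by apply: is_cvgD => //; exact: is_cvg_cst.
pose w x := fine (limn_esup (fun k => (L1_fun (v k) x)%:E)).
have mw : measurable_fun setT w.
  apply: measurableT_comp => //; apply: measurable_fun_limn_esup => k.
  exact/measurable_EFinP/L1_fun_measurable.
have wP : {ae mu, forall x, L1_fun (v k) x @[k --> \oo] --> w x}.
  apply: filterS v_cvg => x /cvg_ex[l vl].
  suff -> : w x = l by [].
  have vlE : (L1_fun (v k) x)%:E @[k --> \oo] --> l%:E.
    by apply: cvg_EFin => //; exact: nearW.
  by rewrite /w (cvg_limn_einf_sup vlE).2.
have close (e : R) : 0 < e -> exists N, forall n, (N <= n)%N ->
    (\int[mu]_x `|(w x - L1_fun (u n) x)%:E| <= e%:E)%E.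
  move=> e0; have [N HN] := u_cauchy e e0; exists N => n Nn.
  have mk k : measurable_fun setT (fun x => `|(L1_fun (v k) x - L1_fun (u n) x)%:E|%E).
    apply: measurableT_comp => //; apply/measurable_EFinP.
    by apply: measurable_funB; exact: L1_fun_measurable.
  have -> : (\int[mu]_x `|(w x - L1_fun (u n) x)%:E| =
      \int[mu]_x limn_einf (fun k => `|(L1_fun (v k) x - L1_fun (u n) x)%:E|))%E.
    apply: ae_eq_integral => //.
    - apply: measurableT_comp => //; apply/measurable_EFinP.
      by apply: measurable_funB => //; exact: L1_fun_measurable.
    - apply: measurableT_comp => //; apply: measurable_fun_limn_esup => k.
      exact: measurableT_comp.
    - apply: filterS wP => x wx _; apply/esym.
      apply: (cvg_limn_einf_sup _).1; apply: cvg_abse; apply: cvg_EFin.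
        exact: nearW.
      by apply: cvgB => //; exact: cvg_cst.
  apply: le_trans (fatou _ _ _ _) _ => //.
  rewrite limn_einf_lim; apply: lime_le; first exact: is_cvg_einfs.
  apply: nearW => m; set k := maxn m N.
  apply: (@le_trans _ _ (\int[mu]_x `|(L1_fun (v k) x - L1_fun (u n) x)%:E|)%E).
    by apply: ereal_inf_lbound; exists k => //=; exact: leq_maxl.
  rewrite (@L1_normE_le (v k) (u n)) ?lee_fin.
  - apply: HN => //; apply: leq_trans (leq_maxr m N) _; exact: leq_addl.
  - exact: nearW.
  - by apply: measurable_funB; exact: L1_fun_measurable.
have iw : mu.-integrable setT (EFin \o w).
  have [N /(_ N (leqnn N)) HN] := close 1 ltr01.
  have mB : measurable_fun setT (fun x => w x - L1_fun (u N) x).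
    by apply: measurable_funB => //; exact: L1_fun_measurable.
  have iB : mu.-integrable setT (EFin \o (fun x => w x - L1_fun (u N) x)).
    apply/integrableP; split; first exact/measurable_EFinP.
    by apply: le_lt_trans HN _; exact: ltry.
  apply: (@eq_integrable _ _ _ mu _ measurableT
    (fun x => (w x - L1_fun (u N) x)%:E + (L1_fun (u N) x)%:E)%E).
    by move=> x _ /=; rewrite -EFinD subrK.
  by apply: integrableD => //; exact: L1_fun_integrable.
exists (toL1 mu w); apply/cvgrPdist_le => e e0.
have [N HN] := close e e0; exists N => // n Nn.
have := HN n Nn; rewrite (@L1_normE_le (toL1 mu w) (u n)) ?lee_fin //.
- by apply: filterS (toL1_ae iw) => x ->.
- by apply: measurable_funB => //; exact: L1_fun_measurable.
Qed.

End L1_facts.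

(** * Primitives on the half line *)

Lemma ge0_integral_exhaust d (T : measurableType d) (R : realType)
    (m : {measure set T -> \bar R}) (F : nat -> set T) (f : T -> \bar R) (K : \bar R) :
  nondecreasing_seq F -> (forall i, measurable (F i)) ->
  (forall i, measurable_fun (F i) f) -> (forall i x, F i x -> (0 <= f x)%E) ->
  (forall i, \int[m]_(x in F i) f x <= K)%E ->
  (\int[m]_(x in \bigcup_i F i) f x <= K)%E.
Proof.
move=> ndF mF mf f0 FK.
have cv := ge0_nondecreasing_set_cvg_integral (mu := m) ndF mF mf f0.
rewrite -(cvg_lim _ cv)//; apply: lime_le; first by apply/cvg_ex; eexists; exact: cv.
by apply: nearW.
Qed.

Section halfline_restriction.
Context (R : realType).
Implicit Types (f : R -> R) (y : R).

Lemma halfline_pos f y : 0 < y -> (f \_ halfline) y = f y.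
Proof. by move=> y0; rewrite patchE ifT // inE /= in_itv /= y0. Qed.

Lemma halfline_neg f y : y <= 0 -> (f \_ halfline) y = 0.
Proof.
move=> y0; rewrite patchE ifF //; apply: memNset; rewrite /= in_itv /= andbT.
by apply/negP; rewrite -leNgt.
Qed.

Lemma halfline_measurable f : measurable_fun (halfline : set R) f ->
  measurable_fun (setT : set R) (f \_ halfline).
Proof. by move=> mf; apply/(measurable_restrictT _ _).1. Qed.

End halfline_restriction.

Lemma halfline_nondecreasing_measurable (R : realType) (f : R -> R) :
  (forall x y : R, 0 < x -> x <= y -> f x <= f y) ->
  measurable_fun (halfline : set R) f.
Proof.
move=> f_nd; have mfe : measurable_fun setT (f \o expR).
  apply: nondecreasing_measurable => // x y xy.
  by apply: f_nd; rewrite ?expR_gt0 // ler_expR.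
have : measurable_fun (halfline : set R) ((f \o expR) \o (@ln R)).
  apply: measurableT_comp => //; apply: measurable_funTS; exact: measurable_ln.
apply: eq_measurable_fun => x; rewrite inE /= in_itv /= andbT => x0.
by rewrite lnK.
Qed.

Section primitives.
Context (R : realType).
Local Notation leb := (@lebesgue_measure R).
Implicit Types (x y z t s : R).

Definition integrable_on_segments (g : R -> R) : Prop :=
  forall x y, 0 < x -> leb.-integrable `[x, y] (EFin \o g).

(** The signed integral from 1 to [y].  The base point cannot be 0, near which
    [g] need not be integrable. *)
Definition primitive (g : R -> R) (y : R) : R :=
  \int[leb]_(t in `[1, y]) g t - \int[leb]_(t in `[y, 1]) g t.

Lemma Rintegral_split (g : R -> R) x y z : x <= y -> y <= z ->
  leb.-integrable `[x, z] (EFin \o g) ->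
  \int[leb]_(t in `[x, z]) g t =
  \int[leb]_(t in `[x, y]) g t + \int[leb]_(t in `[y, z]) g t.
Proof.
move=> xy yz ig.
have ixy : (BLeft x <= BRight y)%O by rewrite bnd_simp.
have iyz : (BRight y <= BRight z)%O by rewrite bnd_simp.
have := Rintegral_itvB ig ixy iyz.
rewrite Rintegral_itv_obnd_cbnd; last first.
  by apply: integrableS ig => //; apply: subset_itv; rewrite bnd_simp.
by move=> <-; rewrite addrC subrK.
Qed.

Variable g : R -> R.
Hypothesis g_int : integrable_on_segments g.

Lemma primitiveB x y : 0 < x -> x <= y ->
  primitive g y - primitive g x = \int[leb]_(t in `[x, y]) g t.
Proof.
move=> x0 xy; have y0 := lt_le_trans x0 xy; rewrite /primitive.
have emp u v : v <= u -> \int[leb]_(t in `[u, v]) g t = 0.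
  rewrite le_eqVlt => /predU1P[->|vu]; first by rewrite set_itv1 Rintegral_set1.
  by rewrite set_itv_ge ?Rintegral_set0 // -leNgt bnd_simp ?ltW // -ltNge.
have [y1|y1] := leP y 1.
  rewrite (emp 1 y y1) (emp 1 x (le_trans xy y1)) !sub0r opprK addrC.
  by rewrite (Rintegral_split xy y1 (g_int _ x0)) addrK.
have [x1|x1] := leP 1 x.
  rewrite (emp y 1 (ltW y1)) (emp x 1 x1) !subr0.
  by rewrite (Rintegral_split x1 xy (g_int _ ltr01)) addrC addKr.
rewrite (emp y 1 (ltW y1)) (emp 1 x (ltW x1)) subr0 sub0r opprK addrC.
by rewrite (Rintegral_split (ltW x1) (ltW y1) (g_int _ x0)).
Qed.

Lemma primitive_within_continuous x z : 0 < x -> x <= z ->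
  {within `[x, z], continuous (primitive g)}.
Proof.
move=> x0 xz.
have c := @parameterized_integral_continuous R x z g xz (g_int z x0).
have cD : {within `[x, z], continuous
    (fun y => parameterized_integral leb x y g + primitive g x)}.
  move=> y; apply: cvgD; [exact: c|exact: cvg_cst].
apply: (@subspace_eq_continuous _ _ _ _ _ _ cD) => y.
rewrite inE /= in_itv /= => /andP[xy yz].
by rewrite /from_subspace /= /parameterized_integral -(primitiveB x0 xy) subrK.
Qed.

Lemma primitive_ivt x z v : 0 < x -> x <= z ->
  primitive g x <= v <= primitive g z ->
  exists y, x <= y <= z /\ primitive g y = v.
Proof.
move=> x0 xz /andP[a b].
have mv : Num.min (primitive g x) (primitive g z) <= v <=
    Num.max (primitive g x) (primitive g z) by rewrite ge_min a le_max b orbT.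
have [y yxz yv] := IVT xz (primitive_within_continuous x0 xz) mv.
by exists y; move: yxz; rewrite in_itv.
Qed.

Hypothesis g_ge0 : forall x, 0 < x -> 0 <= g x.

Lemma primitive_nondecreasing x y : 0 < x -> x <= y ->
  primitive g x <= primitive g y.
Proof.
move=> x0 xy; rewrite -subr_ge0 primitiveB //; apply: Rintegral_ge0 => t /=.
by rewrite in_itv /= => /andP[xt _]; apply: g_ge0; exact: lt_le_trans xt.
Qed.

Lemma integral_primitive x y : 0 < x -> x <= y ->
  (\int[leb]_(t in `[x, y]) (g t)%:E)%E = (primitive g y - primitive g x)%:E.
Proof.
move=> x0 xy; rewrite primitiveB // /Rintegral fineK //.
by apply: integrable_fin_num => //; exact: g_int.
Qed.

Lemma primitive_measurable : measurable_fun (halfline : set R) (primitive g).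
Proof.
by apply: halfline_nondecreasing_measurable => x y; exact: primitive_nondecreasing.
Qed.

Let E y : R := expR (- primitive g y).

Let g_meas x z : 0 < x -> measurable_fun `[x, z] g.
Proof. by move=> x0; have /integrableP[/measurable_EFinP] := g_int z x0. Qed.

Let gE_meas x z : 0 < x -> measurable_fun `[x, z] (fun y => (g y * E y)%:E).
Proof.
move=> x0; apply/measurable_EFinP; apply: measurable_funM; first exact: g_meas.
apply: measurableT_comp => //; apply: measurableT_comp => //.
apply: measurable_funS primitive_measurable => // y /=.
by rewrite !in_itv /= andbT => /andP[xy _]; exact: lt_le_trans xy.
Qed.

Let gE_int : integrable_on_segments (fun y => g y * E y).
Proof.
move=> x z x0.
have iC : leb.-integrable `[x, z] (fun y => (E x)%:E * (g y)%:E)%E.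
  by apply: integrableZl => //; exact: g_int.
apply: le_integrable iC => //; first exact: gE_meas.
move=> y /=; rewrite in_itv /= => /andP[xy yz].
have y0 := lt_le_trans x0 xy.
have aux (p q u : R) : 0 <= q -> q <= p -> `|u * q| <= `|p * u|.
  move=> q0 qp; rewrite mulrC !normrM ler_wpM2r ?normr_ge0 //.
  by rewrite !ger0_norm // (le_trans q0).
apply: aux; first exact: expR_ge0.
by rewrite ler_expR lerN2 primitive_nondecreasing.
Qed.

(** The exact antiderivative is [- expR (- primitive g y)], but
    [primitive g] is differentiable only almost everywhere. A crude bound
    on [[x, z]] loses a factor exponential in the increment of
    [primitive g]; halving that increment by the intermediate value theorem
    improves the factor, which tends to 1. *)
Let exp_integral_bound k x z : 0 < x -> x <= z ->
  \int[leb]_(y in `[x, z]) (g y * E y) <=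
  expR ((primitive g z - primitive g x) / 2 ^+ k) * (E x - E z).
Proof.
elim: k x z => [|k IH] x z x0 xz.
  set D := primitive g z - primitive g x.
  have -> : E z = E x * expR (- D).
    rewrite /E -expRD; congr expR; rewrite /D.
    by move: (primitive g x) (primitive g z) => p q; ring.
  apply: (@le_trans _ _ (E x * D)).
    rewrite /D primitiveB // -RintegralZl //; last exact: g_int.
    apply: le_Rintegral => //; first exact: gE_int.
      have iC : leb.-integrable `[x, z] (fun y => (E x)%:E * (g y)%:E)%E.
        by apply: integrableZl => //; exact: g_int.
      exact: iC.
    move=> y; rewrite /= in_itv /= => /andP[xy yz].
    have y0 := lt_le_trans x0 xy.
    by rewrite mulrC ler_wpM2r ?g_ge0 // ler_expR lerN2 primitive_nondecreasing.
  rewrite expr0 divr1.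
  have -> : expR D * (E x - E x * expR (- D)) = E x * (expR D - expR D * expR (- D)).
    by move: (E x) (expR D) (expR (- D)) => p q u; ring.
  by rewrite expRxMexpNx_1 ler_wpM2l ?expR_ge0 // lerBrDr addrC expR_ge1Dx.
have Hxz := primitive_nondecreasing x0 xz.
have [m [/andP[xm mz] Hm]] : exists m, x <= m <= z /\
    primitive g m = (primitive g x + primitive g z) / 2.
  apply: primitive_ivt => //; lra.
have m0 := lt_le_trans x0 xm.
rewrite (Rintegral_split xm mz); last exact: gE_int.
apply: le_trans (lerD (IH _ _ x0 xm) (IH _ _ m0 mz)) _; rewrite Hm.
have E1 : ((primitive g x + primitive g z) / 2 - primitive g x) / 2 ^+ k =
    (primitive g z - primitive g x) / 2 ^+ k.+1.
  by rewrite exprS; field; rewrite expf_neq0.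
have E2 : (primitive g z - (primitive g x + primitive g z) / 2) / 2 ^+ k =
    (primitive g z - primitive g x) / 2 ^+ k.+1.
  by rewrite exprS; field; rewrite expf_neq0.
by rewrite E1 E2 -mulrDr addrA subrK.
Qed.

Lemma integral_exp_primitive x z : 0 < x -> x <= z ->
  \int[leb]_(y in `[x, z]) (g y * expR (- primitive g y)) <=
  expR (- primitive g x) - expR (- primitive g z).
Proof.
move=> x0 xz; rewrite -/(E x) -/(E z).
have cv : expR ((primitive g z - primitive g x) / 2 ^+ k) * (E x - E z)
    @[k --> \oo] --> expR 0 * (E x - E z).
  apply: cvgM; last exact: cvg_cst.
  apply: continuous_cvg; [exact: continuous_expR|exact: cvg_two_pow].
rewrite expR0 mul1r in cv; rewrite -(cvg_lim _ cv)//; apply: limr_ge; first by apply/cvg_ex; eexists; exact: cv.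
by apply: nearW => k; exact: exp_integral_bound.
Qed.

Lemma integral_exp_primitive_tail x : 0 < x ->
  (\int[leb]_(y in `[x, +oo[) (g y * expR (- primitive g y))%:E <=
   (expR (- primitive g x))%:E)%E.
Proof.
move=> x0; pose F n : set R := `[x, x + n%:R]%classic.
have UF : \bigcup_n F n = `[x, +oo[%classic.
  apply/seteqP; split=> [y [n _]|y] /=; rewrite !in_itv /= ?andbT.
    by case/andP.
  move=> xy; exists (Num.truncn (y - x)).+1 => //; rewrite /F /= in_itv /= xy /=.
  by rewrite -lerBlDl ltW // truncnS_gt.
rewrite -UF; apply: ge0_integral_exhaust.
- move=> m n mn; rewrite subsetEset => y; rewrite /F /= !in_itv /= => /andP[-> ym] /=.
  by apply: le_trans ym _; rewrite lerD2l ler_nat.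
- by move=> i; exact: measurable_itv.
- by move=> i; exact: gE_meas.
- move=> i y; rewrite /F /= in_itv /= => /andP[xy _]; rewrite lee_fin mulr_ge0 ?expR_ge0 //.
  by apply: g_ge0; exact: lt_le_trans xy.
move=> n; have xn : x <= x + n%:R by rewrite lerDl.
have fin : (\int[leb]_(y in F n) (g y * expR (- primitive g y))%:E)%E \is a fin_num.
  by apply: integrable_fin_num; [exact: measurable_itv|exact: gE_int].
rewrite -(fineK fin) lee_fin; apply: le_trans (integral_exp_primitive x0 xn) _.
by rewrite gerBl expR_ge0.
Qed.

End primitives.

(** * The flow of the growth rate *)

Section density_measure.
Context d (T : measurableType d) (R : realType).
Variables (m : {measure set T -> \bar R}) (w : T -> R).
Hypothesis w_meas : measurable_fun setT w.
Hypothesis w_ge0 : forall x, 0 <= w x.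

Definition density_measure
    (mw : measurable_fun setT w) (w0 : forall x, 0 <= w x) (A : set T) : \bar R :=
  (\int[m]_(x in A) (w x)%:E)%E.

Let nu := density_measure w_meas w_ge0.

Let nu0 : nu set0 = 0%E.
Proof. by rewrite /nu /density_measure integral_set0. Qed.

Let nu_ge0 A : (0 <= nu A)%E.
Proof. by apply: integral_ge0 => x _; rewrite lee_fin w_ge0. Qed.

Let nu_sigma_additive : semi_sigma_additive nu.
Proof.
move=> /= F mF tF mUF; rewrite /nu /density_measure; apply: cvg_toP.
  apply: ereal_nondecreasing_is_cvgn => p q pq.
  apply: lee_sum_nneg_natr => // k _ _; apply: integral_ge0 => /= x Fkx.
  by rewrite lee_fin w_ge0.
rewrite ge0_integral_bigcup//=.
- exact/measurable_funTS/measurableT_comp.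
- by move=> x _; rewrite lee_fin w_ge0.
Qed.

HB.instance Definition _ := isMeasure.Build _ _ _ (density_measure w_meas w_ge0)
  nu0 nu_ge0 nu_sigma_additive.

End density_measure.

(** The two divergent integrals say that it takes an infinite time to come from 0
    and to reach infinity, so travel times fill the real line. *)
Record growth_rate (R : realType) (r : R -> R) (C : R) : Prop := GrowthRate {
  growth_cont : {within halfline, continuous r};
  growth_gt0 : forall x : R, 0 < x -> 0 < r x;
  growth_int0 : (\int[@lebesgue_measure R]_(s in `]0%R, 1%R[) ((r s)^-1)%:E = +oo)%E;
  growth_intoo : (\int[@lebesgue_measure R]_(s in `]1%R, +oo[) ((r s)^-1)%:E = +oo)%E;
  growth_const_gt0 : 0 < C;
  growth_le : forall x : R, 0 < x -> r x <= C * x }.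

Section flow.
Context (R : realType) (r : R -> R) (C : R).
Local Notation leb := (@lebesgue_measure R).
Implicit Types (x y z t s h v : R).
Hypothesis rP : growth_rate r C.

Let r_cont := growth_cont rP.
Let r_gt0 := growth_gt0 rP.
Let r_int0 := growth_int0 rP.
Let r_intoo := growth_intoo rP.
Let C_gt0 := growth_const_gt0 rP.
Let r_le := growth_le rP.

(** The time from 1 to [y], negative below 1. *)
Definition travel_time : R -> R := primitive (fun s => (r s)^-1).
Local Notation rho := travel_time.

Lemma segment_halfline x z : 0 < x -> `[x, z] `<=` (halfline : set R).
Proof.
move=> x0 y; rewrite /= !in_itv /= andbT => /andP[xy _]; exact: lt_le_trans xy.
Qed.

Lemma segment_gt0 x z s : 0 < x -> `[x, z]%classic s -> 0 < s.
Proof. by move=> x0 /(segment_halfline x0); rewrite /= in_itv /= andbT. Qed.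

Lemma rV_within : {within halfline, continuous (fun s => (r s)^-1)}.
Proof.
apply/subspace_continuousP => y y0; apply: cvgV.
  by rewrite gt_eqF // r_gt0 //; move: y0; rewrite /= in_itv /= andbT.
by move/subspace_continuousP : r_cont; apply.
Qed.

Lemma rV_measurable : measurable_fun (halfline : set R) (fun s => (r s)^-1).
Proof. by apply: subspace_continuous_measurable_fun => //; exact: rV_within. Qed.

Lemma rV_int : integrable_on_segments (fun s => (r s)^-1).
Proof.
move=> x z x0; apply: continuous_compact_integrable; first exact: segment_compact.
exact: continuous_subspaceW (@segment_halfline x z x0) rV_within.
Qed.

Lemma rV_ge0 x : 0 < x -> 0 <= (r x)^-1.
Proof. by move=> x0; rewrite invr_ge0 ltW // r_gt0. Qed.

Lemma inv_within x y : 0 < x -> {within `[x, y], continuous (fun s : R => s^-1)}.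
Proof.
move=> x0; apply/subspace_continuousP => z /(segment_gt0 x0) z0.
apply: cvgV; first by rewrite gt_eqF.
by apply: cvg_within_filter; exact: cvg_id.
Qed.

Lemma integral_inv x y : 0 < x -> x < y ->
  (\int[leb]_(s in `[x, y]) (s^-1)%:E = (ln y - ln x)%:E)%E.
Proof.
move=> x0 xy; rewrite EFinB; apply: continuous_FTC2 => //.
- exact: inv_within.
- split.
  + move=> z; rewrite in_itv /= => /andP[xz _].
    by have [] := is_derive1_ln (lt_trans x0 xz).
  + apply: cvg_at_right_filter; apply: continuous_ln => //.
  + apply: cvg_at_left_filter; apply: continuous_ln; exact: lt_trans xy.
- move=> z; rewrite in_itv /= => /andP[xz _].
  by rewrite derive1E; have [_ ->] := is_derive1_ln (lt_trans x0 xz).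
Qed.

(** Growth at a rate below [C s] is no faster than exponential growth. *)
Lemma travel_time_ln x y : 0 < x -> x <= y -> ln y - ln x <= C * (rho y - rho x).
Proof.
move=> x0; rewrite le_eqVlt => /predU1P[->|xy]; first by rewrite !subrr mulr0.
rewrite -lee_fin -integral_inv // EFinM -(integral_primitive rV_int x0 (ltW xy)).
have C_ge0 := ltW C_gt0.
rewrite -ge0_integralZl_EFin //; last 2 first.
- by move=> s /(segment_gt0 x0)/rV_ge0; rewrite lee_fin.
- by have /integrableP[] := rV_int y x0.
apply: ge0_le_integral => //.
- by move=> s /(segment_gt0 x0) s0; rewrite lee_fin invr_ge0 ltW.
- apply/measurable_EFinP; apply: subspace_continuous_measurable_fun => //.
  exact: inv_within.
- apply/measurable_EFinP; apply: measurable_funM => //.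
  by have /integrableP[/measurable_EFinP] := rV_int y x0.
- move=> s /(segment_gt0 x0) s0.
  have rs := r_gt0 s0.
  rewrite lee_fin ler_pdivlMr // mulrC ler_pdivrMr //; exact: r_le.
Qed.

Lemma travel_time_lt x y : 0 < x -> x < y -> rho x < rho y.
Proof.
move=> x0 xy; rewrite -subr_gt0 -(pmulr_rgt0 _ C_gt0).
apply: lt_le_trans (travel_time_ln x0 (ltW xy)).
by rewrite subr_gt0 ltr_ln // posrE // (lt_trans x0).
Qed.

Lemma travel_time_le x y : 0 < x -> x <= y -> rho x <= rho y.
Proof. exact: (primitive_nondecreasing rV_int rV_ge0). Qed.

Lemma travel_time_le_mono x y : 0 < x -> 0 < y -> (rho x <= rho y) = (x <= y).
Proof.
move=> x0 y0; apply/idP/idP; last exact: travel_time_le.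
by apply: contraTT; rewrite -!ltNge; exact: travel_time_lt.
Qed.

Lemma travel_time_inj x y : 0 < x -> 0 < y -> rho x = rho y -> x = y.
Proof.
move=> x0 y0 E; apply/eqP.
by rewrite eq_le -(travel_time_le_mono x0 y0) -(travel_time_le_mono y0 x0) E lexx.
Qed.

Let rV_meas x y : 0 < x -> measurable_fun `[x, y] (fun s => ((r s)^-1)%:E).
Proof. by move=> x0; have /integrableP[] := rV_int y x0. Qed.

Lemma travel_time_lower v : exists x, 0 < x /\ rho x <= v.
Proof.
apply: contrapT => H; pose F n : set R := `[n.+1%:R^-1, 1]%classic.
have n0 n : 0 < n.+1%:R^-1 :> R by rewrite invr_gt0.
have UF : \bigcup_n F n = `]0, 1]%classic.
  apply/seteqP; split=> [s [n _]|s]; rewrite /F /= !in_itv /=.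
    by move=> /andP[ns ->]; rewrite (lt_le_trans (n0 n) ns).
  move=> /andP[s0 s1]; exists (Num.truncn s^-1) => //; rewrite /F /= in_itv /= s1 andbT.
  by rewrite invf_ple ?posrE // ltW // truncnS_gt.
suff : (\int[leb]_(s in `]0%R, 1%R]) ((r s)^-1)%:E <= (rho 1 - v)%:E)%E.
  rewrite -integral_itv_bndo_bndc; last first.
    by apply/measurable_EFinP; apply: measurable_funS rV_measurable => // s /=;
      rewrite !in_itv /= andbT => /andP[].
  by rewrite r_int0 leye_eq.
rewrite -UF; apply: ge0_integral_exhaust.
- move=> m n mn; rewrite subsetEset => s; rewrite /F /= !in_itv /= => /andP[ms ->].
  by rewrite andbT; apply: le_trans ms; rewrite lef_pV2 ?posrE // ler_nat.
- by move=> n; exact: measurable_itv.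
- by move=> n; exact: rV_meas.
- move=> n s /(segment_gt0 (n0 n)) s0; by rewrite lee_fin rV_ge0.
- move=> n; rewrite (integral_primitive rV_int) //; last by rewrite invf_le1 // ler1n.
  rewrite lee_fin lerD2l lerN2; apply: contrapT => nv; apply: H.
  by exists n.+1%:R^-1; split => //; rewrite ltW // ltNge; apply/negP.
Qed.

Lemma travel_time_upper v : exists x, 0 < x /\ v <= rho x.
Proof.
apply: contrapT => H; pose F n : set R := `[1, n.+1%:R]%classic.
have UF : \bigcup_n F n = `[1, +oo[%classic.
  apply/seteqP; split=> [s [n _]|s]; rewrite /F /= !in_itv /= andbT.
    by move=> /andP[].
  move=> s1; exists (Num.truncn s) => //; rewrite /F /= in_itv /= s1 /=.
  by rewrite ltW // truncnS_gt.
suff : (\int[leb]_(s in `[1%R, +oo[) ((r s)^-1)%:E <= (v - rho 1)%:E)%E.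
  rewrite -integral_itv_obnd_cbnd; last first.
    apply/measurable_EFinP; apply: measurable_funS rV_measurable => // s /=.
    by rewrite !in_itv /= !andbT; exact: lt_trans.
  by rewrite r_intoo leye_eq.
rewrite -UF; apply: ge0_integral_exhaust.
- move=> m n mn; rewrite subsetEset => s; rewrite /F /= !in_itv /= => /andP[-> sm] /=.
  by apply: le_trans sm _; rewrite ler_nat.
- by move=> n; exact: measurable_itv.
- by move=> n; exact: rV_meas.
- move=> n s /(segment_gt0 ltr01) s0; by rewrite lee_fin rV_ge0.
- move=> n; rewrite (integral_primitive rV_int) //; last by rewrite ler1n.
  rewrite lee_fin lerD2r; apply: contrapT => nv; apply: H.
  by exists n.+1%:R; split => //; rewrite ltW // ltNge; apply/negP.
Qed.

Lemma travel_time_surj v : exists x, 0 < x /\ rho x = v.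
Proof.
have [x [x0 xv]] := travel_time_lower v; have [z [z0 vz]] := travel_time_upper v.
have xz : x <= z by rewrite -travel_time_le_mono // (le_trans xv).
have [y [/andP[xy _] yv]] := primitive_ivt rV_int x0 xz (v := v) ltac:(by rewrite xv vz).
by exists y; split => //; exact: lt_le_trans xy.
Qed.

Definition place (v : R) : R := xget 1 [set x | 0 < x /\ rho x = v].

Lemma placeP v : 0 < place v /\ rho (place v) = v.
Proof.
rewrite /place; case: xgetP => [x -> //|H].
by have [x [x0 xv]] := travel_time_surj v; case: (H x).
Qed.

Lemma place_gt0 v : 0 < place v. Proof. by have [] := placeP v. Qed.

Lemma placeK v : rho (place v) = v. Proof. by have [] := placeP v. Qed.

Lemma travel_timeK x : 0 < x -> place (rho x) = x.
Proof. by move=> x0; apply: travel_time_inj => //; [exact: place_gt0|rewrite placeK]. Qed.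

Lemma place_le s t : (place s <= place t) = (s <= t).
Proof. by rewrite -travel_time_le_mono ?place_gt0 // !placeK. Qed.

Lemma place_lt s t : (place s < place t) = (s < t).
Proof. by rewrite !ltNge place_le. Qed.

Lemma flowE y t : 0 < y -> 0 <= t -> flow r y t = place (rho y - t).
Proof.
move=> y0 t0; rewrite /flow; case: xgetP => [x _ [/andP[x0 xy]]|H].
  rewrite (integral_primitive rV_int x0 xy) => tE.
  have -> : t = rho y - rho x by apply/esym/EFin_inj; exact: tE.
  by rewrite opprB addrCA subrr addr0 travel_timeK.
have xy : place (rho y - t) <= y.
  by rewrite -[X in _ <= X]travel_timeK // place_le gerBl.
case: (H (place (rho y - t))); rewrite /= place_gt0 xy; split => //.
rewrite (integral_primitive rV_int (place_gt0 _) xy) -/rho placeK.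
by congr EFin; rewrite opprB addrCA subrr addr0.
Qed.

Lemma flow_gt0 y t : 0 < y -> 0 <= t -> 0 < flow r y t.
Proof. by move=> y0 t0; rewrite flowE // place_gt0. Qed.

Lemma travel_time_flow y t : 0 < y -> 0 <= t -> rho (flow r y t) = rho y - t.
Proof. by move=> y0 t0; rewrite flowE // placeK. Qed.

Lemma flow_le y t : 0 < y -> 0 <= t -> flow r y t <= y.
Proof.
by move=> y0 t0; rewrite flowE // -[X in _ <= X]travel_timeK // place_le gerBl.
Qed.

Lemma flow_out y t : y <= 0 -> flow r y t = 0.
Proof.
move=> y0; rewrite /flow; case: xgetP => [x _ [/andP[x0 xy]]|//].
by have := lt_le_trans x0 (le_trans xy y0); rewrite ltxx.
Qed.

(** Extended by 0, so that it is the density of a measure on the whole line. *)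
Definition slowness : R -> R := (fun y => (r y)^-1) \_ halfline.

Lemma slowness_pos y : 0 < y -> slowness y = (r y)^-1.
Proof. exact: halfline_pos. Qed.

Lemma slowness_neg y : y <= 0 -> slowness y = 0.
Proof. exact: halfline_neg. Qed.

Lemma slowness_ge0 y : 0 <= slowness y.
Proof. by have [/slowness_neg->//|y0] := leP y 0; rewrite slowness_pos // rV_ge0. Qed.

Lemma slowness_measurable : measurable_fun setT slowness.
Proof. exact: halfline_measurable rV_measurable. Qed.

Lemma travel_time_measurable : measurable_fun (halfline : set R) rho.
Proof. exact: (primitive_measurable rV_int rV_ge0). Qed.

Lemma place_measurable : measurable_fun setT place.
Proof. by apply: nondecreasing_measurable => // s t; rewrite place_le. Qed.

(** [travel_time] transports the measure [dy / r y] to Lebesgue measure,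
    because both give the same mass to intervals. *)
Lemma integral_travel_time c (G : R -> \bar R) :
  measurable_fun setT G -> (forall s, 0 <= G s)%E ->
  (\int[leb]_y (G (rho y - c)%R * (slowness y)%:E) = \int[leb]_s G s)%E.
Proof.
move=> mG G0; pose phi : R -> measurableTypeR R := (fun y => rho y - c) \_ halfline.
have mphi : measurable_fun setT phi.
  apply/(measurable_restrictT _ _).1 => //; apply: measurable_funB => //.
  exact: travel_time_measurable.
have phi_pos y : 0 < y -> phi y = rho y - c.
  by move=> y0; rewrite /phi patchE ifT // inE /= in_itv /= y0.
pose nu : {measure set (measurableTypeR R) -> \bar R} :=
  density_measure leb slowness_measurable slowness_ge0.
transitivity (\int[leb]_y ((G \o phi) y * (slowness y)%:E))%E.
  apply: eq_integral => y _ /=; have [/slowness_neg->|y0] := leP y 0; first by rewrite !mule0.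
  by rewrite phi_pos.
have mGphi : measurable_fun setT (G \o phi) by exact: measurableT_comp.
rewrite -(@ge0_integral_density _ (measurableTypeR R) R leb nu slowness slowness_measurable slowness_ge0) //; last first.
  by move=> y; exact: G0.
rewrite -(@ge0_integral_pushforward _ _ (measurableTypeR R) (measurableTypeR R) R phi mphi nu setT) //.
apply: eq_measure_integral => A mA _; apply/esym.
move: A mA; apply: lebesgue_measure_unique => _ [[p q] _ <-] /=.
rewrite lebesgue_measure_itv /= lte_fin /pushforward /nu /= /density_measure.
have E : (\int[leb]_(x in phi @^-1` `]p, q]) (slowness x)%:E =
    \int[leb]_(x in `]place (p + c), place (q + c)]) ((r x)^-1)%:E)%E.
  rewrite integral_mkcond [RHS]integral_mkcond; apply: eq_integral => x _.
  rewrite !patchE; have [x0|x0] := leP x 0.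
    rewrite (slowness_neg x0) if_same ifF //; apply: memNset; rewrite /= in_itv /=.
    by move=> /andP[px _]; have := lt_trans (place_gt0 _) px; rewrite ltNge x0.
  rewrite (slowness_pos x0) (_ : (x \in phi @^-1` _) = (x \in `]place (p + c), place (q + c)]%classic)) //.
  apply/idP/idP; rewrite !inE /= !in_itv /= phi_pos // ltrBrDr lerBlDr.
    by rewrite -place_lt -place_le travel_timeK.
  by rewrite -[in X in X -> _](travel_timeK x0) place_lt place_le.
rewrite E; case: ifPn => [pq|]; last first.
  rewrite -leNgt => qp; rewrite set_itv_ge ?integral_set0 //.
  by rewrite -leNgt bnd_simp place_le lerD2r.
have pq' : place (p + c) <= place (q + c) by rewrite place_le lerD2r ltW.
have mV : measurable_fun (`]place (p + c), place (q + c)] : set R) (fun x => ((r x)^-1)%:E).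
  apply/measurable_EFinP; apply: measurable_funS rV_measurable => // s /=.
  by rewrite !in_itv /= andbT => /andP[+ _]; exact: lt_trans (place_gt0 _).
rewrite integral_itv_obnd_cbnd; last exact: mV.
rewrite (integral_primitive rV_int (place_gt0 _) pq') -/rho !placeK.
by rewrite -EFinD; congr EFin; rewrite opprD addrACA subrr addr0.
Qed.

Lemma flow_measurable h : 0 <= h -> measurable_fun setT (flow r ^~ h).
Proof.
move=> h0; have -> : flow r ^~ h = (fun y => place (rho y - h)) \_ halfline.
  apply/funext => y; rewrite patchE; have [y0|y0] := leP y 0.
    rewrite flow_out // ifF //; apply: memNset; rewrite /= in_itv /= andbT.
    by apply/negP; rewrite -leNgt.
  by rewrite flowE // ifT // inE /= in_itv /= y0.
apply/(measurable_restrictT _ _).1 => //.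
apply: (measurableT_comp place_measurable); apply: measurable_funB => //.
exact: travel_time_measurable.
Qed.

(** In terms of travel times the flow is a translation. *)
Lemma flow_invariance h (H : R -> \bar R) : 0 <= h ->
  measurable_fun setT H -> (forall s, 0 <= H s)%E ->
  (\int[leb]_y (H (flow r y h) * (slowness y)%:E) = \int[leb]_y (H y * (slowness y)%:E))%E.
Proof.
move=> h0 mH H0.
have mG : measurable_fun setT (H \o place) by apply: measurableT_comp => //; exact: place_measurable.
have G0 s : (0 <= (H \o place) s)%E by exact: H0.
transitivity (\int[leb]_s (H \o place) s)%E.
  rewrite -(integral_travel_time h mG G0); apply: eq_integral => y _ /=.
  have [/slowness_neg->|y0] := leP y 0; first by rewrite !mule0.
  by rewrite flowE.
rewrite -(integral_travel_time 0 mG G0); apply: eq_integral => y _ /=.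
have [/slowness_neg->|y0] := leP y 0; first by rewrite !mule0.
by rewrite subr0 travel_timeK.
Qed.

End flow.

(** * Positive integral operators *)

Lemma ae_imply d (T : measurableType d) (R : realType)
    (m : {measure set T -> \bar R}) (P Q : T -> Prop) :
  {ae m, forall x, P x} -> (forall x, P x -> Q x) -> {ae m, forall x, Q x}.
Proof. by move=> HP PQ; apply: filterS HP. Qed.

Lemma ae_imply2 d (T : measurableType d) (R : realType)
    (m : {measure set T -> \bar R}) (P P' Q : T -> Prop) :
  {ae m, forall x, P x} -> {ae m, forall x, P' x} ->
  (forall x, P x -> P' x -> Q x) -> {ae m, forall x, Q x}.
Proof. by move=> HP HP' PQ; apply: filterS2 HP HP'. Qed.

Lemma ae_imply3 d (T : measurableType d) (R : realType)
    (m : {measure set T -> \bar R}) (P P' P'' Q : T -> Prop) :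
  {ae m, forall x, P x} -> {ae m, forall x, P' x} -> {ae m, forall x, P'' x} ->
  (forall x, P x -> P' x -> P'' x -> Q x) -> {ae m, forall x, Q x}.
Proof. by move=> HP HP' HP'' PQ; apply: filterS3 HP HP' HP''. Qed.

Section kernel_operators.
Context (R : realType).
Local Notation leb := (@lebesgue_measure R).
Local Notation RT := (measurableTypeR R).

Definition kernel_op (k : R -> R -> R) (f : R -> R) (x : R) : R :=
  \int[leb]_y (k x y * f y).

Variables (w : R -> R) (k : R -> R -> R).
Hypothesis w_meas : measurable_fun (setT : set RT) w.
Hypothesis w_ge0 : forall x, 0 <= w x.
Hypothesis k_meas : measurable_fun (setT : set (RT * RT)) (fun z : RT * RT => k z.1 z.2).
Hypothesis k_ge0 : forall x y, 0 <= k x y.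

(** The mass that the operator moves, weighted by its place of arrival.  By
    Tonelli's theorem it bounds the norm, and it can be estimated one column
    at a time. *)
Definition kernel_mass (f : R -> R) : \bar R :=
  (\int[leb]_y \int[leb]_x (w x * (k x y * `|f y|))%:E)%E.

Implicit Types f g : R -> R.

Let mkf f : measurable_fun (setT : set RT) f ->
  measurable_fun (setT : set (RT * RT)) (fun z : RT * RT => (k z.1 z.2 * f z.2)%:E).
Proof.
move=> mf; apply/measurable_EFinP; apply: measurable_funM => //.
exact: measurableT_comp.
Qed.

Let mwkf f : measurable_fun (setT : set RT) f ->
  measurable_fun (setT : set (RT * RT))
    (fun z : RT * RT => (w z.1 * (k z.1 z.2 * `|f z.2|))%:E).
Proof.
move=> mf; apply/measurable_EFinP; apply: measurable_funM.
  exact: measurableT_comp.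
apply: measurable_funM => //; apply: measurableT_comp => //.
exact: measurableT_comp.
Qed.

Let wkf_ge0 f x y : (0 <= (w x * (k x y * `|f y|))%:E)%E.
Proof. by rewrite lee_fin mulr_ge0 ?mulr_ge0. Qed.

Lemma kernel_mass_swap f : measurable_fun (setT : set RT) f ->
  kernel_mass f = (\int[leb]_x \int[leb]_y (w x * (k x y * `|f y|))%:E)%E.
Proof.
move=> mf; apply/esym.
exact: (@fubini_tonelli _ _ RT RT R leb leb _ (mwkf mf) (fun z => wkf_ge0 f z.1 z.2)).
Qed.

Lemma ksection_measurable f x : measurable_fun (setT : set RT) f ->
  measurable_fun (setT : set RT) (fun y => (k x y * f y)%:E).
Proof.
move=> mf; have mp : measurable_fun (setT : set RT) (fun y : RT => (x, y) : RT * RT).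
  by apply: measurable_fun_pair.
exact: (measurableT_comp (mkf mf) mp).
Qed.

Lemma kernel_op_measurable f : measurable_fun (setT : set RT) f ->
  measurable_fun (setT : set RT) (kernel_op k f).
Proof.
move=> mf; pose h (z : RT * RT) := (k z.1 z.2 * f z.2)%:E.
have mp : measurable_fun (setT : set RT)
    (fun x => \int[leb]_y (h^\+ (x, y)))%E.
  apply: (@measurable_fun_fubini_tonelli_F _ _ RT RT R leb).
    by apply: measurable_funepos; exact: mkf.
  by move=> z; exact: funepos_ge0.
have mn : measurable_fun (setT : set RT)
    (fun x => \int[leb]_y (h^\- (x, y)))%E.
  apply: (@measurable_fun_fubini_tonelli_F _ _ RT RT R leb).
    by apply: measurable_funeneg; exact: mkf.
  by move=> z; exact: funeneg_ge0.
have -> : kernel_op k f = (fun x => fine (\int[leb]_y (h^\+ (x, y)) - \int[leb]_y (h^\- (x, y))))%E.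
  by apply/funext => x; rewrite /kernel_op /Rintegral integralE; congr (fine (_ - _)%E);
    apply: eq_integral => y _; rewrite ?funeposE ?funenegE.
apply: measurableT_comp; first exact: fine_measurable.
exact: emeasurable_funB.
Qed.

Lemma kernel_op_ae_integrable f : measurable_fun (setT : set RT) f -> (kernel_mass f < +oo)%E ->
  {ae leb, forall x, w x != 0 -> leb.-integrable setT (fun y => (k x y * f y)%:E)}.
Proof.
move=> mf; rewrite kernel_mass_swap // => fin.
have mF : measurable_fun (setT : set RT)
    (fun x => \int[leb]_y (w x * (k x y * `|f y|))%:E)%E.
  apply: (@measurable_fun_fubini_tonelli_F _ _ RT RT R leb _ (mwkf mf)).
  by move=> z; exact: wkf_ge0.
have iF : leb.-integrable setT (fun x => \int[leb]_y (w x * (k x y * `|f y|))%:E)%E.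
  apply/integrableP; split => //.
  under eq_integral do rewrite gee0_abs ?integral_ge0 //.
  exact: fin.
have := @integrable_ae _ _ R leb _ measurableT _ iF; apply: filterS => x /(_ I) fx wx.
apply/integrableP; split; first exact: ksection_measurable.
have w0 : 0 < w x by rewrite lt_neqAle eq_sym wx w_ge0.
have ma : measurable_fun (setT : set RT) (fun y => `|(k x y * f y)%:E|)%E.
  by apply: measurableT_comp => //; exact: ksection_measurable.
have E : (\int[leb]_y (w x * (k x y * `|f y|))%:E =
    (w x)%:E * \int[leb]_y `|(k x y * f y)%:E|)%E.
  rewrite -ge0_integralZl_EFin //.
  by apply: eq_integral => y _; rewrite -EFinM /= normrM (ger0_norm (k_ge0 _ _)).
move: fx; rewrite E ge0_fin_numE ?mule_ge0 ?integral_ge0 // ?lee_fin //.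
set J := (\int[leb]_y _)%E; have : (0 <= J)%E by exact: integral_ge0.
case: J => [j _ _||//] //; first exact: ltry.
by move=> _; rewrite gt0_muley // lte_fin.
Qed.

Lemma kernel_op_le f : measurable_fun (setT : set RT) f ->
  (\int[leb]_x (`|kernel_op k f x|%:E * (w x)%:E) <= kernel_mass f)%E.
Proof.
move=> mf; rewrite kernel_mass_swap //; apply: ge0_le_integral => //.
- by move=> x _; rewrite mule_ge0 ?lee_fin.
- apply: emeasurable_funM; apply/measurable_EFinP => //.
  by apply: measurableT_comp => //; exact: kernel_op_measurable.
- apply: (@measurable_fun_fubini_tonelli_F _ _ RT RT R leb _ (mwkf mf)).
  by move=> z; exact: wkf_ge0.
move=> x _; have ma : measurable_fun (setT : set RT) (fun y => `|(k x y * f y)%:E|)%E.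
  by apply: measurableT_comp => //; exact: ksection_measurable.
have -> : (\int[leb]_y (w x * (k x y * `|f y|))%:E =
    (w x)%:E * \int[leb]_y `|(k x y * f y)%:E|)%E.
  rewrite -ge0_integralZl_EFin //.
  by apply: eq_integral => y _; rewrite -EFinM /= normrM (ger0_norm (k_ge0 _ _)).
rewrite muleC lee_wpmul2l ?lee_fin //.
apply: le_trans (le_abse_integral _ _ (ksection_measurable x mf)) => //.
by rewrite /kernel_op /Rintegral; case: (\int[leb]_y _)%E => [j| |] /=; rewrite ?normr0 ?leey ?lexx.
Qed.

Lemma kernel_op_lin (c : R) f g x :
  leb.-integrable setT (fun y => (k x y * f y)%:E) ->
  leb.-integrable setT (fun y => (k x y * g y)%:E) ->
  kernel_op k (fun y => c * f y + g y) x = c * kernel_op k f x + kernel_op k g x.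
Proof.
move=> fi gi; apply: EFin_inj; rewrite EFinD EFinM.
have ci : leb.-integrable setT (fun y => c%:E * (k x y * f y)%:E)%E by exact: integrableZl.
have E (u : R -> R) : leb.-integrable setT (fun y => (u y)%:E) ->
    (\int[leb]_y u y)%:E = (\int[leb]_y (u y)%:E)%E.
  by move=> ui; rewrite /Rintegral fineK //; exact: integrable_fin_num.
rewrite /kernel_op (E _ fi) (E _ gi) -integralZl // -integralD // E.
  by apply: eq_integral => y _; rewrite -EFinM -EFinD; congr EFin; ring.
have := integrableD measurableT ci gi; apply: eq_integrable => // y _ /=.
by rewrite -EFinM -EFinD; congr EFin; ring.
Qed.

Hypothesis k_neg : forall x y, y <= 0 -> k x y = 0.

Lemma kernel_op_ext f g : measurable_fun (setT : set RT) f -> measurable_fun (setT : set RT) g ->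
  {ae leb, forall y, 0 < y -> f y = g y} -> kernel_op k f = kernel_op k g.
Proof.
move=> mf mg fg; apply/funext => x; rewrite /kernel_op /Rintegral; congr fine.
apply: ae_eq_integral => //; [exact: ksection_measurable|exact: ksection_measurable|].
apply: (ae_imply fg) => y fgy _; have [y0|y0] := leP y 0.
  by rewrite k_neg // !mul0r.
by rewrite fgy.
Qed.

Lemma kernel_mass_le (M : R -> R) f : measurable_fun (setT : set RT) f ->
  measurable_fun (setT : set RT) M ->
  (forall y, 0 < y -> (\int[leb]_x (w x * k x y)%:E <= (M y)%:E)%E) ->
  (forall y, 0 <= M y) ->
  (kernel_mass f <= \int[leb]_y (M y * `|f y|)%:E)%E.
Proof.
move=> mf mM HM M0; apply: ge0_le_integral => //.
- by move=> y _; exact: integral_ge0.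
- apply: (@measurable_fun_fubini_tonelli_G _ _ RT RT R leb _ (mwkf mf)).
  by move=> z; exact: wkf_ge0.
- apply/measurable_EFinP; apply: measurable_funM => //.
  exact: measurableT_comp.
move=> y _; have [y0|y0] := leP y 0.
  rewrite integral0_eq ?lee_fin ?mulr_ge0 // => x _.
  by rewrite k_neg // mul0r mulr0.
have mk : measurable_fun (setT : set RT) (fun x => (w x * k x y)%:E).
  apply/measurable_EFinP; apply: measurable_funM => //.
  have mp : measurable_fun (setT : set RT) (fun x : RT => (x, y) : RT * RT).
    by apply: measurable_fun_pair.
  exact: (measurableT_comp k_meas mp).
have -> : (\int[leb]_x (w x * (k x y * `|f y|))%:E =
    `|f y|%:E * \int[leb]_x (w x * k x y)%:E)%E.
  rewrite -ge0_integralZl_EFin //.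
    by apply: eq_integral => x _; rewrite -EFinM; congr EFin; ring.
  by move=> x _; rewrite lee_fin mulr_ge0.
by rewrite mulrC EFinM lee_wpmul2l ?lee_fin // HM.
Qed.

End kernel_operators.

Section weighted_facts.
Context (R : realType) (alpha : R).
Local Notation leb := (@lebesgue_measure R).
Local Notation RT := (measurableTypeR R).
Local Notation X := (L1 (weighted alpha)).

Lemma weight_pos (x : R) : 0 < x -> weight alpha x = x `^ alpha.
Proof. exact: halfline_pos. Qed.

Lemma weight_neg (x : R) : x <= 0 -> weight alpha x = 0.
Proof. exact: halfline_neg. Qed.

Lemma weight_gt0 (x : R) : 0 < x -> 0 < weight alpha x.
Proof. by move=> x0; rewrite weight_pos // powR_gt0. Qed.

Lemma weight_eq0 (x : R) : (weight alpha x != 0) = (0 < x).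
Proof.
have [x0|x0] := leP x 0; first by rewrite weight_neg // eqxx.
by rewrite gt_eqF // weight_gt0.
Qed.

Let w_meas : measurable_fun (setT : set RT) (weight alpha) := measurable_weight alpha.
Let w_ge0 := weight_ge0 alpha.

Lemma ae_weighted (P : R -> Prop) :
  {ae weighted alpha, forall x, P x} <-> {ae leb, forall x, 0 < x -> P x}.
Proof.
split=> H.
  have := @ae_density _ RT R leb (weighted alpha) _ w_meas w_ge0 (fun _ _ => erefl) P H.
  by move=> /ae_imply; apply=> x; rewrite weight_eq0.
apply: (@density_ae _ RT R leb (weighted alpha) _ w_meas (fun _ _ => erefl)).
by apply: (ae_imply H) => x; rewrite weight_eq0.
Qed.

Lemma ge0_integral_weighted (f : R -> \bar R) :
  measurable_fun (setT : set RT) f -> (forall x, 0 <= f x)%E ->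
  (\int[weighted alpha]_x f x = \int[leb]_x (f x * (weight alpha x)%:E))%E.
Proof.
exact: (@ge0_integral_density _ RT R leb (weighted alpha) _ w_meas w_ge0 (fun _ _ => erefl)).
Qed.

Lemma Xspace_normE (f : X) :
  (`|f|%:E = \int[leb]_x (`|L1_fun f x|%:E * (weight alpha x)%:E))%E.
Proof.
rewrite L1_normE ge0_integral_weighted //.
by apply: measurableT_comp => //; exact/measurable_EFinP/L1_fun_measurable.
Qed.

Lemma Xspace_normE' (f : X) :
  (`|f|%:E = \int[leb]_x (weight alpha x * `|L1_fun f x|)%:E)%E.
Proof. by rewrite Xspace_normE; apply: eq_integral => x _; rewrite -EFinM mulrC. Qed.

Lemma weighted_integrable (g : R -> R) : measurable_fun (setT : set RT) g ->
  (\int[leb]_x (`|g x|%:E * (weight alpha x)%:E) < +oo)%E ->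
  (weighted alpha).-integrable setT (EFin \o g).
Proof.
move=> mg fin; apply/integrableP; split; first exact/measurable_EFinP.
rewrite ge0_integral_weighted //; apply: measurableT_comp => //.
exact/measurable_EFinP.
Qed.

Section kernel_map.
Variable k : R -> R -> R.
Hypothesis k_meas : measurable_fun (setT : set (RT * RT)) (fun z : RT * RT => k z.1 z.2).
Hypothesis k_ge0 : forall x y, 0 <= k x y.
Hypothesis k_neg : forall x y, y <= 0 -> k x y = 0.
Implicit Types f g : X.

Definition kernel_map f : X := toL1 (weighted alpha) (kernel_op k (L1_fun f)).

(** A finite mass makes the integrals in [kernel_op] converge almost everywhere;
    without it [kernel_map] need not be additive. *)
Definition kernel_finite f : Prop := (kernel_mass (weight alpha) k (L1_fun f) < +oo)%E.

Lemma kernel_map_integrable f : kernel_finite f ->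
  (weighted alpha).-integrable setT (EFin \o kernel_op k (L1_fun f)).
Proof.
move=> fin; have mf := L1_fun_measurable f.
apply: weighted_integrable; first exact: kernel_op_measurable.
exact: le_lt_trans (kernel_op_le w_meas w_ge0 k_meas k_ge0 mf) fin.
Qed.

Lemma kernel_map_ae f : kernel_finite f ->
  {ae weighted alpha, forall x, leb.-integrable setT (fun y => (k x y * L1_fun f y)%:E)}.
Proof.
move=> fin; apply/ae_weighted.
have := kernel_op_ae_integrable w_meas w_ge0 k_meas k_ge0 (L1_fun_measurable f) fin.
by move=> /ae_imply; apply=> x; rewrite weight_eq0.
Qed.

Lemma kernel_map_norm f : kernel_finite f ->
  (`|kernel_map f|%:E <= kernel_mass (weight alpha) k (L1_fun f))%E.
Proof.
move=> fin; have mf := L1_fun_measurable f.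
rewrite toL1_normE; last exact: kernel_map_integrable.
rewrite ge0_integral_weighted //.
  exact: kernel_op_le.
apply: measurableT_comp => //; apply/measurable_EFinP; exact: kernel_op_measurable.
Qed.

Lemma kernel_op_congr (u v : R -> R) : measurable_fun (setT : set RT) u ->
  measurable_fun (setT : set RT) v ->
  {ae weighted alpha, forall x, u x = v x} -> kernel_op k u = kernel_op k v.
Proof. by move=> mu mv /ae_weighted uv; exact: kernel_op_ext. Qed.

Lemma kernel_map_lin (c : R) f g : kernel_finite f -> kernel_finite g ->
  kernel_map (c *: f + g) = c *: kernel_map f + kernel_map g.
Proof.
move=> ff fg; have mf := L1_fun_measurable f; have mg := L1_fun_measurable g.
rewrite -toL1_lin; [|exact: kernel_map_integrable..].
have E : kernel_op k (L1_fun (c *: f + g)) = kernel_op k (fun y => c * L1_fun f y + L1_fun g y).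
  apply: kernel_op_congr; [exact: L1_fun_measurable| |exact: L1_fun_lin].
  by apply: measurable_funD => //; exact: measurable_funM.
rewrite /kernel_map E; apply: L1_ext.
have ff' := kernel_map_ae ff; have fg' := kernel_map_ae fg.
have lin : {ae weighted alpha, forall x, kernel_op k (fun y => c * L1_fun f y + L1_fun g y) x =
    c * kernel_op k (L1_fun f) x + kernel_op k (L1_fun g) x}.
  by apply: (ae_imply2 ff' fg') => x fx gx; exact: kernel_op_lin.
have i1 := kernel_map_integrable ff; have i2 := kernel_map_integrable fg.
have i3 : (weighted alpha).-integrable setT
    (EFin \o (fun x => c * kernel_op k (L1_fun f) x + kernel_op k (L1_fun g) x)).
  have := integrableD measurableT (integrableZl measurableT c i1) i2.
  by apply: eq_integrable.
have i4 : (weighted alpha).-integrable setT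
    (EFin \o kernel_op k (fun y => c * L1_fun f y + L1_fun g y)).
  apply/integrableP; split.
    apply/measurable_EFinP; apply: kernel_op_measurable => //.
    by apply: measurable_funD => //; exact: measurable_funM.
  have /integrableP[m3] := i3; congr (_ < _)%E.
  apply: ae_eq_integral => //.
  - exact: measurableT_comp.
  - apply: measurableT_comp => //; apply/measurable_EFinP; apply: kernel_op_measurable => //.
    by apply: measurable_funD => //; exact: measurable_funM.
  - by apply: (ae_imply lin) => x /= -> _.
by apply: (ae_imply3 (toL1_ae i3) (toL1_ae i4) lin) => x -> -> ->.
Qed.

Lemma kernel_map_pos f : kernel_finite f -> L1_nneg f -> L1_nneg (kernel_map f).
Proof.
move=> fin f0; apply: toL1_nneg; first exact: kernel_map_integrable.
have mf := L1_fun_measurable f.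
have -> : kernel_op k (L1_fun f) = kernel_op k (fun y => `|L1_fun f y|).
  apply: kernel_op_congr => //; first exact: measurableT_comp.
  by apply: (ae_imply f0) => x fx; rewrite ger0_norm.
by apply: nearW => x; apply: Rintegral_ge0 => y _; rewrite mulr_ge0.
Qed.

End kernel_map.
End weighted_facts.

Lemma primitive_lin (R : realType) (c : R) (f g : R -> R) y :
  integrable_on_segments f -> integrable_on_segments g -> 0 < y ->
  primitive (fun x => c * f x + g x) y = c * primitive f y + primitive g y.
Proof.
move=> fi gi y0; pose leb := @lebesgue_measure R.
have lin u v : 0 < u -> \int[leb]_(t in `[u, v]) (c * f t + g t) =
    c * \int[leb]_(t in `[u, v]) f t + \int[leb]_(t in `[u, v]) g t.
  move=> u0; have ci : leb.-integrable `[u, v] (EFin \o (fun t => c * f t)).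
    have ci' : leb.-integrable `[u, v] (fun t => c%:E * (f t)%:E)%E.
      by apply: integrableZl => //; exact: fi.
    exact: ci'.
  rewrite RintegralD //; last exact: gi.
  by rewrite RintegralZl //; exact: fi.
by rewrite /primitive !lin //; ring.
Qed.

Lemma derivable_seq (R : realType) (F : R -> R) (y c : R) (k : nat -> R) :
  derivable F y 1 -> derive1 F y = c -> k @ \oo --> 0 -> (forall n, k n != 0) ->
  (k n)^-1 * (F (y + k n) - F y) @[n --> \oo] --> c.
Proof.
move=> dF Fc k0 kn0.
have cF : h^-1 *: (F (h *: 1 + y) - F y) @[h --> 0^'] --> c.
  by rewrite -Fc derive1E; move: dF => /cvg_ex[v cv]; rewrite /derive (cvg_lim _ cv).
have kd : k n @[n --> \oo] --> 0^'.
  move=> A [e /= e0 Ae]; have /cvgrPdist_lt/(_ e e0)[N _ HN] := k0.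
  exists N => // n Nn; apply: Ae; last exact: kn0.
  by rewrite /= ; exact: HN.
have := cvg_comp _ _ kd cF; apply: cvg_trans.
apply: near_eq_cvg; apply: nearW => n /=.
by rewrite /GRing.scale /= mulr1 [k n + y]addrC.
Qed.

(** Scheffe's lemma. The positive part of [f - K n] is dominated by [f],
    and its negative part has no larger mass because the norm of [K n] is
    at most that of [f]. *)
Lemma L1_scheffe d (T : measurableType d) (R : realType)
    (mu : {measure set T -> \bar R}) (f : L1 mu) (K : nat -> L1 mu) :
  L1_nneg f -> (forall n, L1_nneg (K n)) -> (forall n, `|K n| <= `|f|) ->
  {ae mu, forall x, L1_fun (K n) x @[n --> \oo] --> L1_fun f x} ->
  `|f - K n| @[n --> \oo] --> 0.
Proof.
move=> f0 K0 Kf Kae; have mf := L1_fun_measurable f.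
have mK n := L1_fun_measurable (K n).
pose g n x := 2 * Num.max (L1_fun f x - L1_fun (K n) x) 0.
have mg n : measurable_fun setT (g n).
  by apply: measurable_funM => //; apply: measurable_maxr => //; exact: measurable_funB.
have meg n : measurable_fun setT (EFin \o g n) by exact/measurable_EFinP.
have g_ge0 n x : 0 <= g n x by rewrite mulr_ge0 // le_max lexx orbT.
have ig : mu.-integrable setT (fun x => 2%:E * `|(L1_fun f x)%:E|)%E.
  by apply: integrableZl => //; exact: integrable_abse (L1_fun_integrable f).
have g_dom : {ae mu, forall x n, setT x -> (`|(g n x)%:E| <= 2%:E * `|(L1_fun f x)%:E|)%E}.
  have K0' : {ae mu, forall x, forall n, 0 <= L1_fun (K n) x} by apply/ae_foralln.
  apply: (ae_imply K0') => x Kx n _.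
  rewrite gee0_abs ?lee_fin // /g ler_pM2l // ge_max normr_ge0 andbT.
  by apply: le_trans (ler_norm _); rewrite gerBl.
have g_cvg : {ae mu, forall x, setT x -> (EFin \o g n) x @[n --> \oo] --> 0%E}.
  apply: (ae_imply Kae) => x Kx _; apply: cvg_EFin; first exact: nearW.
  apply: (@squeeze_cvgr _ _ _ _ (fun=> 0) (fun n => 2 * `|L1_fun f x - L1_fun (K n) x|)).
  - by apply: nearW => n /=; rewrite g_ge0 /= ler_pM2l // ge_max normr_ge0 ler_norm.
  - exact: cvg_cst.
  rewrite -(mulr0 2); apply: cvgM; first exact: cvg_cst.
  rewrite -(normr0 R) -(subrr (L1_fun f x)); apply: cvg_norm.
  by apply: cvgB => //; exact: cvg_cst.
have [_ _] := @dominated_convergence _ T R mu setT measurableT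
  (fun n => EFin \o g n) (cst 0%E) _ meg (measurable_cst _) g_cvg ig g_dom.
rewrite integral0 => G_cvg.
have aux (p q : R) : `|p - q| + p <= q + 2 * Num.max (p - q) 0.
  by case: (lerP (p - q) 0) => pq; [rewrite ler0_norm //|rewrite gtr0_norm //]; lra.
have le_G n : (`|f - K n|%:E <= \int[mu]_x (g n x)%:E)%E.
  rewrite -(@leeD2rE _ `|f|%:E) //.
  apply: (@le_trans _ _ (`|K n|%:E + \int[mu]_x (g n x)%:E)%E); last first.
    by rewrite addeC leeD2l // lee_fin.
  rewrite (L1_normE (K n)) -(@L1_normE_le _ _ _ _ f (K n) (fun x => L1_fun f x - L1_fun (K n) x)); last 2 first.
  - exact: nearW.
  - exact: measurable_funB.
  have mfK : measurable_fun setT (fun x => `|(L1_fun f x - L1_fun (K n) x)%:E|)%E.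
    by apply: measurableT_comp => //; apply/measurable_EFinP; exact: measurable_funB.
  have maf : measurable_fun setT (fun x => `|(L1_fun f x)%:E|)%E.
    by apply: measurableT_comp => //; exact/measurable_EFinP.
  have maK : measurable_fun setT (fun x => `|(L1_fun (K n) x)%:E|)%E.
    by apply: measurableT_comp => //; exact/measurable_EFinP.
  rewrite (L1_normE f) -!ge0_integralD //; last 2 first.
  - by move=> x _; rewrite lee_fin.
  - exact: meg.
  apply: ae_ge0_le_integral.
  - exact: measurableT.
  - by move=> x _; exact: adde_ge0.
  - exact: emeasurable_funD.
  - by move=> x _; rewrite adde_ge0 // lee_fin.
  - exact: emeasurable_funD maK (meg n).
  apply: (ae_imply2 f0 (K0 n)) => x fx Kx _.
  rewrite -!EFinD lee_fin (ger0_norm fx) (ger0_norm Kx) /g.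
  exact: aux.
have G_fin n : (\int[mu]_x (g n x)%:E)%E \is a fin_num.
  have /integrableP[m2 fin2] := ig.
  rewrite ge0_fin_numE; last by apply: integral_ge0 => x _; rewrite lee_fin.
  apply: le_lt_trans fin2; apply: ae_ge0_le_integral => //.
  - by move=> x _; rewrite lee_fin.
  - exact: meg.
  - exact: measurableT_comp.
  apply: (ae_imply g_dom) => x /(_ n) gx Tx; have := gx Tx.
  have gE : `|(g n x)%:E|%E = (g n x)%:E by rewrite gee0_abs ?lee_fin.
  by rewrite gE => /le_trans; apply; exact: lee_abs.
have fG : (fun n => fine (\int[mu]_x (g n x)%:E)%E) @ \oo --> (0 : R).
  exact: fine_cvg.
apply/cvgrPdist_le => e e0; have /cvgrPdist_le/(_ e e0) := fG.
apply: filterS => n; rewrite !sub0r !normrN normr_id => Ge.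
apply: le_trans Ge; apply: le_trans (ler_norm _).
by have lG := le_G n; rewrite -(fineK (G_fin n)) lee_fin in lG.
Qed.

Lemma le_of_eq d (T : porderType d) (x y : T) : x = y -> (x <= y)%O.
Proof. by move=> ->. Qed.

Lemma L1_norm_add d (T : measurableType d) (R : realType)
    (mu : {measure set T -> \bar R}) (f g : L1 mu) :
  L1_nneg f -> L1_nneg g -> `|f + g| = `|f| + `|g|.
Proof.
move=> f0 g0; have fg0 : L1_nneg (f + g) by rewrite -[f]scale1r; exact: L1_nneg_lin.
rewrite -(L1_integral_nneg fg0) -(L1_integral_nneg f0) -(L1_integral_nneg g0).
by rewrite -{1}[f]scale1r L1_integral_lin mul1r.
Qed.

Lemma L1_norm_le_add d (T : measurableType d) (R : realType)
    (mu : {measure set T -> \bar R}) (k : R) (f g h : L1 mu) :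
  0 <= k -> L1_nneg f -> L1_nneg g -> h = f + k *: g -> `|f| <= `|h|.
Proof.
move=> k0 f0 g0 ->; have kg0 : L1_nneg (k *: g).
  apply: (ae_imply2 g0 (L1_funZ k g)) => x gx ->; exact: mulr_ge0.
by rewrite L1_norm_add // lerDl.
Qed.

(** * The resolvent of transport *)

Section growth_fragmentation.
Context (R : realType) (alpha : R) (r : R -> R) (C : R) (a : R -> R).
Hypothesis alpha_ge0 : 0 <= alpha.
Hypothesis rP : growth_rate r C.
Hypothesis a_loc : locally_integrable halfline a.
Hypothesis a_ge0 : forall y, 0 < y -> 0 <= a y.
Local Notation leb := (@lebesgue_measure R).
Local Notation RT := (measurableTypeR R).
Local Notation X := (L1 (weighted alpha)).
Local Notation rho := (travel_time r).
Local Notation slowness := (slowness r).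
Local Notation tf := (transport_fun r a).
Local Notation U := (@transport R alpha r a).

Let r_gt0 := growth_gt0 rP.
Let w_meas : measurable_fun (setT : set RT) (weight alpha) := measurable_weight alpha.
Let w_ge0 := weight_ge0 alpha.

Implicit Types (x y z t s h l m : R) (f g : X).

Lemma absorption_int : integrable_on_segments (fun s => a s / r s).
Proof.
move=> x z x0; have [xz|zx] := leP x z; last first.
  rewrite set_itv_ge; first exact: integrable_set0.
  by rewrite -leNgt bnd_simp.
have cV := continuous_subspaceW (@segment_halfline _ x z x0) (rV_within rP).
have [c cxz cM] := EVT_max xz cV.
have [a_meas _ a_fin] := a_loc.
have ia : leb.-integrable `[x, z] (EFin \o a).
  apply/integrableP; split.
    by apply/measurable_EFinP; apply: measurable_funS a_meas => //; exact: segment_halfline.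
  by apply: a_fin; [exact: segment_halfline|exact: segment_compact].
have c0 : 0 < c by apply: (segment_gt0 x0 (z := z)).
have ica : leb.-integrable `[x, z] (fun s => ((r c)^-1)%:E * (a s)%:E)%E.
  by apply: integrableZl.
apply: le_integrable ica => //.
  apply/measurable_EFinP; apply: measurable_funM.
    by apply: measurable_funS a_meas => //; exact: segment_halfline.
  by apply: measurable_funS (rV_measurable rP) => //; exact: segment_halfline.
move=> s sxz /=; have s0 := segment_gt0 x0 sxz.
rewrite lee_fin mulrC !normrM ler_wpM2r //.
rewrite !ger0_norm ?invr_ge0 ?(ltW (r_gt0 _)) //.
exact: cM.
Qed.

Lemma absorption_ge0 x : 0 < x -> 0 <= a x / r x.
Proof. by move=> x0; rewrite divr_ge0 ?a_ge0 // ltW // r_gt0. Qed.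

Definition absorbed : R -> R := primitive (fun s => a s / r s).

(** The exponent of the integrating factor of (l - T) u = f. *)
Definition potential l y : R := l * rho y + absorbed y.

Lemma potential_primitive l y : 0 < y ->
  potential l y = primitive (fun s => l * (r s)^-1 + a s / r s) y.
Proof.
by move=> y0; rewrite primitive_lin //; [exact: (rV_int rP)|exact: absorption_int].
Qed.

Lemma absorbed_le x y : 0 < x -> x <= y -> absorbed x <= absorbed y.
Proof. exact: (primitive_nondecreasing absorption_int absorption_ge0). Qed.

(** A bound for the growth rate of [y ^ alpha] along the flow. *)
Definition growth_bound : R := alpha * C.
Local Notation omega := growth_bound.

Lemma growth_bound_ge0 : 0 <= omega.
Proof. by rewrite mulr_ge0 // ltW // (growth_const_gt0 rP). Qed.

Lemma power_growth x y : 0 < x -> x <= y ->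
  y `^ alpha <= x `^ alpha * expR (omega * (rho y - rho x)).
Proof.
move=> x0 xy; have y0 := lt_le_trans x0 xy.
rewrite /powR !gt_eqF // -expRD ler_expR -lerBlDl -mulrBr /growth_bound -mulrA.
by rewrite ler_wpM2l // (travel_time_ln rP).
Qed.

Lemma potential_growth l x y : omega <= l -> 0 < x -> x <= y ->
  y `^ alpha * expR (potential l x - potential l y) <= x `^ alpha.
Proof.
move=> ol x0 xy; pose d := omega * (rho y - rho x).
have E : x `^ alpha = x `^ alpha * expR d * expR (- d).
  by rewrite -mulrA expRxMexpNx_1 mulr1.
rewrite [X in _ <= X]E; apply: ler_pM; rewrite ?powR_ge0 ?expR_ge0 ?power_growth //.
rewrite ler_expR /potential /d.
have := absorbed_le x0 xy; have := travel_time_le rP x0 xy.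
move: (absorbed x) (absorbed y) (rho x) (rho y) => Ax Ay u v uv AA.
have : (l - omega) * (v - u) >= 0 by rewrite mulr_ge0 ?subr_ge0.
move: omega ol => o ol; nra.
Qed.

Definition decay l : R -> R := (fun y => expR (- potential l y)) \_ halfline.
Definition gain l : R -> R := (fun y => expR (potential l y)) \_ halfline.

Lemma potential_measurable l : measurable_fun (halfline : set R) (potential l).
Proof.
apply: measurable_funD.
  by apply: measurable_funM => //; exact: (travel_time_measurable rP).
exact: (primitive_measurable absorption_int absorption_ge0).
Qed.

Lemma decay_measurable l : measurable_fun setT (decay l).
Proof.
apply: halfline_measurable; apply: measurableT_comp => //.
by apply: measurableT_comp => //; exact: potential_measurable.
Qed.

Lemma gain_measurable l : measurable_fun setT (gain l).
Proof.
by apply: halfline_measurable; apply: measurableT_comp => //; exact: potential_measurable.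
Qed.

Lemma decay_ge0 l y : 0 <= decay l y.
Proof.
have [y0|y0] := leP y 0; first by rewrite /decay halfline_neg.
by rewrite /decay halfline_pos ?expR_ge0.
Qed.

Lemma gain_ge0 l y : 0 <= gain l y.
Proof.
have [y0|y0] := leP y 0; first by rewrite /gain halfline_neg.
by rewrite /gain halfline_pos ?expR_ge0.
Qed.

(** Variation of constants: the solution of (l - T) u = f is
    u(y) = e^{-L(y)} / r(y) * int_0^y e^{L(x)} f(x) dx, with L the [potential]. *)
Definition resolvent_kernel l y x : R := if x <= y then slowness y * decay l y * gain l x else 0.
Local Notation Rk := resolvent_kernel.

Lemma resolvent_kernel_ge0 l y x : 0 <= Rk l y x.
Proof.
by rewrite /Rk; case: ifP => // _; rewrite mulr_ge0 ?gain_ge0 // mulr_ge0 ?decay_ge0 // (slowness_ge0 rP).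
Qed.

Lemma resolvent_kernel_neg l y x : x <= 0 -> Rk l y x = 0.
Proof. by move=> x0; rewrite /Rk [gain l x]halfline_neg // mulr0 if_same. Qed.

Lemma resolvent_kernel_measurable l :
  measurable_fun (setT : set (RT * RT)) (fun z : RT * RT => Rk l z.1 z.2).
Proof.
apply: measurable_fun_ifT.
- by apply: measurable_fun_ler.
- apply: measurable_funM.
    apply: measurable_funM; apply: measurableT_comp => //.
      exact: (slowness_measurable rP).
    exact: decay_measurable.
  by apply: measurableT_comp => //; exact: gain_measurable.
- exact: measurable_cst.
Qed.

Definition absorption_rate : R -> R := a \_ halfline.

Lemma absorption_rate_ge0 y : 0 <= absorption_rate y.
Proof.
have [y0|y0] := leP y 0; first by rewrite /absorption_rate halfline_neg.
by rewrite /absorption_rate halfline_pos ?a_ge0.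
Qed.

Lemma absorption_rate_measurable : measurable_fun setT absorption_rate.
Proof. by have [a_meas _ _] := a_loc; exact: halfline_measurable. Qed.

(** Since the weight grows at most at the rate omega along the flow, it
    suffices to integrate [g y * expR (- primitive g y)] with
    [g = (l - omega + a) / r]. *)
Lemma resolvent_kernel_column l x : omega <= l -> 0 < x ->
  (\int[leb]_y (weight alpha y * (l - omega + absorption_rate y) * Rk l y x)%:E <=
   (weight alpha x)%:E)%E.
Proof.
move=> ol x0; pose g s := (l - omega) * (r s)^-1 + a s / r s.
have g_int : integrable_on_segments g.
  move=> u v u0; have i1 := rV_int rP v u0; have i2 := absorption_int v u0.
  have i3 : leb.-integrable `[u, v] (fun s => (l - omega)%:E * ((r s)^-1)%:E)%E.
    by apply: integrableZl.
  have i4 : leb.-integrable `[u, v]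
      (fun s => (l - omega)%:E * ((r s)^-1)%:E + (a s / r s)%:E)%E.
    by apply: integrableD.
  exact: i4.
have g_ge0 s : 0 < s -> 0 <= g s.
  move=> s0; rewrite addr_ge0 ?absorption_ge0 // mulr_ge0 ?subr_ge0 //.
  by rewrite invr_ge0 ltW // r_gt0.
have gE y : 0 < y -> primitive g y = potential (l - omega) y.
  by move=> y0; rewrite potential_primitive.
have mG : measurable_fun (`[x, +oo[ : set R) (fun y => g y * expR (- primitive g y)).
  apply: (@measurable_funS _ _ _ _ (halfline : set R)) => //.
    by move=> y /=; rewrite !in_itv /= !andbT; exact: lt_le_trans.
  have [a_meas _ _] := a_loc; have mV := rV_measurable rP.
  apply: measurable_funM.
    by apply: measurable_funD; apply: measurable_funM.
  apply: measurableT_comp => //; apply: measurableT_comp => //.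
  exact: (primitive_measurable g_int g_ge0).
have wx0 : 0 <= weight alpha x * expR (potential (l - omega) x).
  by rewrite mulr_ge0 ?weight_ge0 ?expR_ge0.
apply: (@le_trans _ _ (\int[leb]_(y in `[x, +oo[)
    ((weight alpha x * expR (potential (l - omega) x))%:E *
     (g y * expR (- primitive g y))%:E))%E).
  rewrite [leRHS]integral_mkcond; apply: ge0_le_integral => //.
  - move=> y _; rewrite lee_fin mulr_ge0 ?resolvent_kernel_ge0 // mulr_ge0 ?weight_ge0 //.
    by rewrite addr_ge0 ?absorption_rate_ge0 // subr_ge0.
  - apply/measurable_EFinP; apply: measurable_funM.
      apply: measurable_funM; first exact: measurable_weight.
      by apply: measurable_funD => //; exact: absorption_rate_measurable.
    have mp : measurable_fun (setT : set RT) (fun y : RT => (y, x) : RT * RT).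
      by apply: measurable_fun_pair.
    exact: (measurableT_comp (resolvent_kernel_measurable l) mp).
  - apply/(measurable_restrictT _ _).1 => //.
    apply: emeasurable_funM => //; exact/measurable_EFinP.
  move=> y _; rewrite patchE /Rk; case: ifPn => [xy|]; last first.
    rewrite mulr0 => _; case: ifPn => [|//]; rewrite inE /= in_itv /= andbT => xy.
    have y0 := lt_le_trans x0 xy.
    by rewrite lee_fin mulr_ge0 // mulr_ge0 ?expR_ge0 // g_ge0.
  have y0 := lt_le_trans x0 xy.
  rewrite ifT; last by rewrite inE /= in_itv /= xy.
  rewrite lee_fin (weight_pos _ x0) (weight_pos _ y0) /absorption_rate /decay /gain !halfline_pos //.
  rewrite (slowness_pos _ y0) gE // /g.
  have E : expR (- potential l y) * expR (potential l x) = expR (potential (l - omega) x) *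
      (expR (- potential (l - omega) y) * expR (- (omega * (rho y - rho x)))).
    by rewrite -!expRD /potential; congr expR; ring.
  have -> : y `^ alpha * (l - omega + a y) * ((r y)^-1 * expR (- potential l y) * expR (potential l x)) =
     (y `^ alpha * expR (- (omega * (rho y - rho x)))) * (expR (potential (l - omega) x) *
      (((l - omega) * (r y)^-1 + a y / r y) * expR (- potential (l - omega) y))).
    by rewrite -[(r y)^-1 * _ * _]mulrA E; ring.
  rewrite -[X in _ <= X]mulrA; apply: ler_wpM2r.
    rewrite mulr_ge0 ?expR_ge0 // mulr_ge0 ?expR_ge0 //; exact: g_ge0.
  rewrite -ler_pdivlMr ?expR_gt0 // -expRN opprK; exact: power_growth.
rewrite ge0_integralZl_EFin //.
- have := integral_exp_primitive_tail g_int g_ge0 x0.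
  rewrite gE // => tail; apply: le_trans (lee_wpmul2l _ tail) _ => //.
  by rewrite -EFinM -mulrA expRxMexpNx_1 mulr1.
- move=> y; rewrite /= in_itv /= andbT => xy.
  by rewrite lee_fin mulr_ge0 ?expR_ge0 // g_ge0 // (lt_le_trans x0).
- exact/measurable_EFinP.
Qed.

Definition transport_resolvent l (f : X) : X := kernel_map (Rk l) f.
Local Notation Rs := transport_resolvent.

Let Rk_meas := resolvent_kernel_measurable.
Let Rk_pos := resolvent_kernel_ge0.
Let Rk_0 := resolvent_kernel_neg.

Let damping l y : R := weight alpha y * (l - omega + absorption_rate y).

Let damping_meas l : measurable_fun (setT : set RT) (damping l).
Proof.
apply: measurable_funM; first exact: w_meas.
by apply: measurable_funD => //; exact: absorption_rate_measurable.
Qed.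

Let damping_ge0 l y : omega <= l -> 0 <= damping l y.
Proof.
move=> ol; rewrite mulr_ge0 ?w_ge0 // addr_ge0 ?subr_ge0 //.
exact: absorption_rate_ge0.
Qed.

Let Rk_sec l x : measurable_fun (setT : set RT) (fun y => Rk l y x).
Proof.
have mp : measurable_fun (setT : set RT) (fun y : RT => (y, x) : RT * RT).
  by apply: measurable_fun_pair.
exact: (measurableT_comp (Rk_meas l) mp).
Qed.

Lemma resolvent_damped_mass l f : omega <= l -> (kernel_mass (damping l) (Rk l) (L1_fun f) <= `|f|%:E)%E.
Proof.
move=> ol; rewrite Xspace_normE'; have mf := L1_fun_measurable f.
apply: (kernel_mass_le (damping_meas l) (fun y => damping_ge0 y ol) (Rk_meas l) (Rk_pos l)
  (Rk_0 l) mf w_meas _ w_ge0).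
by move=> y y0; exact: resolvent_kernel_column.
Qed.

Lemma resolvent_mass l f : omega < l ->
  (kernel_mass (weight alpha) (Rk l) (L1_fun f) <= ((l - omega)^-1 * `|f|)%:E)%E.
Proof.
move=> ol; have lo : 0 < l - omega by rewrite subr_gt0.
rewrite EFinM Xspace_normE' -ge0_integralZl_EFin ?invr_ge0 ?(ltW lo) //; last 2 first.
- by move=> x _; rewrite lee_fin mulr_ge0 ?w_ge0.
- apply/measurable_EFinP; apply: measurable_funM => //.
  by apply: measurableT_comp => //; exact: L1_fun_measurable.
under [X in (_ <= X)%E]eq_integral do rewrite -EFinM mulrA.
apply: (kernel_mass_le w_meas w_ge0 (Rk_meas l) (Rk_pos l) (Rk_0 l) (L1_fun_measurable f)).
- by apply: measurable_funM.
- move=> y y0; rewrite EFinM lee_pdivlMl // -ge0_integralZl_EFin ?(ltW lo) //; last 2 first.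
  + by move=> x _; rewrite lee_fin mulr_ge0 ?w_ge0 // Rk_pos.
  + by apply/measurable_EFinP; apply: measurable_funM.
  apply: le_trans (resolvent_kernel_column (ltW ol) y0).
  apply: ge0_le_integral => //.
  + by move=> x _; rewrite mule_ge0 ?lee_fin ?(ltW lo) // mulr_ge0 ?w_ge0 // Rk_pos.
  + by apply: emeasurable_funM => //; apply/measurable_EFinP; apply: measurable_funM.
  + by apply/measurable_EFinP; apply: measurable_funM => //; exact: damping_meas.
  move=> x _; rewrite -EFinM lee_fin mulrA ler_wpM2r ?Rk_pos // mulrC ler_wpM2l ?w_ge0 //.
  by rewrite lerDl absorption_rate_ge0.
- by move=> y; rewrite mulr_ge0 ?invr_ge0 ?w_ge0 // ltW.
Qed.

Lemma resolvent_finite l f : omega < l -> kernel_finite (Rk l) f.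
Proof. by move=> ol; apply: le_lt_trans (resolvent_mass f ol) _; exact: ltry. Qed.

Lemma resolvent_lin l : omega < l -> linear (Rs l).
Proof.
by move=> ol c f g; apply: (kernel_map_lin (Rk_meas l) (Rk_pos l) (Rk_0 l)); exact: resolvent_finite.
Qed.

Lemma resolvent_bnd l f : omega < l -> `|Rs l f| <= (l - omega)^-1 * `|f|.
Proof.
move=> ol; rewrite -lee_fin; apply: le_trans (resolvent_mass f ol).
exact: (kernel_map_norm (Rk_meas l) (Rk_pos l) (resolvent_finite f ol)).
Qed.

Lemma resolvent_nneg l f : omega < l -> L1_nneg f -> L1_nneg (Rs l f).
Proof.
by move=> ol; exact: (kernel_map_pos (Rk_meas l) (Rk_pos l) (Rk_0 l) (resolvent_finite f ol)).
Qed.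

Lemma resolvent_ae l f : omega < l ->
  {ae weighted alpha, forall x, L1_fun (Rs l f) x = kernel_op (Rk l) (L1_fun f) x}.
Proof.
move=> ol; apply: toL1_ae.
exact: (kernel_map_integrable (Rk_meas l) (Rk_pos l) (resolvent_finite f ol)).
Qed.

(** Absorption consumes at most the mass of [f]. The unbounded rate [a] is
    under control thanks to this term. *)
Lemma resolvent_energy l f : omega < l ->
  (\int[leb]_y (weight alpha y * (l - omega + absorption_rate y) * `|L1_fun (Rs l f) y|)%:E <=
   `|f|%:E)%E.
Proof.
move=> ol; have mf := L1_fun_measurable f.
apply: le_trans (resolvent_damped_mass f (ltW ol)).
apply: le_trans (kernel_op_le (damping_meas l) (fun y => damping_ge0 y (ltW ol)) (Rk_meas l) (Rk_pos l) mf).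
rewrite le_eqVlt; apply/orP; left; apply/eqP.
apply: ae_eq_integral => //.
- apply/measurable_EFinP; apply: measurable_funM; first exact: damping_meas.
  by apply: measurableT_comp => //; exact: L1_fun_measurable.
- apply: emeasurable_funM; apply/measurable_EFinP; last exact: damping_meas.
  apply: measurableT_comp => //; exact: (kernel_op_measurable (Rk_meas l)).
have /ae_weighted E := resolvent_ae f ol; apply: (ae_imply E) => y Ey _.
have [y0|y0] := leP y 0; first by rewrite /damping weight_neg // !mul0r mule0.
by rewrite Ey // -EFinM mulrC.
Qed.

(** * The transport semigroup and its averages *)

Section averages.
Implicit Types (u v : R -> R).

Let r0 := r \_ halfline.

Let r0_meas : measurable_fun (setT : set R) r0.
Proof.
apply: halfline_measurable; apply: subspace_continuous_measurable_fun => //.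
exact: growth_cont rP.
Qed.

Let r0_ge0 y : 0 <= r0 y.
Proof.
have [y0|y0] := leP y 0; first by rewrite /r0 halfline_neg.
by rewrite /r0 halfline_pos // ltW // r_gt0.
Qed.

Lemma transport_fun_pos h u y : 0 <= h -> 0 < y ->
  tf h u y = expR (absorbed (flow r y h) - absorbed y) *
             (r (flow r y h) * u (flow r y h) * slowness y).
Proof.
move=> h0 y0; rewrite /transport_fun halfline_pos // slowness_pos //; congr (expR _ * _).
rewrite -(primitiveB (absorption_int) (flow_gt0 rP y0 h0) (flow_le rP y0 h0)).
by rewrite opprB.
Qed.

Lemma transport_fun_neg h u y : y <= 0 -> tf h u y = 0.
Proof. by move=> y0; rewrite /transport_fun halfline_neg. Qed.

Lemma transport_fun_measurable h u : 0 <= h -> measurable_fun (setT : set R) u ->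
  measurable_fun (setT : set R) (tf h u).
Proof.
move=> h0 mu; pose A0 := absorbed \_ halfline.
have mA : measurable_fun (setT : set R) A0.
  apply: halfline_measurable.
  exact: (primitive_measurable (absorption_int) (absorption_ge0)).
have mf := flow_measurable rP h0.
have -> : tf h u = (fun y => expR (A0 (flow r y h) - A0 y) *
    (r0 (flow r y h) * u (flow r y h) * slowness y)).
  apply/funext => y; have [y0|y0] := leP y 0.
    by rewrite transport_fun_neg // (slowness_neg _ y0) !mulr0.
  rewrite transport_fun_pos // /A0 /r0 !halfline_pos //; exact: (flow_gt0 rP).
apply: measurable_funM.
  apply: measurableT_comp => //; apply: measurable_funB => //.
  exact: measurableT_comp.
apply: measurable_funM; last exact: (slowness_measurable rP).
by apply: measurable_funM; exact: measurableT_comp.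
Qed.

(** A change of variables along the flow: the weight gains at most the
    factor [expR (omega * h)], and absorption only helps. *)
Lemma transport_fun_norm h u : 0 <= h -> measurable_fun (setT : set R) u ->
  (\int[leb]_y (`|tf h u y|%:E * (weight alpha y)%:E) <=
   (expR (omega * h))%:E * \int[leb]_y (`|u y|%:E * (weight alpha y)%:E))%E.
Proof.
move=> h0 mu; have o0 := growth_bound_ge0.
pose H z := (expR (omega * h) * (r0 z * `|u z| * weight alpha z))%:E.
have mH : measurable_fun (setT : set R) H.
  apply/measurable_EFinP; apply: measurable_funM => //; apply: measurable_funM => //.
  by apply: measurable_funM => //; exact: measurableT_comp.
have H0 z : (0 <= H z)%E.
  by rewrite lee_fin mulr_ge0 ?expR_ge0 // mulr_ge0 ?w_ge0 // mulr_ge0.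
have mt := transport_fun_measurable h0 mu.
apply: (@le_trans _ _ (\int[leb]_y (H (flow r y h) * (slowness y)%:E))%E).
  apply: ge0_le_integral => //.
  - by move=> y _; rewrite mule_ge0 ?lee_fin ?w_ge0.
  - apply: emeasurable_funM; apply/measurable_EFinP => //.
    exact: measurableT_comp.
  - apply: emeasurable_funM; last by apply/measurable_EFinP; exact: (slowness_measurable rP).
    exact: (measurableT_comp mH (flow_measurable rP h0)).
  move=> y _; have [y0|y0] := leP y 0.
    by rewrite weight_neg // mule0 mule_ge0 // lee_fin (slowness_ge0 rP).
  have f0 := flow_gt0 rP y0 h0; have fy := flow_le rP y0 h0.
  rewrite transport_fun_pos // /H /r0 halfline_pos // !weight_pos // -!EFinM lee_fin.
  rewrite !normrM (ger0_norm (expR_ge0 _)) (ger0_norm (slowness_ge0 rP y)) (gtr0_norm (r_gt0 f0)).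
  have pg := power_growth f0 fy.
  rewrite (travel_time_flow rP y0 h0) opprB addrCA subrr addr0 in pg.
  have e1 : expR (absorbed (flow r y h) - absorbed y) <= 1.
    rewrite -expR0 ler_expR subr_le0; exact: (absorbed_le).
  have q0 : 0 <= r (flow r y h) * `|u (flow r y h)| * slowness y.
    by rewrite mulr_ge0 ?(slowness_ge0 rP) // mulr_ge0 // ltW // r_gt0.
  apply: (@le_trans _ _ (r (flow r y h) * `|u (flow r y h)| * slowness y * y `^ alpha)).
    by rewrite ler_wpM2r ?powR_ge0 // ler_piMl.
  apply: le_trans (ler_wpM2l q0 pg) _.
  rewrite le_eqVlt; apply/orP; left; apply/eqP.
  by move: (flow r y h `^ alpha) (expR _) (r _) `|_| (slowness y) => a1 a2 a3 a4 a5; ring.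
rewrite (flow_invariance rP h0 mH H0).
rewrite -ge0_integralZl_EFin ?expR_ge0 //; last 2 first.
- by move=> y _; rewrite mule_ge0 ?lee_fin ?w_ge0.
- by apply: emeasurable_funM; apply/measurable_EFinP => //; exact: measurableT_comp.
rewrite le_eqVlt; apply/orP; left; apply/eqP; apply: eq_integral => y _.
have [y0|y0] := leP y 0; first by rewrite weight_neg // (slowness_neg _ y0) !mule0.
rewrite /H /r0 halfline_pos // (slowness_pos _ y0) -!EFinM; congr EFin.
by have := r_gt0 y0; move: (expR _) => e ry0; field; rewrite gt_eqF.
Qed.

Let fin_norm f : (\int[leb]_y (`|L1_fun f y|%:E * (weight alpha y)%:E) < +oo)%E.
Proof. by rewrite -Xspace_normE ltry. Qed.

Lemma transport_integrable h u : 0 <= h -> measurable_fun (setT : set R) u ->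
  (\int[leb]_y (`|u y|%:E * (weight alpha y)%:E) < +oo)%E ->
  (weighted alpha).-integrable setT (EFin \o tf h u).
Proof.
move=> h0 mu fin; apply: weighted_integrable; first exact: transport_fun_measurable.
apply: le_lt_trans (transport_fun_norm h0 mu) _.
by rewrite lte_mul_pinfty // ?lee_fin ?expR_ge0.
Qed.

(** Transport is well defined on classes: by [transport_fun_norm] it maps
    null functions to null functions. *)
Lemma transport_fun_congr h u v : 0 <= h ->
  measurable_fun (setT : set R) u -> measurable_fun (setT : set R) v ->
  {ae weighted alpha, forall x, u x = v x} ->
  {ae weighted alpha, forall x, tf h u x = tf h v x}.
Proof.
move=> h0 mu mv /ae_weighted uv; apply/ae_weighted.
have md : measurable_fun (setT : set R) (fun x => u x - v x) by exact: measurable_funB.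
have z : (\int[leb]_y (`|(u y - v y)%R|%:E * (weight alpha y)%:E) = 0)%E.
  rewrite -[RHS](integral0 leb setT); apply: ae_eq_integral => //.
    apply: emeasurable_funM; apply/measurable_EFinP => //; exact: measurableT_comp.
  apply: (ae_imply uv) => y uvy _; have [y0|y0] := leP y 0.
    by rewrite weight_neg // mule0.
  by rewrite uvy // subrr normr0 mul0e.
have := transport_fun_norm h0 md; rewrite z mule0 => le0.
have mt := transport_fun_measurable h0 md.
have mF : measurable_fun (setT : set RT)
    (fun y => `|tf h (fun x => u x - v x)%R y|%:E * (weight alpha y)%:E)%E.
  by apply: emeasurable_funM; apply/measurable_EFinP => //; exact: measurableT_comp.
have : (\int[leb]_y `|(`|tf h (fun x => u x - v x)%R y|%:E * (weight alpha y)%:E)| = 0)%E.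
  under eq_integral do rewrite gee0_abs ?mule_ge0 ?lee_fin ?w_ge0 //.
  by apply/eqP; rewrite eq_le le0 integral_ge0 // => y _; rewrite mule_ge0 ?lee_fin ?w_ge0.
move/(@ae_eq_integral_abs _ RT R leb _ measurableT _ mF).
move=> H; apply: (ae_imply H) => y /(_ I) /eqP + y0.
rewrite mule_eq0 !eqe (gt_eqF (weight_gt0 alpha y0)) orbF normr_eq0 => /eqP.
rewrite !transport_fun_pos // => E.
apply/eqP; rewrite -subr_eq0 -[X in _ == X]E; apply/eqP.
by move: (expR _) (r _) (u _) (v _) (slowness y) => a1 a2 a3 a4 a5; ring.
Qed.

Lemma transport_ae h f : 0 <= h ->
  {ae weighted alpha, forall x, L1_fun (U h f) x = tf h (L1_fun f) x}.
Proof.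
move=> h0; apply: toL1_ae.
exact: (transport_integrable h0 (L1_fun_measurable f) (fin_norm f)).
Qed.

Lemma transport_bnd h f : 0 <= h -> `|U h f| <= expR (omega * h) * `|f|.
Proof.
move=> h0; have mf := L1_fun_measurable f.
rewrite -lee_fin EFinM (Xspace_normE f).
apply: le_trans (transport_fun_norm h0 mf).
have it := transport_integrable h0 mf (fin_norm f).
rewrite /transport toL1_normE // ge0_integral_weighted //.
by apply: measurableT_comp => //; apply/measurable_EFinP; exact: transport_fun_measurable.
Qed.

Definition weighted_finite u : Prop :=
  (\int[leb]_y (`|u y|%:E * (weight alpha y)%:E) < +oo)%E.

(** The integral in the formula of the resolvent: [gain] vanishes below 0. *)
Definition cumulated l u y : R := \int[leb]_(x in `]-oo, y]) (gain l x * u x).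

Lemma gain_le_weight l x y : omega <= l -> x <= y -> 0 < y ->
  y `^ alpha * decay l y * gain l x <= weight alpha x.
Proof.
move=> ol xy y0; have [x0|x0] := leP x 0.
  by rewrite [gain l x]halfline_neg // mulr0 w_ge0.
rewrite weight_pos // /gain /decay !halfline_pos // -mulrA -expRD addrC.
exact: (potential_growth).
Qed.

Lemma cumulated_integrable l u y : omega <= l -> 0 < y ->
  measurable_fun (setT : set R) u -> weighted_finite u ->
  leb.-integrable `]-oo, y] (fun x => (gain l x * u x)%:E).
Proof.
move=> ol y0 mu fin.
have iw : leb.-integrable (setT : set RT) (fun x => `|u x|%:E * (weight alpha x)%:E)%E.
  apply/integrableP; split.
    by apply: emeasurable_funM; apply/measurable_EFinP => //; exact: measurableT_comp.
  by under eq_integral do rewrite gee0_abs ?mule_ge0 ?lee_fin ?w_ge0 //.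
pose c := (y `^ alpha * decay l y)^-1.
have d0 : 0 < y `^ alpha * decay l y.
  by rewrite mulr_gt0 ?powR_gt0 // /decay halfline_pos ?expR_gt0.
have ic : leb.-integrable (`]-oo, y] : set RT)
    (fun x => c%:E * (`|u x|%:E * (weight alpha x)%:E))%E.
  by apply: integrableZl => //; exact: integrableS iw.
apply: le_integrable ic => //.
  apply/measurable_EFinP; apply: measurable_funTS.
  by apply: measurable_funM => //; exact: gain_measurable.
move=> x /=; rewrite in_itv /= => xy; rewrite lee_fin normrM.
have c0 : 0 <= c * (`|u x| * weight alpha x).
  by rewrite mulr_ge0 ?invr_ge0 ?(ltW d0) // mulr_ge0 ?w_ge0.
rewrite (ger0_norm (gain_ge0 l x)) (ger0_norm c0).
rewrite mulrCA mulrC ler_wpM2l // /c mulrC ler_pdivlMr // mulrC.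
exact: gain_le_weight.
Qed.

Lemma kernel_op_resolvent l u y : omega <= l -> 0 < y ->
  measurable_fun (setT : set R) u -> weighted_finite u ->
  kernel_op (Rk l) u y = slowness y * decay l y * cumulated l u y.
Proof.
move=> ol y0 mu fin; rewrite /cumulated -RintegralZl //; last exact: cumulated_integrable.
rewrite [RHS]Rintegral_mkcond /kernel_op; congr fine; apply: eq_integral => x _.
rewrite patchE /Rk; case: ifPn => xy.
  by rewrite ifT ?mulrA // inE /= in_itv.
by rewrite mul0r ifF //; apply: memNset; rewrite /= in_itv /=; exact/negP.
Qed.

Lemma transport_fun_resolvent l h u y : omega <= l -> 0 <= h -> 0 < y ->
  measurable_fun (setT : set R) u -> weighted_finite u ->
  tf h (kernel_op (Rk l) u) y =
  expR (l * h) * (slowness y * decay l y * cumulated l u (flow r y h)).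
Proof.
move=> ol h0 y0 mu fin; have f0 := flow_gt0 rP y0 h0.
rewrite (transport_fun_pos) // kernel_op_resolvent // (slowness_pos _ f0) /decay !halfline_pos //.
rewrite /potential (travel_time_flow rP y0 h0).
have rf := r_gt0 f0; set rX := r _ in rf *.
have -> : expR (- (l * rho y + absorbed y)) = expR (- (l * h)) *
    (expR (absorbed (flow r y h) - absorbed y) *
     expR (- (l * (rho y - h) + absorbed (flow r y h)))).
  by rewrite -!expRD; congr expR; ring.
have : expR (l * h) * expR (- (l * h)) = 1 by rewrite expRxMexpNx_1.
move: (expR (l * h)) (expR (- (l * h))) (expR (- (l * _ + _))) (expR _) => e1 e2 e3 e4 e12.
move: (cumulated _ _ _) (slowness y) => p q.
have -> : rX * (rX^-1 * e3 * p) * q = e3 * p * q by field; rewrite gt_eqF.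
rewrite -[LHS]mul1r -e12; ring.
Qed.

Lemma Rintegral_flow h (G : R -> R) : 0 <= h -> measurable_fun (setT : set R) G ->
  \int[leb]_y (G (flow r y h) * slowness y) = \int[leb]_y (G y * slowness y).
Proof.
move=> h0 mG; rewrite /Rintegral; congr fine.
rewrite [LHS]integralE [RHS]integralE.
have pos (f : R -> R) y : ((fun y => (f y * slowness y)%:E)^\+ y = (Num.max (f y) 0)%:E * (slowness y)%:E)%E.
  by rewrite funeposE -EFin_max -EFinM; congr EFin; rewrite maxr_pMl ?mul0r // (slowness_ge0 rP).
have neg (f : R -> R) y : ((fun y => (f y * slowness y)%:E)^\- y = (Num.max (- f y) 0)%:E * (slowness y)%:E)%E.
  by rewrite funenegE -EFinN -mulNr -EFin_max -EFinM; congr EFin; rewrite maxr_pMl ?mul0r // (slowness_ge0 rP).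
have mp : measurable_fun (setT : set R) (fun z => (Num.max (G z) 0)%:E).
  by apply/measurable_EFinP; apply: measurable_maxr.
have mn : measurable_fun (setT : set R) (fun z => (Num.max (- G z) 0)%:E).
  by apply/measurable_EFinP; apply: measurable_maxr => //; exact: measurableT_comp.
have Ep (f : R -> R) : (\int[leb]_y (fun y => (f y * slowness y)%:E)^\+ y =
    \int[leb]_y ((Num.max (f y) 0)%:E * (slowness y)%:E))%E.
  by apply: eq_integral => y _; exact: pos.
have En (f : R -> R) : (\int[leb]_y (fun y => (f y * slowness y)%:E)^\- y =
    \int[leb]_y ((Num.max (- f y) 0)%:E * (slowness y)%:E))%E.
  by apply: eq_integral => y _; exact: neg.
congr (_ - _)%E.
  apply: etrans (Ep (fun y => G (flow r y h))) (etrans _ (esym (Ep G))).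
  by apply: (flow_invariance rP h0 mp) => z; rewrite lee_fin le_max lexx orbT.
apply: etrans (En (fun y => G (flow r y h))) (etrans _ (esym (En G))).
by apply: (flow_invariance rP h0 mn) => z; rewrite lee_fin le_max lexx orbT.
Qed.

(** Transport shifts [cumulated] along the flow; with
    [transport_fun_resolvent] it follows that the resolvent commutes with
    the semigroup. *)
Lemma cumulated_transport l h u y : omega <= l -> 0 <= h -> 0 < y ->
  measurable_fun (setT : set R) u -> weighted_finite u ->
  cumulated l (tf h u) y = expR (l * h) * cumulated l u (flow r y h).
Proof.
move=> ol h0 y0 mu fin; have f0 := flow_gt0 rP y0 h0.
pose G z := if z <= flow r y h then expR (l * h) * gain l z * ((r \_ halfline) z * u z) else 0.
have mr : measurable_fun (setT : set R) (r \_ halfline).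
  apply: halfline_measurable; apply: subspace_continuous_measurable_fun => //.
  exact: growth_cont rP.
have mG : measurable_fun (setT : set R) G.
  apply: measurable_fun_ifT; first by apply: measurable_fun_ler.
    apply: measurable_funM; last exact: measurable_funM.
    by apply: measurable_funM => //; exact: gain_measurable.
  exact: measurable_cst.
transitivity (\int[leb]_x (G (flow r x h) * slowness x)).
  rewrite /cumulated Rintegral_mkcond; congr fine; apply: eq_integral => x _.
  congr EFin; rewrite patchE; have [x0|x0] := leP x 0.
    by rewrite (slowness_neg _ x0) mulr0 [gain l x]halfline_neg // mul0r if_same.
  have fx0 := flow_gt0 rP x0 h0.
  have E : (flow r x h <= flow r y h) = (x <= y).
    by rewrite -(travel_time_le_mono rP fx0 f0) !(travel_time_flow rP) // lerD2r (travel_time_le_mono rP).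
  rewrite /G E (_ : (x \in _) = (x <= y)); last first.
    by apply/idP/idP; rewrite inE /= in_itv.
  case: ifP => xy; last by rewrite mul0r.
  rewrite (transport_fun_pos) // /gain !halfline_pos // /potential (travel_time_flow rP) //.
  have -> : l * rho x + absorbed x = l * h + (l * (rho x - h) + absorbed x) by ring.
  move: (absorbed x) (absorbed (flow r x h)) => Ax AX; rewrite !expRD expRN.
  have := expR_gt0 Ax; move: (expR Ax) => e e0.
  by field; rewrite gt_eqF.
rewrite (Rintegral_flow h0 mG) /cumulated -RintegralZl //; last exact: cumulated_integrable.
rewrite [RHS]Rintegral_mkcond; congr fine; apply: eq_integral => z _.
congr EFin; rewrite patchE /G (_ : (z \in _) = (z <= flow r y h)); last first.
  by apply/idP/idP; rewrite inE /= in_itv.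
case: ifP => _; last by rewrite mul0r.
have [z0|z0] := leP z 0.
  by rewrite (slowness_neg _ z0) mulr0 [gain l z]halfline_neg // mul0r mulr0.
rewrite halfline_pos // (slowness_pos _ z0); have rz := r_gt0 z0.
by move: (gain l z) (expR _) => p q; field; rewrite gt_eqF.
Qed.

Lemma Xspace_finite f : weighted_finite (L1_fun f).
Proof. by rewrite /weighted_finite -Xspace_normE ltry. Qed.

Let finite_transport h u : 0 <= h -> measurable_fun (setT : set R) u ->
  weighted_finite u -> weighted_finite (tf h u).
Proof.
move=> h0 mu fin.
apply: le_lt_trans (transport_fun_norm h0 mu) _.
by rewrite lte_mul_pinfty // ?lee_fin ?expR_ge0.
Qed.

Lemma transport_resolvent_ae l h f : omega < l -> 0 <= h ->
  {ae weighted alpha, forall y, 0 < y -> L1_fun (U h (Rs l f)) y =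
     expR (l * h) * (slowness y * decay l y * cumulated l (L1_fun f) (flow r y h))}.
Proof.
move=> ol h0; have mf := L1_fun_measurable f.
have mk : measurable_fun (setT : set R) (kernel_op (Rk l) (L1_fun f)).
  by apply: kernel_op_measurable => //; exact: (resolvent_kernel_measurable l).
have E1 := transport_ae (Rs l f) h0.
have E2 := transport_fun_congr h0 (L1_fun_measurable (Rs l f)) mk
  (resolvent_ae f ol).
apply: (ae_imply2 E1 E2) => y -> -> y0.
by apply: transport_fun_resolvent => //; [exact: ltW|exact: Xspace_finite].
Qed.

Lemma resolvent_transport l h f : omega < l -> 0 <= h -> Rs l (U h f) = U h (Rs l f).
Proof.
move=> ol h0; have mf := L1_fun_measurable f; have ol' := ltW ol.
have mt := transport_fun_measurable h0 mf.
apply: L1_ext.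
have E1 := resolvent_ae (U h f) ol.
have kE : kernel_op (Rk l) (L1_fun (U h f)) = kernel_op (Rk l) (tf h (L1_fun f)).
  exact: (kernel_op_congr (alpha := alpha) (resolvent_kernel_measurable l) (resolvent_kernel_neg l)
    (L1_fun_measurable (U h f)) mt (transport_ae f h0)).
have p0 : {ae weighted alpha, forall y, 0 < y}.
  by apply/ae_weighted; exact: nearW.
have fin := Xspace_finite f; have fint := finite_transport h0 mf fin.
apply: (ae_imply3 E1 (transport_resolvent_ae f ol h0) p0) => y -> E3 y0.
by rewrite (E3 y0) kE (kernel_op_resolvent ol' y0 mt fint) (cumulated_transport ol' h0 y0 mf fin) mulrCA.
Qed.

(** The kernel of the average of e^{-l s} U(s) over 0 <= s <= h: the part of
    the resolvent kernel that comes from the points [x] passed within the last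
    [h] units of time before reaching [y]. *)
Definition average_kernel l h y x : R :=
  if (flow r y h < x) && (x <= y) then h^-1 * (slowness y * decay l y * gain l x) else 0.
Local Notation Kk := average_kernel.

Lemma average_kernel_ge0 l h y x : 0 <= h -> 0 <= Kk l h y x.
Proof.
move=> h0; rewrite /Kk; case: ifP => // _; rewrite mulr_ge0 ?invr_ge0 //.
by rewrite mulr_ge0 ?gain_ge0 // mulr_ge0 ?decay_ge0 // (slowness_ge0 rP).
Qed.

Lemma average_kernel_neg l h y x : x <= 0 -> Kk l h y x = 0.
Proof. by move=> x0; rewrite /Kk [gain l x]halfline_neg // !mulr0 if_same. Qed.

Lemma average_kernel_measurable l h : 0 <= h ->
  measurable_fun (setT : set (RT * RT)) (fun z : RT * RT => Kk l h z.1 z.2).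
Proof.
move=> h0; apply: measurable_fun_ifT.
- apply: measurable_and; last by apply: measurable_fun_ler.
  apply: measurable_fun_ltr => //.
  apply: (measurableT_comp (flow_measurable rP h0)); exact: measurable_fst.
- apply: measurable_funM => //; apply: measurable_funM.
    apply: measurable_funM; apply: measurableT_comp => //.
      exact: (slowness_measurable rP).
    exact: (decay_measurable).
  by apply: measurableT_comp => //; exact: gain_measurable.
- exact: measurable_cst.
Qed.

(** A point [x] is carried to positions whose travel times fill an interval
    of length [h], which cancels the factor [h^-1]. *)
Lemma average_kernel_column l h x : omega <= l -> 0 < h -> 0 < x ->
  (\int[leb]_y (weight alpha y * Kk l h y x)%:E <= (weight alpha x)%:E)%E.
Proof.
move=> ol h0 x0; have h0' := ltW h0.
pose G s : \bar R := (\1_(`[rho x, rho x + h[%classic : set R) s)%:E.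
have mG : measurable_fun (setT : set R) G by apply/measurable_EFinP; exact: measurable_indic.
have G0 s : (0 <= G s)%E by rewrite lee_fin.
have mp : measurable_fun (setT : set RT) (fun y : RT => (y, x) : RT * RT).
  by apply: measurable_fun_pair.
have mK : measurable_fun (setT : set RT) (fun y => Kk l h y x).
  exact: (measurableT_comp (average_kernel_measurable l h0') mp).
have mR : measurable_fun (setT : set RT) (fun y => G (rho y - 0)%R * (slowness y)%:E)%E.
  have -> : (fun y => G (rho y - 0)%R * (slowness y)%:E)%E =
     (fun y => G ((rho \_ halfline) y) * (slowness y)%:E)%E.
    apply/funext => y; have [y0|y0] := leP y 0; first by rewrite (slowness_neg _ y0) !mule0.
    by rewrite halfline_pos // subr0.
  apply: emeasurable_funM; last by apply/measurable_EFinP; exact: (slowness_measurable rP).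
  apply: (measurableT_comp mG); apply: halfline_measurable.
  exact: (travel_time_measurable rP).
have c0 : 0 <= h^-1 * weight alpha x by rewrite mulr_ge0 ?invr_ge0 ?w_ge0.
apply: (@le_trans _ _ (\int[leb]_y ((h^-1 * weight alpha x)%:E * (G (rho y - 0)%R * (slowness y)%:E)))%E).
  apply: ge0_le_integral => //.
  - by move=> y _; rewrite lee_fin mulr_ge0 ?w_ge0 // average_kernel_ge0.
  - by apply/measurable_EFinP; apply: measurable_funM.
  - by apply: emeasurable_funM.
  move=> y _; have [y0|y0] := leP y 0.
    by rewrite weight_neg // mul0r (slowness_neg _ y0) !mule0.
  rewrite /Kk; case: ifPn => [/andP[fx xy]|_]; last first.
    rewrite mulr0; apply: mule_ge0; first by rewrite lee_fin.
    by apply: mule_ge0 => //; rewrite lee_fin (slowness_ge0 rP).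
  rewrite subr0 /G indicE mem_set; last first.
    rewrite /= in_itv /= (travel_time_le rP x0 xy) /=.
    rewrite -ltrBlDr -(travel_time_flow rP y0 h0').
    exact: (travel_time_lt rP (flow_gt0 rP y0 h0')).
  rewrite mul1e -EFinM lee_fin (weight_pos _ y0).
  have := gain_le_weight ol xy y0.
  have : 0 <= h^-1 * slowness y by rewrite mulr_ge0 ?invr_ge0 // (slowness_ge0 rP).
  move: (gain l x) (decay l y) (weight alpha x) (y `^ alpha) (slowness y) h^-1 => g d wx p q k kq le.
  have -> : p * (k * (q * d * g)) = (k * q) * (p * d * g) by ring.
  have -> : k * wx * q = (k * q) * wx by ring.
  exact: ler_wpM2l.
rewrite ge0_integralZl_EFin //; last by move=> y _; rewrite mule_ge0 // lee_fin (slowness_ge0 rP).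
rewrite (integral_travel_time rP 0 mG G0) /G integral_indic //= setIT lebesgue_measure_itv /=.
rewrite lte_fin ltrDl h0 -EFinD -EFinM lee_fin addrAC subrr add0r.
by rewrite mulrC mulrA mulfV ?mul1r // gt_eqF.
Qed.

Definition flow_average l h (f : X) : X := kernel_map (Kk l h) f.
Local Notation Ks := flow_average.

Lemma average_mass l h f : omega <= l -> 0 < h ->
  (kernel_mass (weight alpha) (Kk l h) (L1_fun f) <= `|f|%:E)%E.
Proof.
move=> ol h0; rewrite Xspace_normE'.
apply: (kernel_mass_le w_meas w_ge0 (average_kernel_measurable l (ltW h0)) (fun y x => average_kernel_ge0 l y x (ltW h0))
  (average_kernel_neg l h) (L1_fun_measurable f) w_meas _ w_ge0).
by move=> y y0; exact: average_kernel_column.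
Qed.

Lemma average_finite l h f : omega <= l -> 0 < h -> kernel_finite (Kk l h) f.
Proof. by move=> ol h0; apply: le_lt_trans (average_mass f ol h0) _; exact: ltry. Qed.

Lemma average_lin l h : omega <= l -> 0 < h -> linear (Ks l h).
Proof.
move=> ol h0 c f g; exact: (kernel_map_lin (average_kernel_measurable l (ltW h0))
  (fun y x => average_kernel_ge0 l y x (ltW h0)) (average_kernel_neg l h) c (average_finite f ol h0) (average_finite g ol h0)).
Qed.

Lemma average_bnd l h f : omega <= l -> 0 < h -> `|Ks l h f| <= `|f|.
Proof.
move=> ol h0; rewrite -lee_fin; apply: le_trans (average_mass f ol h0).
exact: (kernel_map_norm (average_kernel_measurable l (ltW h0)) (fun y x => average_kernel_ge0 l y x (ltW h0))
  (average_finite f ol h0)).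
Qed.

Lemma average_ae l h f : omega <= l -> 0 < h ->
  {ae weighted alpha, forall x, L1_fun (Ks l h f) x = kernel_op (Kk l h) (L1_fun f) x}.
Proof.
move=> ol h0; apply: toL1_ae.
exact: (kernel_map_integrable (average_kernel_measurable l (ltW h0)) (fun y x => average_kernel_ge0 l y x (ltW h0))
  (average_finite f ol h0)).
Qed.

Lemma kernel_op_average l h u y : omega <= l -> 0 <= h -> 0 < y ->
  measurable_fun (setT : set R) u -> weighted_finite u ->
  kernel_op (Kk l h) u y =
  h^-1 * (slowness y * decay l y * (cumulated l u y - cumulated l u (flow r y h))).
Proof.
move=> ol h0 y0 mu fin; have f0 := flow_gt0 rP y0 h0; have fy := flow_le rP y0 h0.
have iy := cumulated_integrable ol y0 mu fin.
rewrite /cumulated (Rintegral_itvB iy) ?bnd_simp // mulrA -RintegralZl //; last first.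
  by apply: integrableS iy => // x; rewrite /= !in_itv /= => /andP[].
rewrite [RHS]Rintegral_mkcond /kernel_op; congr fine; apply: eq_integral => x _.
congr EFin; rewrite patchE /Kk (_ : (x \in _) = (flow r y h < x) && (x <= y)); last first.
  by apply/idP/idP; rewrite inE /= in_itv.
by case: ifP => _; rewrite ?mul0r // !mulrA.
Qed.

(** Going back along the flow for a time [h] removes from [cumulated]
    precisely the part that enters the average. *)
Lemma transport_resolvent_average l h f : omega < l -> 0 < h ->
  U h (Rs l f) = expR (l * h) *: (Rs l f - h *: Ks l h f).
Proof.
move=> ol h0; have ol' := ltW ol; have h0' := ltW h0; apply: L1_ext.
have mf := L1_fun_measurable f; have fin := Xspace_finite f.
have p0 : {ae weighted alpha, forall y, 0 < y} by apply/ae_weighted; exact: nearW.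
have E1 := transport_resolvent_ae f ol h0'.
have E2 := resolvent_ae f ol.
have E3 := average_ae f ol' h0.
have E4 := ae_imply3 (L1_funZ (expR (l * h)) (Rs l f - h *: Ks l h f))
  (L1_funB (Rs l f) (h *: Ks l h f)) (L1_funZ h (Ks l h f))
  (fun x a b c => conj a (conj b c)).
have E5 := ae_imply3 E1 E2 E3 (fun x a b c => conj a (conj b c)).
apply: (ae_imply3 E4 E5 p0) => y [-> [-> ->]] [E [-> ->]] y0; rewrite (E y0).
rewrite kernel_op_average // (kernel_op_resolvent ol' y0 mf fin).
by move: (cumulated _ _ y) (cumulated _ _ _) => p q; field; rewrite gt_eqF.
Qed.

Lemma flow_near y h : 0 < y -> 0 <= h -> y - flow r y h <= C * y * h.
Proof.
move=> y0 h0; have f0 := flow_gt0 rP y0 h0; have fy := flow_le rP y0 h0.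
have := travel_time_ln rP f0 fy; rewrite (travel_time_flow rP y0 h0) opprB addrCA subrr addr0.
move=> ln_le.
have e1 := expR_ge1Dx (ln (flow r y h) - ln y).
rewrite expRB !lnK // in e1.
have e2 : 1 - C * h <= flow r y h / y by apply: le_trans e1; lra.
have := ler_wpM2r (ltW y0) e2; rewrite divfK ?gt_eqF //; lra.
Qed.

Lemma flow_lt y h : 0 < y -> 0 < h -> flow r y h < y.
Proof.
move=> y0 h0; rewrite (flowE rP) ?(ltW h0) // -[X in _ < X](travel_timeK rP y0) (place_lt rP).
by rewrite gtrBl.
Qed.

Lemma flow_cvg y (h : nat -> R) : 0 < y -> h @ \oo --> 0 -> (forall n, 0 < h n) ->
  flow r y (h n) - y @[n --> \oo] --> 0.
Proof.
move=> y0 h0 hn0; apply: (@cvg_dist_squeeze _ _ _ _ _ _ _ (fun n => C * y * h n)).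
  by rewrite -(mulr0 (C * y)); apply: cvgM => //; exact: cvg_cst.
apply: nearW => n; rewrite sub0r normrN distrC ger0_norm; last first.
  by rewrite subr_ge0 ltW // flow_lt.
by apply: flow_near => //; exact: ltW.
Qed.

Lemma flow_speed y (h : nat -> R) : 0 < y -> h @ \oo --> 0 -> (forall n, 0 < h n) ->
  (flow r y (h n) - y)^-1 * - h n @[n --> \oo] --> (r y)^-1.
Proof.
move=> y0 h0 hn0; pose p := y / 2; have p0 : 0 < p by rewrite divr_gt0.
have py : p < y by rewrite /p; lra.
pose G z := \int[leb]_(t in `[p, z]) (r t)^-1.
have cr : {for y, continuous (fun s => (r s)^-1)}.
  have := rV_within rP; rewrite continuous_open_subspace; last exact: interval_open.
  by apply; rewrite inE /= in_itv /= y0.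
have yy1 : y < y + 1 by rewrite ltrDl.
have [dG GE] := continuous_FTC1_closed yy1 (rV_int rP (y + 1) p0) py cr.
have kn0 n : flow r y (h n) - y != 0 by rewrite subr_eq0 lt_eqF // flow_lt.
have := derivable_seq dG GE (flow_cvg y0 h0 hn0) kn0.
apply: cvg_near_eq.
have /cvgrPdist_lt/(_ p p0) fc := flow_cvg y0 h0 hn0.
apply: filterS fc => n; rewrite sub0r normrN => near_n; congr (_ * _).
have f0 := flow_gt0 rP y0 (ltW (hn0 n)).
have pf : p <= flow r y (h n).
  by move: near_n; rewrite ltr_norml /p => /andP[+ _]; lra.
rewrite [y + _]addrC subrK /G -(primitiveB (rV_int rP) p0 pf) -(primitiveB (rV_int rP) p0 (ltW py)).
rewrite -/(travel_time r) (travel_time_flow rP y0 (ltW (hn0 n))).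
by move: (rho y) (rho p) => b c; ring.
Qed.

(** The average is the difference quotient of [cumulated] between
    [flow r y h] and [y], up to the ratio of [y - flow r y h] to [h], which
    tends to [r y]. Lebesgue's differentiation theorem applies to
    [cumulated]. *)
Lemma average_ae_cvg l f (h : nat -> R) : omega <= l -> h @ \oo --> 0 -> (forall n, 0 < h n) ->
  {ae weighted alpha, forall y, L1_fun (Ks l (h n) f) y @[n --> \oo] --> L1_fun f y}.
Proof.
move=> ol h0 hn0; have mf := L1_fun_measurable f; have fin := Xspace_finite f.
pose phi x := gain l x * L1_fun f x.
have mphi : measurable_fun (setT : set RT) phi.
  by apply: measurable_funM => //; exact: (gain_measurable).
have i_phi y : leb.-integrable `]-oo, y] (EFin \o phi).
  have [y0|y0] := ltP 0 y; first exact: (cumulated_integrable ol y0 mf fin).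
  have i1 := cumulated_integrable ol ltr01 mf fin.
  by apply: integrableS i1 => // x; rewrite /= !in_itv /= => /le_trans; apply; exact: le_trans y0 ler01.
have loc_phi : locally_integrable [set: R] phi.
  split => //; first exact: openT.
  move=> K _ cK; have [M [_ KM]] := compact_bounded cK.
  have KI : K `<=` `]-oo, (M + 1)%R].
    move=> x Kx; rewrite /= in_itv /=; apply: le_trans (ler_norm x) _.
    by apply: KM => //; rewrite ltrDl.
  have /integrableP[m_phi phi_fin] := i_phi (M + 1).
  apply: le_lt_trans phi_fin; apply: ge0_subset_integral => //.
  - exact: compact_measurable.
  - apply/measurable_EFinP; apply: measurableT_comp => //.
    exact: measurable_funTS.
have ftc := FTC1Ny i_phi loc_phi.
have all_n : {ae weighted alpha, forall y, forall n, L1_fun (Ks l (h n) f) y = kernel_op (Kk l (h n)) (L1_fun f) y}.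
  apply/ae_foralln => n; exact: (average_ae).
apply: (ae_imply2 all_n (_ : {ae weighted alpha, forall y, 0 < y /\
   (derivable (cumulated l (L1_fun f)) y 1 /\ derive1 (cumulated l (L1_fun f)) y = phi y)})).
  apply/ae_weighted; apply: (ae_imply ftc) => y; by split.
move=> y E [y0 [dF FE]].
have kn0 n : flow r y (h n) - y != 0 by rewrite subr_eq0 lt_eqF // flow_lt.
have c1 := derivable_seq dF FE (flow_cvg y0 h0 hn0) kn0.
have rV0 : (r y)^-1 != 0 by rewrite invr_eq0 gt_eqF // r_gt0.
have c2 : ((flow r y (h n) - y)^-1 * - h n)^-1 @[n --> \oo] --> (r y)^-1^-1.
  by apply: cvgV => //; exact: flow_speed.
have c3 : slowness y * decay l y * ((flow r y (h n) - y)^-1 *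
    (cumulated l (L1_fun f) (y + (flow r y (h n) - y)) - cumulated l (L1_fun f) y) *
    ((flow r y (h n) - y)^-1 * - h n)^-1) @[n --> \oo] -->
    slowness y * decay l y * (phi y * (r y)^-1^-1).
  by apply: cvgM; [exact: cvg_cst|exact: cvgM].
have -> : L1_fun f y = slowness y * decay l y * (phi y * (r y)^-1^-1).
  rewrite invrK (slowness_pos _ y0) /phi /decay /gain !halfline_pos // expRN.
  have := expR_gt0 (potential l y); have := r_gt0 y0.
  by move: (expR _) => e ry0 e0; field; rewrite !gt_eqF.
apply: (cvg_near_eq _ c3); apply: nearW => n.
rewrite E (kernel_op_average ol (ltW (hn0 n)) y0 mf fin).
have hn := hn0 n; have kn := kn0 n; move: (hn) (kn).
rewrite [y + _]addrC subrK.
move: (flow r y (h n) - y) (h n) => k hh hh0 k0.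
move: (cumulated _ _ _) (cumulated _ _ _) => P Q.
by field; rewrite k0 gt_eqF.
Qed.

Lemma average_nneg l h f : omega <= l -> 0 < h -> L1_nneg f -> L1_nneg (Ks l h f).
Proof.
move=> ol h0; exact: (kernel_map_pos (average_kernel_measurable l (ltW h0))
  (fun y x => average_kernel_ge0 l y x (ltW h0)) (average_kernel_neg l h)
  (average_finite f ol h0)).
Qed.

Lemma average_cvg_nneg l f (h : nat -> R) : omega <= l -> h @ \oo --> 0 -> (forall n, 0 < h n) ->
  L1_nneg f -> `|f - Ks l (h n) f| @[n --> \oo] --> 0.
Proof.
move=> ol h0 hn0 f0; apply: L1_scheffe => //.
- by move=> n; exact: average_nneg.
- by move=> n; exact: (average_bnd).
- exact: average_ae_cvg.
Qed.

Lemma average_cvg l f : omega <= l -> Ks l h f @[h --> 0^'+] --> f.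
Proof.
move=> ol; apply/cvgrPdist_le => e e0.
suff : `|f - Ks l h f| @[h --> 0^'+] --> 0.
  move=> /cvgrPdist_le/(_ e e0); apply: filterS => h.
  by rewrite sub0r normrN normr_id.
apply/cvg_at_rightP => h [hn0 h0].
have [p [q [p0 q0 -> _]]] := L1_split f.
apply: (@squeeze_cvgr _ _ _ _ (fun=> 0)
  (fun n => `|p - Ks l (h n) p| + `|q - Ks l (h n) q|)).
- apply: nearW => n; rewrite normr_ge0 /=.
  rewrite (linear_sub (average_lin ol (hn0 n))).
  have -> : p - q - (Ks l (h n) p - Ks l (h n) q) =
      (p - Ks l (h n) p) - (q - Ks l (h n) q).
    by rewrite !opprB addrACA [RHS]addrACA; congr (_ + _); exact: addrC.
  exact: ler_normB.
- exact: cvg_cst.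
- by rewrite -[X in _ --> X]addr0; apply: cvgD; exact: average_cvg_nneg.
Qed.

End averages.

(** * The generator of transport *)

Local Notation Ks := flow_average.
Local Notation D := (transport_dom alpha r a).
Local Notation T := (transport_gen alpha r a).

(** By [transport_resolvent_average], the quotient is ((e^{l h} - 1) / h)
    (l - T)^{-1} f - e^{l h} K_h f. *)
Lemma resolvent_derivative l f : omega < l ->
  h^-1 *: (U h (Rs l f) - Rs l f) @[h --> 0^'+] --> l *: Rs l f - f.
Proof.
move=> ol; pose E h : X := (h^-1 * (expR (l * h) - 1)) *: Rs l f - expR (l * h) *: Ks l h f.
apply: (@cvg_near_eq _ _ _ _ E).
  near=> h; have h0 : 0 < h by near: h; exact: nbhs_right_gt.
  rewrite (transport_resolvent_average f ol h0) /E.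
  move: (expR _) (Rs l f) (Ks l h f) => e x k.
  have -> : e *: (x - h *: k) - x = (e - 1) *: x - (e * h) *: k.
    by rewrite scalerBr scalerBl scale1r scalerA addrAC.
  rewrite scalerBr !scalerA; congr (_ - _ *: _).
  by rewrite mulrCA mulVf ?mulr1 // gt_eqF.
apply: cvgB; first by apply: cvgZl; exact: expR_quotient_cvg.
rewrite -[X in _ --> X]scale1r; apply: cvgZ; first exact: expR_right_cvg.
exact: (average_cvg (ltW ol)).
Unshelve. all: by end_near. Qed.

Lemma gen_derivative f : D f -> h^-1 *: (U h f - f) @[h --> 0^'+] --> T f.
Proof. by rewrite /transport_dom /gen_dom /= => /cvg_ex[l fl]; rewrite /transport_gen /gen (cvg_lim _ fl). Qed.

Lemma resolvent_dom l f : omega < l -> D (Rs l f).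
Proof. by move=> ol; apply/cvg_ex; eexists; exact: resolvent_derivative. Qed.

Lemma gen_resolvent l f : omega < l -> T (Rs l f) = l *: Rs l f - f.
Proof. by move=> ol; apply: cvg_lim => //; exact: resolvent_derivative. Qed.

(** The resolvent is bounded and commutes with the semigroup, hence with
    the limit that defines the generator. *)
Lemma resolvent_gen l f : omega < l -> D f -> Rs l (T f) = l *: Rs l f - f.
Proof.
move=> ol Df; have lin := resolvent_lin ol.
have bnd g := resolvent_bnd g ol.
have c1 : Rs l (h^-1 *: (U h f - f)) @[h --> 0^'+] --> Rs l (T f).
  exact: (cvg_bounded_linear lin bnd (gen_derivative Df)).
have c2 : Rs l (h^-1 *: (U h f - f)) @[h --> 0^'+] --> l *: Rs l f - f.
  apply: (@cvg_near_eq _ _ _ _ (fun h => h^-1 *: (U h (Rs l f) - Rs l f))); last exact: resolvent_derivative.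
  near=> h.
  have h0 : 0 < h by near: h; exact: nbhs_right_gt.
  rewrite (linear_scale lin) (linear_sub lin).
  by rewrite (resolvent_transport f ol (ltW h0)).
exact: (cvg_unique _ c1 c2).
Unshelve. all: by end_near. Qed.

Lemma transport_resolventP l : omega < l -> is_resolvent D T l (Rs l).
Proof.
move=> ol; have lin := resolvent_lin ol; split.
- split=> //; exists (l - omega)^-1 => f; exact: (resolvent_bnd).
- move=> g; split; first exact: resolvent_dom.
  by rewrite gen_resolvent // opprB addrC subrK.
- move=> f Df; rewrite (linear_sub lin) (linear_scale lin) resolvent_gen //.
  by rewrite opprB addrC subrK.
Qed.

Lemma transport_resolventE l : omega < l -> resolvent D T l = Rs l.
Proof.
move=> ol; have res := transport_resolventP ol; rewrite /resolvent.
case: xgetP => [P _ [_ PD _]|]; last by move=> /(_ (Rs l)).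
apply/funext => g; have [Dg Pg] := PD g; have [_ _ /(_ _ Dg)] := res.
by rewrite Pg.
Qed.

(** The averages of [f] lie in the range of the resolvent and tend to [f]. *)
Lemma transport_dom_dense : dense_in_norm D.
Proof.
move=> f e e0; pose l := omega + 1; have ol : omega < l by rewrite ltrDl.
have /cvgrPdist_le/(_ e e0) K_near := @average_cvg l f (ltW ol).
have /filter_ex[h [h0 Kh]] : \forall h \near 0^'+, 0 < h /\ `|f - Ks l h f| <= e.
  by apply: filterS2 K_near (nbhs_right_gt 0) => h.
exists (Ks l h f) => //.
have lin := resolvent_lin ol.
suff -> : Ks l h f = Rs l (h^-1 *: (f - expR (- (l * h)) *: U h f)) by exact: resolvent_dom.
rewrite (linear_scale lin) (linear_sub lin) (linear_scale lin).
rewrite (resolvent_transport f ol (ltW h0)).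
rewrite (transport_resolvent_average f ol h0) scalerA -expRD addNr expR0 scale1r.
by rewrite opprB addrC subrK scalerA mulVf ?scale1r // gt_eqF.
Qed.

(** Differentiate the growth bound of the semigroup at time 0, where the
    norm of [v] is its integral. *)
Lemma transport_growth (v : X) : D v -> L1_nneg v -> L1_integral (T v) <= omega * L1_integral v.
Proof.
move=> Dv v0; rewrite (L1_integral_nneg v0).
pose q h : X := h^-1 *: (U h v - v).
have I_cvg : L1_integral (q h) @[h --> 0^'+] --> L1_integral (T v).
  apply/cvgrPdist_le => e e0; have /cvgrPdist_le/(_ e e0) := gen_derivative Dv.
  apply: filterS => h; apply: le_trans.
  have -> : L1_integral (T v) - L1_integral (q h) = L1_integral (T v - q h).
    by rewrite addrC [T v - q h]addrC -(scaleN1r (q h)) L1_integral_lin mulN1r.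
  exact: L1_integral_le.
have E_cvg : h^-1 * (expR (omega * h) - 1) * `|v| @[h --> 0^'+] --> omega * `|v|.
  by apply: cvgM; [exact: expR_quotient_cvg|exact: cvg_cst].
apply: (ler_cvg_to I_cvg E_cvg); near=> h.
have h0 : 0 < h by near: h; exact: nbhs_right_gt.
have -> : L1_integral (q h) = h^-1 * (L1_integral (U h v) - `|v|).
  rewrite /q -[_ *: _]addr0 L1_integral_lin -(L1_integral_nneg v0).
  rewrite [U h v - v]addrC -(scaleN1r v) L1_integral_lin mulN1r.
  have -> : L1_integral (0 : X) = 0.
    by apply/eqP; rewrite -normr_le0 -(normr0 X) L1_integral_le.
  by rewrite addr0 addrC.
rewrite -mulrA ler_wpM2l ?invr_ge0 ?(ltW h0) // mulrBl mul1r lerB //.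
apply: le_trans (ler_norm _) _; apply: le_trans (L1_integral_le _) _.
exact: (transport_bnd v (ltW h0)).
Unshelve. all: by end_near. Qed.

(** * Fragmentation *)

Variables (b : R -> R -> R) (S : R).
Hypothesis b_meas : measurable_fun ((halfline : set R) `*` (halfline : set R))
  (fun z : R * R => b z.1 z.2).
Hypothesis b_ge0 : forall x y, 0 < x -> 0 < y -> 0 <= b x y.
Hypothesis b_supp : forall x y, 0 < x -> 0 < y -> y <= x -> b x y = 0.
Hypothesis S_ge0 : 0 <= S.
Hypothesis S_bnd : forall y, 0 < y -> (moment_ratio alpha b y <= S%:E)%E.

Local Notation B := (frag alpha a b).

Implicit Types (c : R) (u : X).

(** Measurability of [b] is known on the quadrant only, hence the extension by 0. *)
Definition daughter x y : R :=
  ((fun z : R * R => b z.1 z.2) \_ ((halfline : set R) `*` (halfline : set R))) (x, y).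

Lemma daughter_pos x y : 0 < x -> 0 < y -> daughter x y = b x y.
Proof.
move=> x0 y0; rewrite /daughter patchE ifT // inE.
by split; rewrite /= in_itv /= ?x0 ?y0.
Qed.

Lemma daughter_negl x y : x <= 0 -> daughter x y = 0.
Proof.
move=> x0; rewrite /daughter patchE ifF //; apply: memNset => -[/=].
by rewrite in_itv /= andbT ltNge x0.
Qed.

Lemma daughter_negr x y : y <= 0 -> daughter x y = 0.
Proof.
move=> y0; rewrite /daughter patchE ifF //; apply: memNset => -[/= _].
by rewrite in_itv /= andbT ltNge y0.
Qed.

Lemma daughter_ge0 x y : 0 <= daughter x y.
Proof.
have [x0|x0] := leP x 0; first by rewrite daughter_negl.
have [y0|y0] := leP y 0; first by rewrite daughter_negr.
by rewrite daughter_pos // b_ge0.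
Qed.

Lemma daughter_measurable :
  measurable_fun (setT : set (RT * RT)) (fun z : RT * RT => daughter z.1 z.2).
Proof.
have mH : measurable ((halfline : set R) `*` (halfline : set R)).
  by apply: measurableX; exact: measurable_itv.
have /(measurable_restrictT _ mH) H := b_meas.
have -> : (fun z : RT * RT => daughter z.1 z.2) =
  (fun z : R * R => b z.1 z.2) \_ ((halfline : set R) `*` (halfline : set R)).
  by apply/funext => -[].
exact: H.
Qed.

Definition frag_kernel x y : R := absorption_rate y * daughter x y.
Local Notation Fk := frag_kernel.

Lemma frag_kernel_ge0 x y : 0 <= Fk x y.
Proof. by rewrite mulr_ge0 ?daughter_ge0 // (absorption_rate_ge0). Qed.

Lemma frag_kernel_neg x y : y <= 0 -> Fk x y = 0.
Proof. by move=> y0; rewrite /Fk daughter_negr // mulr0. Qed.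

Lemma frag_kernel_measurable :
  measurable_fun (setT : set (RT * RT)) (fun z : RT * RT => Fk z.1 z.2).
Proof.
apply: measurable_funM; last exact: daughter_measurable.
have ma : measurable_fun (setT : set RT) (absorption_rate) := absorption_rate_measurable.
exact: (measurableT_comp ma measurable_snd).
Qed.

(** The integral over y > x is one over the whole line, since [b] vanishes
    below the diagonal. *)
Lemma frag_kernel_restrict x (u : R -> R) : 0 < x ->
  (fun y => a y * b x y * u y) \_ `]x, +oo[ = (fun y => Fk x y * u y).
Proof.
move=> x0; apply/funext => y; rewrite patchE; case: ifPn.
  rewrite inE /= in_itv /= andbT => xy; have y0 := lt_trans x0 xy.
  by rewrite /Fk daughter_pos // /absorption_rate halfline_pos.
rewrite notin_setE /= in_itv /= andbT => /negP; rewrite -leNgt => yx.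
have [y0|y0] := leP y 0; first by rewrite frag_kernel_neg // mul0r.
by rewrite /Fk daughter_pos // b_supp // mulr0 mul0r.
Qed.

Lemma frag_funE (u : R -> R) : frag_fun a b u = kernel_op Fk u.
Proof.
apply/funext => x; rewrite /frag_fun; have [x0|x0] := leP x 0.
  rewrite halfline_neg // /kernel_op /Rintegral integral0_eq // => y _.
  by rewrite /Fk daughter_negl // mulr0 mul0r.
by rewrite halfline_pos // Rintegral_mkcond frag_kernel_restrict.
Qed.

Lemma fragE f : frag alpha a b f = kernel_map Fk f.
Proof. by rewrite /frag frag_funE. Qed.

Lemma frag_kernel_finite_dom f : kernel_finite Fk f -> frag_dom alpha a b f.
Proof.
move=> fin; split; last first.
  rewrite frag_funE inE; apply/Lfun1_integrable.
  exact: (kernel_map_integrable frag_kernel_measurable frag_kernel_ge0 fin).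
have p0 : {ae weighted alpha, forall x, 0 < x} by apply/ae_weighted; exact: nearW.
apply: (ae_imply2 p0 (kernel_map_ae frag_kernel_measurable frag_kernel_ge0 fin)) => x x0.
move=> fx; rewrite (@integrable_mkcond _ RT) //.
suff -> : (fun y => (a y * b x y * L1_fun f y)%:E) \_ `]x, +oo[ =
    (fun y => (Fk x y * L1_fun f y)%:E) by exact: fx.
by have := congr1 (fun u : R -> R => EFin \o u) (frag_kernel_restrict (L1_fun f) x0); rewrite -restrict_EFin.
Qed.

Lemma frag_kernel_column y : 0 < y ->
  (\int[leb]_x (weight alpha x * Fk x y)%:E = (a y)%:E * frag_moment alpha b y)%E.
Proof.
move=> y0; have -> : frag_moment alpha b y = (\int[leb]_x (weight alpha x * daughter x y)%:E)%E.
  rewrite /frag_moment integral_mkcond; apply: eq_integral => x _; rewrite patchE.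
  case: ifPn.
    rewrite inE /= in_itv /= => /andP[x0 xy].
    by rewrite weight_pos // daughter_pos.
  rewrite notin_setE /= in_itv /=; have [x0|x0] := leP x 0.
    by rewrite weight_neg // mul0r.
  by move=> /negP /=; rewrite -leNgt => yx; rewrite daughter_pos // b_supp // mulr0.
rewrite -ge0_integralZl_EFin ?a_ge0 //.
- by apply: eq_integral => x _; rewrite -EFinM /Fk /absorption_rate halfline_pos // mulrCA.
- by move=> x _; rewrite lee_fin mulr_ge0 ?weight_ge0 ?daughter_ge0.
- apply/measurable_EFinP; apply: measurable_funM; first exact: measurable_weight.
  have mp : measurable_fun (setT : set RT) (fun x : RT => (x, y) : RT * RT).
    by apply: measurable_fun_pair.
  exact: (measurableT_comp daughter_measurable mp).
Qed.

Definition eventual_ratio s c : Prop :=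
  forall y, 0 < y -> c <= a y -> (moment_ratio alpha b y <= s%:E)%E.

Lemma frag_moment_le y (m : R) : 0 < y -> (moment_ratio alpha b y <= m%:E)%E ->
  (frag_moment alpha b y <= (m * y `^ alpha)%:E)%E.
Proof.
move=> y0; have p := powR_gt0 alpha y0.
by rewrite /moment_ratio -lee_pdivlMr ?invr_gt0 // invrK -EFinM.
Qed.

(** Where [c <= a y] the bound [s] applies; elsewhere [a y < c] and the
    bound [S] applies. *)
Lemma frag_kernel_column_le s c y : 0 <= s -> 0 <= c -> eventual_ratio s c -> 0 < y ->
  (\int[leb]_x (weight alpha x * Fk x y)%:E <=
   (weight alpha y * (s * absorption_rate y + c * S))%:E)%E.
Proof.
move=> s0 c0 sc y0; rewrite frag_kernel_column // /absorption_rate halfline_pos // weight_pos //.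
have p := powR_ge0 y alpha; have ay := a_ge0 y0.
have [ca|ac] := leP c (a y).
  apply: le_trans (lee_wpmul2l _ (frag_moment_le y0 (sc y y0 ca))) _ => //.
  rewrite -EFinM lee_fin mulrDr; apply: le_trans (_ : y `^ alpha * (s * a y) <= _).
    by rewrite le_eqVlt; apply/orP; left; apply/eqP; ring.
  by rewrite lerDl !mulr_ge0.
apply: le_trans (lee_wpmul2l _ (frag_moment_le y0 (S_bnd y0))) _ => //.
rewrite -EFinM lee_fin; apply: le_trans (_ : c * (S * y `^ alpha) <= _).
  by rewrite ler_wpM2r ?mulr_ge0 // ltW.
rewrite [leRHS]mulrC mulrA ler_wpM2r // lerDr mulr_ge0 //.
Qed.

Lemma frag_kernel_mass_le s c f : 0 <= s -> 0 <= c -> eventual_ratio s c ->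
  (kernel_mass (weight alpha) Fk (L1_fun f) <=
   \int[leb]_y (weight alpha y * (s * absorption_rate y + c * S) * `|L1_fun f y|)%:E)%E.
Proof.
move=> s0 c0 sc.
apply: (@kernel_mass_le _ _ _ (measurable_weight alpha) (weight_ge0 alpha) frag_kernel_measurable
  frag_kernel_ge0 frag_kernel_neg).
- exact: L1_fun_measurable.
- apply: measurable_funM; first exact: measurable_weight.
  apply: measurable_funD => //; apply: measurable_funM => //.
  exact: (absorption_rate_measurable).
- by move=> y; exact: frag_kernel_column_le.
- by move=> y; rewrite mulr_ge0 ?weight_ge0 // addr_ge0 // mulr_ge0 // (absorption_rate_ge0).
Qed.

Let mF := frag_kernel_measurable.
Let F_ge0 := frag_kernel_ge0.
Let F_neg := frag_kernel_neg.
Let BE (f : X) : B f = kernel_map Fk f.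
Proof. exact: fragE. Qed.

(** s a + c S <= (s + c S / (l - omega)) (l - omega + a), and
    [resolvent_energy] bounds the integral of the last factor. *)
Lemma frag_resolvent_mass s c l u : 0 <= s -> 0 <= c -> eventual_ratio s c -> omega < l ->
  (kernel_mass (weight alpha) Fk (L1_fun (Rs l u)) <=
   ((s + c * S / (l - omega)) * `|u|)%:E)%E.
Proof.
move=> s0 c0 sc ol; have lo : 0 < l - omega by rewrite subr_gt0.
have m_w := measurable_weight alpha; have m_a := absorption_rate_measurable.
have m_f := L1_fun_measurable (Rs l u).
have m_nf : measurable_fun (setT : set RT) (fun y => `|L1_fun (Rs l u) y|).
  exact: measurableT_comp.
have k0 : 0 <= s + c * S / (l - omega).
  by rewrite addr_ge0 // divr_ge0 ?(ltW lo) // mulr_ge0.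
have ra := absorption_rate_ge0.
apply: le_trans (frag_kernel_mass_le (Rs l u) s0 c0 sc) _.
rewrite EFinM; apply: le_trans (lee_wpmul2l _ (resolvent_energy u ol)); last by rewrite lee_fin.
have w0 := weight_ge0 alpha.
rewrite -ge0_integralZl_EFin //; last 2 first.
- by move=> y _; rewrite lee_fin !mulr_ge0 // addr_ge0 // ltW.
- apply/measurable_EFinP; apply: measurable_funM => //; apply: measurable_funM => //.
  by apply: measurable_funD.
apply: ge0_le_integral => //.
- by move=> y _; rewrite lee_fin !mulr_ge0 // addr_ge0 // mulr_ge0.
- apply/measurable_EFinP; apply: measurable_funM => //; apply: measurable_funM => //.
  by apply: measurable_funD => //; exact: measurable_funM.
- apply: emeasurable_funM => //; apply/measurable_EFinP; apply: measurable_funM => //.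
  by apply: measurable_funM => //; exact: measurable_funD.
move=> y _; rewrite -EFinM lee_fin mulrA ler_wpM2r // mulrCA ler_wpM2l //.
have -> : (s + c * S / (l - omega)) * (l - omega + absorption_rate y) =
    s * absorption_rate y + c * S + (s * (l - omega) + c * S / (l - omega) * absorption_rate y).
  by move: lo; move: (l - omega) => k k_gt0; field; rewrite gt_eqF.
by rewrite lerDl addr_ge0 // mulr_ge0 // ?divr_ge0 ?mulr_ge0 // ltW.
Qed.

Lemma eventual_ratioS : eventual_ratio S 0.
Proof. by move=> y y0 _; exact: S_bnd. Qed.

Lemma frag_resolvent_finite l u : omega < l -> kernel_finite Fk (Rs l u).
Proof.
move=> ol; apply: le_lt_trans (frag_resolvent_mass u S_ge0 (lexx 0) eventual_ratioS ol) _.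
exact: ltry.
Qed.

Lemma frag_resolvent_bnd s c l u : 0 <= s -> 0 <= c -> eventual_ratio s c -> omega < l ->
  `|B (Rs l u)| <= (s + c * S / (l - omega)) * `|u|.
Proof.
move=> s0 c0 sc ol; rewrite BE -lee_fin.
apply: le_trans (frag_resolvent_mass u s0 c0 sc ol).
exact: (kernel_map_norm mF F_ge0 (frag_resolvent_finite u ol)).
Qed.

Lemma frag_resolvent_le l u : omega < l -> `|B (Rs l u)| <= S * `|u|.
Proof.
move=> ol; have := frag_resolvent_bnd u S_ge0 (lexx 0) eventual_ratioS ol.
by rewrite !mul0r addr0.
Qed.

Lemma frag_lin c f g : kernel_finite Fk f -> kernel_finite Fk g ->
  B (c *: f + g) = c *: B f + B g.
Proof.
by move=> ff fg; rewrite !BE; exact: (kernel_map_lin mF F_ge0 F_neg).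
Qed.

Lemma frag_resolvent_lin l : omega < l -> linear (B \o Rs l).
Proof.
move=> ol c u v /=; rewrite (resolvent_lin ol).
exact: (frag_lin c (frag_resolvent_finite u ol) (frag_resolvent_finite v ol)).
Qed.

Lemma frag_resolvent_nneg l u : omega < l -> L1_nneg u -> L1_nneg (B (Rs l u)).
Proof.
move=> ol u0; rewrite BE; apply: (kernel_map_pos mF F_ge0 F_neg (frag_resolvent_finite u ol)).
exact: (resolvent_nneg).
Qed.

Lemma transport_domE l f : omega < l -> D f -> f = Rs l (l *: f - T f).
Proof. by move=> ol Df; have [_ _ ->] := transport_resolventP ol. Qed.

Lemma transport_dom_frag : D `<=` frag_dom alpha a b.
Proof.
move=> f Df; have ol : omega < omega + 1 by rewrite ltrDl.
rewrite (transport_domE ol Df); apply: (frag_kernel_finite_dom).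
exact: frag_resolvent_finite.
Qed.

Lemma frag_rel_bounded : rel_bounded D T (frag_dom alpha a b) B.
Proof.
split; first exact: transport_dom_frag.
have ol : omega < omega + 1 by rewrite ltrDl.
exists (S * `|omega + 1|), S => f Df; rewrite {1}(transport_domE ol Df).
apply: le_trans (frag_resolvent_le _ ol) _.
rewrite -mulrA -mulrDr ler_wpM2l // -normrZ; exact: ler_normB.
Qed.

(** The resolvent identity. It shows that [B (Rs l u)] decreases with [l]
    on nonnegative functions. *)
Lemma frag_resolvent_step l m u : omega < l -> l <= m ->
  B (Rs l u) = B (Rs m u) + (m - l) *: B (Rs l (Rs m u)).
Proof.
move=> ol lm; have om := lt_le_trans ol lm.
have E : Rs m u = Rs l (l *: Rs m u - (m *: Rs m u - u)).
  rewrite -(@gen_resolvent m u om).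
  exact: transport_domE ol (@resolvent_dom m u om).
have {}E : Rs l u = (m - l) *: Rs l (Rs m u) + Rs m u.
  rewrite [X in _ = _ + X]E -(resolvent_lin ol); congr (Rs l _).
  move: (Rs m u) => v.
  by rewrite scalerBl addrA subrK opprB addrC subrK.
apply: etrans (congr1 B E) _.
apply: etrans (frag_lin (m - l) (frag_resolvent_finite (Rs m u) ol) (frag_resolvent_finite u om)) _.
exact: addrC.
Qed.

Lemma frag_resolvent_antitone l m u : omega < l -> l <= m -> L1_nneg u ->
  `|B (Rs m u)| <= `|B (Rs l u)|.
Proof.
move=> ol lm u0; have om := lt_le_trans ol lm.
have ml : 0 <= m - l by rewrite subr_ge0.
exact: (L1_norm_le_add ml (frag_resolvent_nneg om u0)
  (frag_resolvent_nneg ol (resolvent_nneg om u0)) (frag_resolvent_step u ol lm)).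
Qed.

(** The norm is additive on positive and negative parts, so nonnegative
    functions decide. *)
Lemma frag_opnorm_antitone l m : omega < l -> l <= m ->
  (opnorm (B \o Rs m) <= opnorm (B \o Rs l))%E.
Proof.
move=> ol lm; have om := lt_le_trans ol lm.
apply: ge_ereal_sup => _ [u /= u1 <-].
have [p [q [p0 q0 uE npq]]] := L1_split u; subst u.
have npq' : `|p + q| <= 1.
  by apply: le_trans (ler_normD _ _) _; rewrite -npq.
apply: (@le_trans _ _ (`|B (Rs l (p + q))|)%:E); last first.
  by apply: ereal_sup_ubound; exists (p + q).
rewrite lee_fin.
apply: le_trans (_ : `|B (Rs l p)| + `|B (Rs l q)| <= _).
  apply: le_trans (lerD (frag_resolvent_antitone ol lm p0) (frag_resolvent_antitone ol lm q0)).
  have E : B (Rs m (p - q)) = B (Rs m p) - B (Rs m q) := linear_sub (frag_resolvent_lin om) p q.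
  by apply: le_trans (ler_normB _ _); exact: (le_of_eq (congr1 Num.norm E)).
have E : B (Rs l (p + q)) = B (Rs l p) + B (Rs l q) := linear_add (frag_resolvent_lin ol) p q.
have n_add := L1_norm_add (frag_resolvent_nneg ol p0) (frag_resolvent_nneg ol q0).
exact: (le_of_eq (etrans (esym n_add) (congr1 Num.norm (esym E)))).
Qed.

Lemma frag_opnorm_le s c l : 0 <= s -> 0 <= c -> eventual_ratio s c -> omega < l ->
  (opnorm (B \o Rs l) <= (s + c * S / (l - omega))%:E)%E.
Proof.
move=> s0 c0 sc ol; apply: ge_ereal_sup => _ [u /= u1 <-]; rewrite lee_fin.
apply: le_trans (frag_resolvent_bnd u s0 c0 sc ol) _.
rewrite -[leRHS]mulr1 ler_wpM2l // addr_ge0 // divr_ge0 ?mulr_ge0 //.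
by rewrite subr_ge0 ltW.
Qed.

Local Notation N l := (opnorm (B \o resolvent D T l)).

Lemma resolvent_opnormE l : omega < l -> N l = opnorm (B \o Rs l).
Proof. by move=> ol; rewrite (transport_resolventE ol). Qed.

Lemma frag_opnorm_cvg : cvg (N l @[l --> +oo%R]).
Proof.
(* freezing the norm below omega + 1 makes it decrease on the whole line *)
pose F l := opnorm (B \o Rs (Num.max l (omega + 1))).
have ol m : omega < Num.max m (omega + 1) by rewrite lt_max ltrDl ltr01 orbT.
have F_mono : nonincreasing_fun F.
  by move=> l m lm; apply: frag_opnorm_antitone => //; rewrite ge_max !le_max lm lexx orbT.
have F_cvg : F l @[l --> +oo%R] --> ereal_inf (range F) by exact: nonincreasing_cvge.
apply/cvg_ex; exists (ereal_inf (range F)).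
apply: (@cvg_near_eq _ _ _ _ F) => //; near=> l.
have lo : omega + 1 <= l by near: l; apply: nbhs_pinfty_ge; rewrite num_real.
have ol' : omega < l by apply: lt_le_trans lo; rewrite ltrDl.
apply: etrans (esym (resolvent_opnormE ol')).
by rewrite /F max_l.
Unshelve. all: by end_near. Qed.

Lemma lim_frag_opnorm_le s c : 0 <= s -> 0 <= c -> eventual_ratio s c ->
  (lim (N l @[l --> +oo%R]) <= s%:E)%E.
Proof.
move=> s0 c0 sc.
have cS0 : 0 <= c * S by rewrite mulr_ge0.
apply/lee_addgt0Pr => e e0; apply: lime_le; first exact: frag_opnorm_cvg.
near=> l.
have lo : omega + c * S / e + 1 <= l by near: l; apply: nbhs_pinfty_ge; rewrite num_real.
have p0 : 0 <= c * S / e by rewrite divr_ge0 // ltW.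
have ol : omega < l by move: p0 lo; move: (c * S / e) => k; lra.
apply: le_trans (le_of_eq (resolvent_opnormE ol)) _.
apply: le_trans (frag_opnorm_le s0 c0 sc ol) _.
rewrite -EFinD lee_fin lerD2l ler_pdivrMr ?subr_gt0 // -ler_pdivrMl // mulrC.
by move: p0 lo; move: (c * S / e) => k; lra.
Unshelve. all: by end_near. Qed.

End growth_fragmentation.

(** * Upper limits of the fragmentation ratio *)

Lemma ereal_sup_bound (R : realType) (F : R -> \bar R) :
  (ereal_sup [set F y | y in halfline] < +oo)%E ->
  exists2 S : R, 0 <= S & forall y, 0 < y -> (F y <= S%:E)%E.
Proof.
move=> fin; pose s := ereal_sup [set F y | y in halfline].
have F_le y : 0 < y -> (F y <= s)%E.
  by move=> y0; apply: ereal_sup_ubound; exists y => //=; rewrite in_itv /= y0.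
have : (s < +oo)%E by []; case: s F_le => [s| |] // F_le _.
  exists (Num.max s 0); first by rewrite le_max lexx orbT.
  by move=> y /F_le /le_trans; apply; rewrite lee_fin le_max lexx.
by exists 0 => // y /F_le /le_trans; apply; rewrite leNye.
Qed.

Lemma growth_rate_of (R : realType) (r : R -> R) :
  {within halfline, continuous r} -> (forall x : R, 0 < x -> 0 < r x) ->
  (\int[lebesgue_measure]_(s in `]0%R, 1%R[) ((r s)^-1)%:E = +oo)%E ->
  (\int[lebesgue_measure]_(s in `]1%R, +oo[) ((r s)^-1)%:E = +oo)%E ->
  (ereal_sup [set (r z / z)%:E | z in halfline] < +oo)%E ->
  exists C, growth_rate r C.
Proof.
move=> r_cont r_gt0 r_int0 r_intoo /ereal_sup_bound[S S0 rS].
exists (S + 1); split => //; first by rewrite ltr_wpDl.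
move=> x x0; rewrite -ler_pdivrMr //; have := rS x x0; rewrite lee_fin => /le_trans; apply.
by rewrite lerDl.
Qed.

Section upper_limit.
Context (R : realType) (a : R -> R) (g : R -> \bar R).

Let E (c : R) : \bar R :=
  ereal_sup ([set 0%E] `|` [set g y | y in [set y | 0 < y /\ c <= a y]]).

Let E_mono : nonincreasing_fun E.
Proof.
move=> c d cd; apply: le_ereal_sup => x [->|[y [y0 dy] <-]]; first by left.
by right; exists y => //; split => //; exact: le_trans dy.
Qed.

Let E_cvg : E c @[c --> +oo%R] --> ereal_inf (range E) := nonincreasing_cvge E_mono.

Lemma limsup_rateE : limsup_rate a g = ereal_inf (range E).
Proof. exact: cvg_lim E_cvg. Qed.

Lemma limsup_rate_ge (m : \bar R) :
  (forall s c : R, 0 <= s -> 0 <= c ->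
     (forall y, 0 < y -> c <= a y -> (g y <= s%:E)%E) -> (m <= s%:E)%E) ->
  (m <= limsup_rate a g)%E.
Proof.
move=> H; rewrite limsup_rateE; apply: le_ereal_inf_tmp => _ [c _ <-].
apply: (@le_trans _ _ (E (Num.max c 0))); last by apply: E_mono; rewrite le_max lexx.
set d := Num.max c 0; have d0 : 0 <= d by rewrite le_max lexx orbT.
have E0 : (0 <= E d)%E by apply: ereal_sup_ubound; left.
have gE y : 0 < y -> d <= a y -> (g y <= E d)%E.
  by move=> y0 dy; apply: ereal_sup_ubound; right; exists y.
move: E0 gE; case: (E d) => [s| |] // E0 gE; last exact: leey.
by apply: (H s d).
Qed.

Lemma limsup_rate_lt (m : R) : (limsup_rate a g < m%:E)%E ->
  exists s c : R, [/\ 0 <= s, s < m, 0 <= c &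
    forall y, 0 < y -> c <= a y -> (g y <= s%:E)%E].
Proof.
rewrite limsup_rateE => /ereal_inf_lt[_ [c _ <-] Ec].
set d := Num.max c 0; have d0 : 0 <= d by rewrite le_max lexx orbT.
have Ed : (E d < m%:E)%E.
  by apply: le_lt_trans Ec; apply: E_mono; rewrite le_max lexx.
have E0 : (0 <= E d)%E by apply: ereal_sup_ubound; left.
have gE y : 0 < y -> d <= a y -> (g y <= E d)%E.
  by move=> y0 dy; apply: ereal_sup_ubound; right; exists y.
move: E0 gE Ed; case: (E d) => [s| |] // E0 gE sm.
by exists s, d.
Qed.

End upper_limit.

Unset Implicit Arguments.

Theorem theorem4p6 (R : realType) (alpha : R) (r a : R -> R) (b : R -> R -> R)
    (alpha_gt0 : 0 < alpha)
    (r_cont : {within halfline, continuous r})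
    (r_gt0 : forall x : R, 0 < x -> 0 < r x)
    (r_int0 :
      (\int[lebesgue_measure]_(s in `]0%R, 1%R[) ((r s)^-1)%:E = +oo)%E)
    (r_intoo :
      (\int[lebesgue_measure]_(s in `]1%R, +oo[) ((r s)^-1)%:E = +oo)%E)
    (r_lin : (ereal_sup [set (r z / z)%:E | z in halfline] < +oo)%E)
    (a_loc : locally_integrable halfline a)
    (a_ge0 : forall y : R, 0 < y -> 0 <= a y)
    (b_meas : measurable_fun ((halfline : set R) `*` (halfline : set R)) (fun z : R * R => b z.1 z.2))
    (b_ge0 : forall x y : R, 0 < x -> 0 < y -> 0 <= b x y)
    (b_supp : forall x y : R, 0 < x -> 0 < y -> y <= x -> b x y = 0)
    (b_mass : forall y : R, 0 < y ->
      (\int[lebesgue_measure]_(x in `]0%R, y[) (x * b x y)%:E = y%:E)%E)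
    (n_bnd : (ereal_sup [set moment_ratio alpha b y | y in halfline] < +oo)%E) :
  let D := transport_dom alpha r a in
  let T := transport_gen alpha r a in
  let B := frag alpha a b in
  [/\ rel_bounded D T (frag_dom alpha a b) B,
      (\forall l \near +oo%R, resolvent_set D T l) /\
      let N l := opnorm (B \o resolvent D T l) in
      cvg (N l @[l --> +oo%R]) /\
      (lim (N l @[l --> +oo%R]) <= limsup_rate a (moment_ratio alpha b))%E &
      (limsup_rate a (moment_ratio alpha b) < 1)%E ->
      exists V : R -> Xspace alpha -> Xspace alpha,
        [/\ C0_semigroup V,
            forall t : R, 0 <= t -> positive_op (V t) &
            generates D (fun f => T f + B f) V]].
Proof.
have alpha_ge0 := ltW alpha_gt0.
have [C rP] := growth_rate_of r_cont r_gt0 r_int0 r_intoo r_lin.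
have [S S0 S_bnd] := ereal_sup_bound n_bnd.
pose omega := growth_bound alpha C.
move=> D T B; split.
- exact: (frag_rel_bounded alpha_ge0 rP a_loc a_ge0 b_meas b_ge0 b_supp S0 S_bnd).
- split.
    near=> l; exists (@transport_resolvent R alpha r a l).
    by apply: (transport_resolventP alpha_ge0 rP a_loc a_ge0); near: l; apply: nbhs_pinfty_gt; rewrite num_real.
  split; first exact: (frag_opnorm_cvg alpha_ge0 rP a_loc a_ge0 b_meas b_ge0 b_supp S0 S_bnd).
  apply: limsup_rate_ge => s c s0 c0 sc.
  exact: (lim_frag_opnorm_le alpha_ge0 rP a_loc a_ge0 b_meas b_ge0 b_supp S0 S_bnd s0 c0 sc).
move=> /limsup_rate_lt[s [c [s0 s1 c0 sc]]].
(* from w on, c * S / (l - omega) is at most (1 - s) / 2 *)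
pose w := omega + 1 + 2 * (c * S) / (1 - s).
have p1 : 0 < 1 - s by rewrite subr_gt0.
have p2 : 0 <= 2 * (c * S) / (1 - s) by rewrite divr_ge0 ?(ltW p1) // !mulr_ge0.
have ow l : w <= l -> omega < l.
  by apply: lt_le_trans; rewrite /w -addrA ltrDl ltr_pwDl.
have K_bnd l f : w <= l -> `|B (@transport_resolvent R alpha r a l f)| <= (1 + s) / 2 * `|f|.
  move=> wl; have ol := ow l wl.
  apply: le_trans (frag_resolvent_bnd alpha_ge0 rP a_loc a_ge0 b_meas b_ge0 b_supp S0 S_bnd f s0 c0 sc ol) _.
  rewrite ler_wpM2r //.
  have : c * S / (l - omega) <= (1 - s) / 2.
    rewrite ler_pdivrMr ?subr_gt0 // -ler_pdivrMl ?divr_gt0 // invf_div mulrAC.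
    by move: wl; rewrite /w; move: (2 * (c * S) / (1 - s)) => k; lra.
  by rewrite -/omega; move: (c * S / (l - omega)) => k; lra.
apply: (@positive_perturbation R (L1 (weighted alpha)) (@L1_nneg _ _ _ _)
  (@L1_integral _ _ _ _) D T B (@transport_resolvent R alpha r a) w ((1 + s) / 2)).
- exact: L1_complete.
- exact: L1_nneg_closed.
- by apply: (ae_imply (L1_fun0 _)) => x ->.
- by move=> f g f0 g0; rewrite -[f]scale1r; exact: L1_nneg_lin.
- move=> k f k0 f0; apply: (ae_imply2 f0 (L1_funZ k f)) => x fx ->; exact: mulr_ge0.
- exact: L1_integral_lin.
- exact: L1_integral_le.
- exact: L1_integral_nneg.
- exact: L1_split.
- exact: (transport_dom_dense alpha_ge0 rP a_loc a_ge0).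
- by move=> l /ow; exact: (transport_resolventP alpha_ge0 rP a_loc a_ge0).
- by move=> l f /ow; exact: (resolvent_nneg alpha_ge0 rP a_loc a_ge0).
- by move=> l /ow; exact: (frag_resolvent_lin alpha_ge0 rP a_loc a_ge0 b_meas b_ge0 b_supp S0 S_bnd).
- exact: K_bnd.
- move=> l f /ow; exact: (frag_resolvent_nneg alpha_ge0 rP a_loc a_ge0 b_meas b_ge0 b_supp S0 S_bnd).
- by rewrite divr_ge0 // addr_ge0.
- by move: s1; lra.
- move=> v Dv v0; apply: le_trans (transport_growth alpha_ge0 rP a_loc a_ge0 Dv v0) _.
  by rewrite ler_wpM2r ?(L1_integral_nneg v0) // ltW // ow.
Unshelve. all: by end_near. Qed.
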